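(* Let $(\phi_t)$ be a parabolic semigroup of zero hyperbolic step in $\mathbb{D}$ with Denjoy-Wolff point $\tau\in \partial \mathbb{D}$ and Koenigs function $h$. Assume that $h(\mathbb{D})$ contains a vertical Euclidean sector. Then for every $z\in \mathbb{D}$ the trajectory $\phi_t(z)$ converges non-tangentially to $\tau$ as $t\to+\infty$. In other words, the slope of $(\phi_t)$ is a set $[a,b]$ with $-\pi/2<a\leq b<\pi/2$.
   Context: $\mathbb{D}=\{z\in\mathbb{C}:|z|<1\}$. A semigroup in $\mathbb{D}$ is a family $(\phi_t)_{t\ge0}$ of holomorphic self-maps of $\mathbb{D}$ with $\phi_0=\mathrm{id}$, $\phi_{s+t}=\phi_s\circ\phi_t$, and $t\mapsto\phi_t$ continuous for uniform convergence on compacta. If it is not a group of hyperbolic rotations, there is a unique $\tau\in\overline{\mathbb{D}}$, the Denjoy-Wolff point, with $\lim_{t\to+\infty}\phi_t(z)=\tau$ for all $z\in\mathbb{D}$. $(\phi_t)$ is parabolic of zero hyperbolic step if and only if there is a univalent (injective holomorphic) function $h:\mathbb{D}\to\mathbb{C}$ such that $h(\mathbb{D})$ is starlike at infinity (i.e. $h(\mathbb{D})+it\subset h(\mathbb{D})$ for all $t\ge 0$), $h(\phi_t(z))=h(z)+it$ for all $t\ge0$, $z\in\mathbb{D}$, and for every $w\in\mathbb{C}$ there is $t_0\ge0$ with $w+it_0\in h(\mathbb{D})$. Such an $h$ (essentially unique) is the Koenigs function of $(\phi_t)$. A vertical Euclidean sector is a set $p+\{z\in\mathbb{C}:\operatorname{Im}z>k|\operatorname{Re}z|\}$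 with $p\in\mathbb{C}$, $k>0$. The trajectory $\phi_t(z)$ converges non-tangentially to $\tau$ if it converges to $\tau$ and there is $A>1$ such that $|\tau-\phi_t(z)|<A(1-|\phi_t(z)|)$ for all $t$ large enough. The slope of $(\phi_t)$ is the cluster set of $\operatorname{Arg}(1-\overline{\tau}\phi_t(z))$ as $t\to+\infty$, a compact subset of $[-\pi/2,\pi/2]$ which does not depend on $z\in\mathbb{D}$. *)

(* Defs.v *)
From Stdlib Require Import Reals Lra List.
From Coquelicot Require Import Coquelicot.
Open Scope R_scope.

(* Maps of the disc are total functions [C -> C]; nothing is ever required of
   their values off the disc, nor of a semigroup at negative times. *)
Definition unit_disc (z : C) : Prop := Cmod z < 1.

Definition unit_circle (z : C) : Prop := Cmod z = 1.

Definition holomorphic_on_disc (f : C -> C) : Prop :=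
  forall z, unit_disc z -> ex_derive (K := C_AbsRing) (V := C_NormedModule) f z.

Definition compact_set (K : C -> Prop) : Prop :=
  forall (I : Type) (U : I -> C -> Prop),
    (forall i, open (U i)) ->
    (forall z, K z -> exists i, U i z) ->
    exists l : list I, forall z, K z -> exists i, In i l /\ U i z.

Record holomorphic_semigroup (phi : R -> C -> C) : Prop := {
  hs_holomorphic : forall t, 0 <= t -> holomorphic_on_disc (phi t);
  hs_self_map : forall t z, 0 <= t -> unit_disc z -> unit_disc (phi t z);
  hs_zero : forall z, unit_disc z -> phi 0 z = z;
  hs_add : forall s t z, 0 <= s -> 0 <= t -> unit_disc z ->
    phi (s + t) z = phi s (phi t z);
  hs_continuous : forall K : C -> Prop,
    compact_set K -> (forall z, K z -> unit_disc z) ->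
    forall t, 0 <= t -> forall eps : posreal, exists delta : posreal,
      forall s, 0 <= s -> Rabs (s - t) < delta ->
      forall z, K z -> Cmod (phi s z - phi t z) < eps
}.

(* A group of hyperbolic rotations (the identity included) satisfies this for
   no [tau], so it need not be excluded separately. *)
Definition denjoy_wolff_point (phi : R -> C -> C) (tau : C) : Prop :=
  Cmod tau <= 1 /\
  forall z, unit_disc z ->
    filterlim (fun t => phi t z) (Rbar_locally p_infty) (locally tau).

Definition disc_image (h : C -> C) (w : C) : Prop :=
  exists z, unit_disc z /\ h z = w.

Definition univalent (h : C -> C) : Prop :=
  holomorphic_on_disc h /\
  forall z1 z2, unit_disc z1 -> unit_disc z2 -> h z1 = h z2 -> z1 = z2.

Definition starlike_at_infinity (Omega : C -> Prop) : Prop :=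
  forall t w, 0 <= t -> Omega w -> Omega (w + Ci * RtoC t)%C.

(* Koenigs function in the parabolic, zero hyperbolic step case: the last
   field says that the translates [h(D) - i t] exhaust the whole plane. *)
Record koenigs_function (phi : R -> C -> C) (h : C -> C) : Prop := {
  kf_univalent : univalent h;
  kf_starlike : starlike_at_infinity (disc_image h);
  kf_conjugation : forall t z, 0 <= t -> unit_disc z ->
    h (phi t z) = (h z + Ci * RtoC t)%C;
  kf_exhaust : forall w : C, exists t0, 0 <= t0 /\
    disc_image h (w + Ci * RtoC t0)%C
}.

Definition parabolic_zero_hyperbolic_step (phi : R -> C -> C) : Prop :=
  holomorphic_semigroup phi /\ exists h, koenigs_function phi h.

Definition vertical_sector (p : C) (k : R) (w : C) : Prop :=
  Im (w - p)%C > k * Rabs (Re (w - p)%C).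

Definition contains_vertical_sector (Omega : C -> Prop) : Prop :=
  exists (p : C) (k : R), 0 < k /\
    forall w, vertical_sector p k w -> Omega w.

Definition converges_nontangentially (gamma : R -> C) (tau : C) : Prop :=
  filterlim gamma (Rbar_locally p_infty) (locally tau) /\
  exists A : R, 1 < A /\
    Rbar_locally p_infty
      (fun t => Cmod (tau - gamma t) < A * (1 - Cmod (gamma t))).

(* Principal argument, with values in ]-PI, PI]; a junk value at 0. *)
Definition Arg (z : C) : R :=
  if Rle_dec 0 (Im z) then acos (Re z / Cmod z) else - acos (Re z / Cmod z).

Lemma Arg_spec (z : C) : z <> 0 ->
  - PI < Arg z <= PI /\ z = (RtoC (Cmod z) * (cos (Arg z), sin (Arg z)))%C.
Proof.
  intros Hz.
  pose proof (proj1 (Cmod_gt_0 z) Hz) as Hr.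
  pose proof (Cmod2_alt z) as Hr2.
  set (r := Cmod z) in *. set (c := Re z / r).
  assert (Hc : Re z = r * c) by (unfold c; field; lra).
  assert (Hcb : -1 <= c <= 1).
  { pose proof (re_le_Cmod z) as H. fold r in H. apply Rabs_le_between in H.
    split; apply Rmult_le_reg_l with r; lra. }
  pose proof (acos_bound c) as Hb.
  assert (Hs : r * sqrt (1 - c²) = Rabs (Im z)).
  { rewrite <- (sqrt_Rsqr r) at 1 by lra. rewrite <- sqrt_mult_alt.
    - rewrite <- sqrt_Rsqr_abs. f_equal. unfold Rsqr. rewrite Hc in Hr2. nra.
    - apply Rle_0_sqr. }
  unfold Arg. fold r c.
  destruct (Rle_dec 0 (Im z)) as [Hi | Hi].
  - split; [pose proof PI_RGT_0; lra |].
    rewrite cos_acos, sin_acos by lra.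
    rewrite Rabs_pos_eq in Hs by lra.
    apply injective_projections; simpl; change (fst z) with (Re z);
      change (snd z) with (Im z); lra.
  - apply Rnot_le_lt in Hi. rewrite Rabs_left in Hs by lra.
    split.
    + destruct (Req_dec (acos c) PI) as [E | E]; [| pose proof PI_RGT_0; lra].
      exfalso. pose proof (sin_acos c Hcb) as H. rewrite E, sin_PI in H.
      rewrite <- H in Hs. lra.
    + rewrite cos_neg, sin_neg, cos_acos, sin_acos by lra.
      apply injective_projections; simpl; change (fst z) with (Re z);
        change (snd z) with (Im z); lra.
Qed.

Definition cluster_point_at_infinity (f : R -> R) (theta : R) : Prop :=
  forall (eps : posreal) (T : R), exists t, T <= t /\ Rabs (f t - theta) < eps.

(* The set does not in fact depend on [z]. *)
Definition slope (phi : R -> C -> C) (tau z : C) (theta : R) : Prop :=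
  cluster_point_at_infinity (fun t => Arg (1 - Cconj tau * phi t z)%C) theta.

(* Main.v *)
Require Import Defs.
From Stdlib Require Import Reals Lra Lia Classical ClassicalEpsilon.
From Coquelicot Require Import Coquelicot.
Open Scope R_scope.

(** The Cayley transform P(z) = (tau + z)/(tau - z) maps the disc onto the right
    half-plane and tau to infinity. Write P_t = P(phi_t(z)) = X_t + i Y_t. An
    orbit is non-tangential exactly when |P_t| <= K X_t for large t, and the
    slope is governed by the ratio Y_t / (X_t + 1), because
    Arg(1 - conj(tau) phi_t(z)) = - atan (Y_t / (X_t + 1)). So everything rests
    on a bound for |P_t| by X_t.

    Four facts enter, all of them forms of the Schwarz lemma.

    - Julia's lemma ([Re_cayley_nondecreasing]): Re P never decreases along the
      semigroup. Hence for every a >= 0 the function G_a = P o phi_a - P has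
      nonnegative real part on the disc.
    - Along an orbit h is a vertical line, and since h(D) contains a sector it
      contains discs of radius c t around the points h(z) + i t. As the inverse
      of h contracts hyperbolic distance ([inverse_contraction]), phi_s(z) and
      phi_t(z) are at pseudo-hyperbolic distance at most |s - t| / (c t).
    - h(D) is not the plane ([univalent_image_not_plane]), and as it is starlike
      at infinity it omits a whole half-line, whose complement is mapped into a
      half-plane by a square root. This gives an estimate in the opposite direction
      ([slit_distortion]): the distance of phi_t(z) and phi_(t+a)(z) is at least
      a constant times a / t, for t large and a <= t.
    - Harnack's inequality ([harnack]), applied to P and to the functions G_a.

    The heart is [increment_direction]. Take a = lam t with lam small and compare
    the increments g_j = P_(t+(j+1)a) - P_(t+ja) = G_a(phi_(t+ja)(z)). By Harnack,
    g_N differs from g_0 by at most a constant times Re g_0. If Re g_0 were tiny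
    compared with |g_0|, then g_N would be about g_0 and X would hardly grow up
    to the time t + N a. But |g_N| is at most a constant times X_(t+Na) / N,
    whereas |g_0| is at least a constant times X_t: for N large this is absurd.
    Hence |P_(t+a) - P_t| <= K (X_(t+a) - X_t), and summing over the times
    t, (1 + lam) t, (1 + lam)^2 t, and so on gives |P_t| <= K' X_t
    ([cayley_orbit_sectorial]).

    For two points z, z' the quantities P_t(z) and P_t(z') differ by o(X_t), so
    all orbits have the same slope; it is a compact interval because it is the
    cluster set of a bounded continuous function.

    The Schwarz lemma itself is derived from the maximum principle, which comes
    from the mean value property of functions that are only assumed to be complex
    differentiable. That property is Goursat's theorem for rectangles applied to
    f o exp, since the exponential wraps a rectangle of height 2 pi around an
    annulus. *)

(** * Induction on boxes of the plane *)

Lemma nested_intervals (a b : nat -> R) :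
  (forall n, a n <= b n) -> (forall n, a n <= a (S n)) ->
  (forall n, b (S n) <= b n) -> exists x, forall n, a n <= x <= b n.
Proof.
  intros Hab Ha Hb.
  assert (Ham : forall n k, a n <= a (n + k)%nat).
  { intros n k; induction k as [|k IH].
    - rewrite Nat.add_0_r; lra.
    - rewrite Nat.add_succ_r; specialize (Ha (n + k)%nat); lra. }
  assert (Hbm : forall n k, b (n + k)%nat <= b n).
  { intros n k; induction k as [|k IH].
    - rewrite Nat.add_0_r; lra.
    - rewrite Nat.add_succ_r; specialize (Hb (n + k)%nat); lra. }
  assert (Hle : forall m n, a m <= b n).
  { intros m n. pose proof (Ham m n). pose proof (Hbm n m).
    rewrite (Nat.add_comm n m) in H0. pose proof (Hab (m + n)%nat). lra. }
  destruct (completeness (fun x => exists n, x = a n)) as [x [Hub Hlub]].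
  - exists (b 0%nat); intros y [n ->]; apply Hle.
  - exists (a 0%nat); now exists 0%nat.
  - exists x; intros n; split.
    + apply Hub; now exists n.
    + apply Hlub; intros y [m ->]; apply Hle.
Qed.

Definition in_box (a b c d : R) (z : C) : Prop :=
  a <= Re z <= b /\ c <= Im z <= d.

(** A property of boxes that passes from the four quarters to the whole and
    holds for all small boxes around each point holds everywhere: otherwise a
    sequence of nested bad quarters shrinks to a point. This one principle yields
    both Goursat's theorem and all the compactness used below. *)
Lemma box_induction (P : R -> R -> R -> R -> Prop) :
  (forall a b c d, a <= b -> c <= d ->
     P a ((a + b) / 2) c ((c + d) / 2) -> P ((a + b) / 2) b c ((c + d) / 2) ->
     P a ((a + b) / 2) ((c + d) / 2) d -> P ((a + b) / 2) b ((c + d) / 2) d ->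
     P a b c d) ->
  forall a b c d, a <= b -> c <= d ->
  (forall z, in_box a b c d z -> exists delta, 0 < delta /\
     forall a' b' c' d', in_box a' b' c' d' z ->
       a <= a' -> b' <= b -> c <= c' -> d' <= d ->
       b' - a' < delta -> d' - c' < delta -> P a' b' c' d') ->
  P a b c d.
Proof.
  intros Hsplit a b c d Hab Hcd Hloc.
  apply NNPP; intros Hbad.
  (* A box is a pair of intervals; [half i] is the lower or upper half of one. *)
  set (half := fun (i : bool) (I : R * R) =>
    if i then ((fst I + snd I) / 2, snd I) else (fst I, (fst I + snd I) / 2)).
  set (good := fun B : (R * R) * (R * R) => fst (fst B) <= snd (fst B) /\
    fst (snd B) <= snd (snd B) /\
    ~ P (fst (fst B)) (snd (fst B)) (fst (snd B)) (snd (snd B))).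
  assert (Hstep : forall B, exists ij : bool * bool,
    good B -> good (half (fst ij) (fst B), half (snd ij) (snd B))).
  { intros [[x y] [u v]]; unfold good; simpl.
    destruct (classic (x <= y /\ u <= v /\ ~ P x y u v)) as [[H1 [H2 H3]]|H];
      [|exists (true, true); tauto].
    apply NNPP; intros Hn; apply H3; apply Hsplit; trivial; apply NNPP;
    intros Hq; apply Hn;
    [exists (false, false)|exists (true, false)|exists (false, true)|
     exists (true, true)]; intros _; simpl; repeat split; trivial; lra. }
  apply choice in Hstep; destruct Hstep as [ch Hch].
  set (step := fun B : (R * R) * (R * R) =>
    (half (fst (ch B)) (fst B), half (snd (ch B)) (snd B))).
  set (u := fix u n := match n with O => ((a, b), (c, d)) | S n => step (u n) end).
  assert (Hu : forall n, good (u n)).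
  { induction n as [|n IH]; [simpl; unfold good; simpl; tauto|].
    simpl; unfold step; apply Hch, IH. }
  assert (Hhalf : forall i I, fst I <= snd I ->
    fst I <= fst (half i I) /\ snd (half i I) <= snd I /\
    snd (half i I) - fst (half i I) = (snd I - fst I) / 2).
  { intros [] [x y]; simpl; intros; lra. }
  assert (Hs1 : forall n, fst (fst (u n)) <= fst (fst (u (S n))) /\
    snd (fst (u (S n))) <= snd (fst (u n)) /\
    snd (fst (u (S n))) - fst (fst (u (S n))) = (snd (fst (u n)) - fst (fst (u n))) / 2).
  { intros n; simpl; apply Hhalf; apply Hu. }
  assert (Hs2 : forall n, fst (snd (u n)) <= fst (snd (u (S n))) /\
    snd (snd (u (S n))) <= snd (snd (u n)) /\
    snd (snd (u (S n))) - fst (snd (u (S n))) = (snd (snd (u n)) - fst (snd (u n))) / 2).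
  { intros n; simpl; apply Hhalf; apply Hu. }
  destruct (nested_intervals (fun n => fst (fst (u n))) (fun n => snd (fst (u n))))
    as [x Hx]; try (intros n; first [apply Hu|apply Hs1]).
  destruct (nested_intervals (fun n => fst (snd (u n))) (fun n => snd (snd (u n))))
    as [y Hy]; try (intros n; first [apply Hu|apply Hs2]).
  destruct (Hloc (x, y)) as [delta [Hd HP]].
  { split; simpl; [apply (Hx 0%nat)|apply (Hy 0%nat)]. }
  assert (Hin : forall n, a <= fst (fst (u n)) /\ snd (fst (u n)) <= b /\
    c <= fst (snd (u n)) /\ snd (snd (u n)) <= d).
  { induction n as [|n IH]; [simpl; lra|].
    specialize (Hs1 n); specialize (Hs2 n). lra. }
  assert (Hw : forall n, snd (fst (u n)) - fst (fst (u n)) = (b - a) * (1/2)^n /\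
    snd (snd (u n)) - fst (snd (u n)) = (d - c) * (1/2)^n).
  { induction n as [|n IH]; [simpl; lra|].
    specialize (Hs1 n); specialize (Hs2 n).
    change ((1/2)^(S n)) with (1/2 * (1/2)^n). lra. }
  destruct (pow_lt_1_zero (1/2)) with (y := delta / (b - a + d - c + 1)) as [N HN].
  { rewrite Rabs_pos_eq; lra. }
  { apply Rdiv_lt_0_compat; lra. }
  specialize (HN N (le_n N)).
  rewrite Rabs_pos_eq in HN by (apply pow_le; lra).
  assert (Hp : 0 < (1/2)^N) by (apply pow_lt; lra).
  assert (HN' : (b - a + d - c + 1) * (1/2)^N < delta).
  { apply Rmult_lt_compat_l with (r := b - a + d - c + 1) in HN; [|lra].
    replace ((b - a + d - c + 1) * (delta / (b - a + d - c + 1))) with delta in HN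
      by (field; lra). exact HN. }
  destruct (Hu N) as [_ [_ Hnot]]; apply Hnot.
  destruct (Hin N) as [? [? [? ?]]]; destruct (Hw N) as [W1 W2].
  assert (0 <= (b - a) * (1/2)^N) by (apply Rmult_le_pos; lra).
  assert (0 <= (d - c) * (1/2)^N) by (apply Rmult_le_pos; lra).
  apply HP; trivial; [split; simpl; [apply Hx|apply Hy]| |]; nra.
Qed.

(** * Continuity and complex differentiability *)

Definition near (z : C) (P : C -> Prop) : Prop :=
  exists d, 0 < d /\ forall y, Cmod (y - z)%C < d -> P y.

Lemma near_and z P Q : near z P -> near z Q -> near z (fun y => P y /\ Q y).
Proof.
  intros [d [Hd HP]] [e [He HQ]]; exists (Rmin d e); split.
  - now apply Rmin_glb_lt.
  - intros y Hy; split; [apply HP|apply HQ]; eapply Rlt_le_trans; eauto;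
      [apply Rmin_l|apply Rmin_r].
Qed.

Lemma near_imp z (P Q : C -> Prop) : (forall y, P y -> Q y) -> near z P -> near z Q.
Proof. intros H [d [Hd HP]]; exists d; auto. Qed.

Lemma near_self z P : near z P -> P z.
Proof.
  intros [d [Hd HP]]; apply HP. replace (z - z)%C with (RtoC 0) by ring.
  now rewrite Cmod_0.
Qed.

Lemma Cmod_sub_sym x y : Cmod (x - y)%C = Cmod (y - x)%C.
Proof. rewrite <- (Cmod_opp (x - y)). f_equal; ring. Qed.

Lemma Cmod_tri x y z : Cmod (x - z)%C <= Cmod (x - y)%C + Cmod (y - z)%C.
Proof. replace (x - z)%C with ((x - y) + (y - z))%C by ring. apply Cmod_triangle. Qed.

Lemma Cmod_tri_le x y : Cmod x <= Cmod y + Cmod (x - y)%C.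
Proof. replace x with (y + (x - y))%C at 1 by ring. apply Cmod_triangle. Qed.

Definition ccont (f : C -> C) (z : C) : Prop :=
  forall eps, 0 < eps -> near z (fun y => Cmod (f y - f z)%C < eps).

(** Caratheodory's form of the derivative: the rules of calculus become algebra
    with the continuous difference quotient [q], and a quotient of two functions
    vanishing at [z] extends continuously by the quotient of their [q]'s. *)
Definition cderiv (f : C -> C) (z l : C) : Prop :=
  exists q, ccont q z /\ q z = l /\
    near z (fun y => f y - f z = q y * (y - z))%C.

Definition cdiff (f : C -> C) (z : C) : Prop := exists l, cderiv f z l.

Lemma ccont_ext f g z : near z (fun y => f y = g y) -> ccont f z -> ccont g z.
Proof.
  intros He Hf eps Heps. rewrite <- (near_self _ _ He).
  eapply near_imp; [|exact (near_and _ _ _ He (Hf eps Heps))].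
  intros y [<- H]; exact H.
Qed.

Lemma ccont_const k z : ccont (fun _ => k) z.
Proof.
  intros eps He; exists 1; split; [lra|]; intros y _.
  replace (k - k)%C with (RtoC 0) by ring. now rewrite Cmod_0.
Qed.

Lemma ccont_id z : ccont (fun y => y) z.
Proof. intros eps He; exists eps; auto. Qed.

Lemma ccont_plus f g z : ccont f z -> ccont g z -> ccont (fun y => f y + g y)%C z.
Proof.
  intros Hf Hg eps He.
  eapply near_imp; [|exact (near_and _ _ _ (Hf (eps/2) ltac:(lra)) (Hg (eps/2) ltac:(lra)))].
  intros y [H1 H2]; simpl in *.
  replace (f y + g y - (f z + g z))%C with ((f y - f z) + (g y - g z))%C by ring.
  eapply Rle_lt_trans; [apply Cmod_triangle|lra].
Qed.

Lemma ccont_mult f g z : ccont f z -> ccont g z -> ccont (fun y => f y * g y)%C z.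
Proof.
  intros Hf Hg eps He.
  pose proof (Cmod_ge_0 (f z)) as Pf. pose proof (Cmod_ge_0 (g z)) as Pg.
  set (M := Cmod (f z) + Cmod (g z) + 1).
  assert (HM : 0 < M) by (unfold M; lra).
  set (e := Rmin 1 (eps / (2 * M))).
  assert (He0 : 0 < e).
  { apply Rmin_glb_lt; [lra|]. apply Rdiv_lt_0_compat; lra. }
  assert (He1 : e <= 1) by apply Rmin_l.
  assert (He2 : e * (2 * M) <= eps).
  { replace eps with (eps / (2 * M) * (2 * M)) by (field; lra).
    apply Rmult_le_compat_r; [lra|apply Rmin_r]. }
  eapply near_imp; [|exact (near_and _ _ _ (Hf e He0) (Hg e He0))].
  intros y [H1 H2]; simpl in *.
  replace (f y * g y - f z * g z)%C
    with ((f y - f z) * (g y - g z) + (f y - f z) * g z + f z * (g y - g z))%C by ring.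
  eapply Rle_lt_trans; [apply Cmod_triangle|].
  eapply Rle_lt_trans; [apply Rplus_le_compat_r, Cmod_triangle|].
  rewrite !Cmod_mult.
  pose proof (Cmod_ge_0 (f y - f z)). pose proof (Cmod_ge_0 (g y - g z)).
  assert (Cmod (f y - f z) * Cmod (g y - g z) <= e * 1) by (apply Rmult_le_compat; lra).
  assert (Cmod (f y - f z) * Cmod (g z) <= e * Cmod (g z))
    by (apply Rmult_le_compat_r; lra).
  assert (Cmod (f z) * Cmod (g y - g z) <= Cmod (f z) * e)
    by (apply Rmult_le_compat_l; lra).
  unfold M in He2. nra.
Qed.

Lemma ccont_comp f g z : ccont f z -> ccont g (f z) -> ccont (fun y => g (f y)) z.
Proof.
  intros Hf Hg eps He.
  destruct (Hg eps He) as [d [Hd Hd']].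
  eapply near_imp; [|exact (Hf d Hd)]. intros y Hy; now apply Hd'.
Qed.

Lemma Cneq0_near f z : ccont f z -> f z <> RtoC 0 -> near z (fun y => f y <> RtoC 0).
Proof.
  intros Hf Hz. apply Cmod_gt_0 in Hz.
  eapply near_imp; [|exact (Hf _ Hz)]. intros y Hy E; simpl in Hy.
  rewrite E in Hy. replace (RtoC 0 - f z)%C with (- f z)%C in Hy by ring.
  rewrite Cmod_opp in Hy; lra.
Qed.

Lemma ccont_inv z : z <> RtoC 0 -> ccont Cinv z.
Proof.
  intros Hz eps He. pose proof (proj1 (Cmod_gt_0 z) Hz) as Pz.
  set (d := Rmin (Cmod z / 2) (eps * (Cmod z * Cmod z) / 2)).
  exists d; split.
  - apply Rmin_glb_lt; [lra|]. apply Rdiv_lt_0_compat; [|lra].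
    apply Rmult_lt_0_compat; nra.
  - intros y Hy.
    assert (Hy1 : Cmod (y - z) < Cmod z / 2)
      by (eapply Rlt_le_trans; [exact Hy|apply Rmin_l]).
    assert (Hy2 : Cmod (y - z) < eps * (Cmod z * Cmod z) / 2)
      by (eapply Rlt_le_trans; [exact Hy|apply Rmin_r]).
    pose proof (Cmod_tri_le z y) as Ht. rewrite Cmod_sub_sym in Ht.
    assert (Hm : Cmod z / 2 < Cmod y) by lra.
    assert (Hy0 : y <> RtoC 0) by (apply Cmod_gt_0; lra).
    replace (/ y - / z)%C with ((z - y) / (y * z))%C
      by (field; split; assumption).
    rewrite Cmod_div by (apply Cmult_neq_0; assumption).
    rewrite Cmod_mult, Cmod_sub_sym.
    assert (Hyz : Cmod z * Cmod z / 2 < Cmod y * Cmod z) by nra.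
    apply Rmult_lt_reg_r with (Cmod y * Cmod z); [nra|].
    unfold Rdiv; rewrite Rmult_assoc, Rinv_l by nra.
    apply Rmult_lt_compat_l with (r := eps) in Hyz; lra.
Qed.

Lemma ccont_opp f z : ccont f z -> ccont (fun y => - f y)%C z.
Proof.
  intros H. apply ccont_ext with (fun y => (RtoC (-1)) * f y)%C.
  - exists 1; split; [lra|]; intros; apply injective_projections; simpl; ring.
  - apply ccont_mult; [apply ccont_const|exact H].
Qed.

Lemma ccont_minus f g z : ccont f z -> ccont g z -> ccont (fun y => f y - g y)%C z.
Proof. intros; apply ccont_plus; [assumption|now apply ccont_opp]. Qed.

Lemma cderiv_cont f z l : cderiv f z l -> ccont f z.
Proof.
  intros [q [Hq [_ He]]].
  apply ccont_ext with (fun y => f z + q y * (y - z))%C.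
  - eapply near_imp; [|exact He]. intros y H; simpl in H; rewrite <- H; ring.
  - apply ccont_plus; [apply ccont_const|apply ccont_mult; [exact Hq|]].
    apply ccont_minus; [apply ccont_id|apply ccont_const].
Qed.

Lemma cdiff_cont f z : cdiff f z -> ccont f z.
Proof. intros [l H]; exact (cderiv_cont _ _ _ H). Qed.

Lemma near_all z (P : C -> Prop) : (forall y, P y) -> near z P.
Proof. intros H; exists 1; split; [lra|auto]. Qed.

Lemma cderiv_ext f g z l :
  near z (fun y => f y = g y) -> cderiv f z l -> cderiv g z l.
Proof.
  intros He [q [Hq [Hl Hd]]]; exists q; repeat split; trivial.
  rewrite <- (near_self _ _ He).
  eapply near_imp; [|exact (near_and _ _ _ He Hd)].
  intros y [<- H]; exact H.
Qed.

Lemma cdiff_ext f g z : near z (fun y => f y = g y) -> cdiff f z -> cdiff g z.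
Proof. intros He [l H]; exists l; exact (cderiv_ext _ _ _ _ He H). Qed.

Lemma cderiv_const k z : cderiv (fun _ => k) z (RtoC 0).
Proof.
  exists (fun _ => RtoC 0); repeat split; [apply ccont_const|].
  apply near_all; intros; ring.
Qed.

Lemma cderiv_id z : cderiv (fun y => y) z (RtoC 1).
Proof.
  exists (fun _ => RtoC 1); repeat split; [apply ccont_const|].
  apply near_all; intros; ring.
Qed.

Lemma cderiv_plus f g z l m :
  cderiv f z l -> cderiv g z m -> cderiv (fun y => f y + g y)%C z (l + m)%C.
Proof.
  intros [q [Hq [Hl Hd]]] [p [Hp [Hm Hd']]].
  exists (fun y => q y + p y)%C; repeat split; [now apply ccont_plus|congruence|].
  eapply near_imp; [|exact (near_and _ _ _ Hd Hd')].
  intros y [H1 H2]; simpl in *.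
  replace (f y + g y - (f z + g z))%C with ((f y - f z) + (g y - g z))%C by ring.
  rewrite H1, H2; ring.
Qed.

Lemma cderiv_mult f g z l m :
  cderiv f z l -> cderiv g z m ->
  cderiv (fun y => f y * g y)%C z (l * g z + f z * m)%C.
Proof.
  intros [q [Hq [Hl Hd]]] [p [Hp [Hm Hd']]].
  exists (fun y => q y * (g z + p y * (y - z)) + f z * p y)%C; repeat split.
  - apply ccont_plus; apply ccont_mult; trivial; try apply ccont_const.
    apply ccont_plus; [apply ccont_const|apply ccont_mult; trivial].
    apply ccont_minus; [apply ccont_id|apply ccont_const].
  - rewrite Hl, Hm; ring.
  - eapply near_imp; [|exact (near_and _ _ _ Hd Hd')].
    intros y [H1 H2]; simpl in *.
    replace (f y * g y - f z * g z)%C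
      with ((f y - f z) * (g z + (g y - g z)) + f z * (g y - g z))%C by ring.
    rewrite H1, H2; ring.
Qed.

Lemma cderiv_comp f g z l m :
  cderiv f z l -> cderiv g (f z) m -> cderiv (fun y => g (f y)) z (m * l)%C.
Proof.
  intros Hf. pose proof (cderiv_cont _ _ _ Hf) as Cf. revert Hf.
  intros [q [Hq [Hl Hd]]] [p [Hp [Hm [e [He Hd']]]]].
  exists (fun y => p (f y) * q y)%C; repeat split.
  - apply ccont_mult; [now apply ccont_comp|exact Hq].
  - congruence.
  - eapply near_imp; [|exact (near_and _ _ _ Hd (Cf e He))].
    intros y [H1 H2]; simpl in *. rewrite Hd' by exact H2. rewrite H1; ring.
Qed.

Lemma cderiv_inv z : z <> RtoC 0 -> cderiv Cinv z (- / (z * z))%C.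
Proof.
  intros Hz. exists (fun y => - (/ y * / z))%C; repeat split.
  - apply ccont_opp, ccont_mult; [now apply ccont_inv|apply ccont_const].
  - field; exact Hz.
  - eapply near_imp; [|exact (Cneq0_near _ _ (ccont_id z) Hz)].
    intros y Hy; simpl. field; now split.
Qed.

Lemma cdiff_const k z : cdiff (fun _ => k) z.
Proof. eexists; apply cderiv_const. Qed.
Lemma cdiff_id z : cdiff (fun y => y) z.
Proof. eexists; apply cderiv_id. Qed.
Lemma cdiff_plus f g z : cdiff f z -> cdiff g z -> cdiff (fun y => f y + g y)%C z.
Proof. intros [l Hl] [m Hm]; eexists; apply cderiv_plus; eassumption. Qed.
Lemma cdiff_mult f g z : cdiff f z -> cdiff g z -> cdiff (fun y => f y * g y)%C z.
Proof. intros [l Hl] [m Hm]; eexists; apply cderiv_mult; eassumption. Qed.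
Lemma cdiff_comp f g z : cdiff f z -> cdiff g (f z) -> cdiff (fun y => g (f y)) z.
Proof. intros [l Hl] [m Hm]; eexists; eapply cderiv_comp; eassumption. Qed.
Lemma cdiff_inv f z : cdiff f z -> f z <> RtoC 0 -> cdiff (fun y => / f y)%C z.
Proof. intros H Hz; apply (cdiff_comp f Cinv); [exact H|eexists; now apply cderiv_inv]. Qed.
Lemma cdiff_div f g z :
  cdiff f z -> cdiff g z -> g z <> RtoC 0 -> cdiff (fun y => f y / g y)%C z.
Proof. intros; apply cdiff_mult; [assumption|now apply cdiff_inv]. Qed.
Lemma cdiff_minus f g z : cdiff f z -> cdiff g z -> cdiff (fun y => f y - g y)%C z.
Proof.
  intros Hf Hg.
  apply cdiff_ext with (fun y => f y + RtoC (-1) * g y)%C.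
  - apply near_all; intros y; apply injective_projections; simpl; ring.
  - apply cdiff_plus; [exact Hf|apply cdiff_mult; [apply cdiff_const|exact Hg]].
Qed.

Lemma cderiv_of_bound f z l :
  (forall eps, 0 < eps -> near z (fun y =>
     Cmod (f y - f z - l * (y - z))%C <= eps * Cmod (y - z)%C)) -> cderiv f z l.
Proof.
  intros H.
  exists (fun y => if Ceq_dec y z then l else ((f y - f z) / (y - z))%C).
  repeat split.
  - intros eps He. destruct (H (eps/2) ltac:(lra)) as [d [Hd Hb]].
    exists d; split; [exact Hd|]; intros y Hy.
    destruct (Ceq_dec z z) as [_|n]; [|now elim n].
    destruct (Ceq_dec y z) as [_|n].
    + replace (l - l)%C with (RtoC 0) by ring. now rewrite Cmod_0.
    + specialize (Hb y Hy).
      assert (Hn : (y - z)%C <> RtoC 0).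
      { intros E; apply n. replace y with ((y - z) + z)%C by ring. rewrite E; ring. }
      replace ((f y - f z) / (y - z) - l)%C
        with ((f y - f z - l * (y - z)) / (y - z))%C by (field; exact Hn).
      rewrite Cmod_div by exact Hn. apply Cmod_gt_0 in Hn.
      apply Rle_lt_trans with (eps / 2); [|lra].
      apply Rmult_le_reg_r with (Cmod (y - z)); [exact Hn|].
      unfold Rdiv; rewrite Rmult_assoc, Rinv_l by lra. lra.
  - destruct (Ceq_dec z z) as [_|n]; [reflexivity|now elim n].
  - apply near_all; intros y. destruct (Ceq_dec y z) as [->|n].
    + ring.
    + field. intros E; apply n. replace y with ((y - z) + z)%C by ring. rewrite E; ring.
Qed.

Lemma cderiv_bound f z l : cderiv f z l ->
  forall eps, 0 < eps -> near z (fun y =>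
     Cmod (f y - f z - l * (y - z))%C <= eps * Cmod (y - z)%C).
Proof.
  intros [q [Hq [Hl Hd]]] eps He.
  eapply near_imp; [|exact (near_and _ _ _ Hd (Hq eps He))].
  intros y [H1 H2]; simpl in *. rewrite H1, <- Hl.
  replace (q y * (y - z) - q z * (y - z))%C with ((q y - q z) * (y - z))%C by ring.
  rewrite Cmod_mult. apply Rmult_le_compat_r; [apply Cmod_ge_0|lra].
Qed.

Lemma ex_derive_cdiff (f : C -> C) z :
  ex_derive (K := C_AbsRing) (V := C_NormedModule) f z -> cdiff f z.
Proof.
  intros [l [_ H]]; exists l; apply cderiv_of_bound; intros eps He.
  specialize (H z (fun P HP => HP) (mkposreal eps He)).
  destruct H as [d H]; exists d; split; [apply cond_pos|].
  intros y Hy. specialize (H y Hy). simpl in H.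
  unfold norm, minus, plus, opp, scal in H; simpl in H.
  unfold mult in H; simpl in H.
  replace (f y - f z - l * (y - z))%C with (f y + - f z + - ((y + - z) * l))%C by ring.
  exact H.
Qed.

(** * The complex exponential *)

Lemma Cmod_le_abs z : Cmod z <= Rabs (Re z) + Rabs (Im z).
Proof.
  pose proof (Rabs_pos (Re z)). pose proof (Rabs_pos (Im z)).
  apply Rsqr_incr_0_var; [|lra].
  rewrite !Rsqr_pow2, Cmod2_alt, <- (pow2_abs (Re z)), <- (pow2_abs (Im z)). nra.
Qed.

Lemma im_le_Cmod z : Rabs (Im z) <= Cmod z.
Proof. eapply Rle_trans; [apply Rmax_r|apply Rmax_Cmod]. Qed.

Definition cexp (z : C) : C := (exp (Re z) * cos (Im z), exp (Re z) * sin (Im z)).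

Lemma cexp_add x y : cexp (x + y)%C = (cexp x * cexp y)%C.
Proof.
  destruct x as [x1 x2], y as [y1 y2].
  unfold cexp; apply injective_projections; simpl;
    rewrite exp_plus, ?cos_plus, ?sin_plus; ring.
Qed.

Lemma Cmod_cexp z : Cmod (cexp z) = exp (Re z).
Proof.
  pose proof (exp_pos (Re z)). apply Rsqr_inj; [apply Cmod_ge_0|lra|].
  rewrite Rsqr_pow2, Cmod2_alt; simpl.
  pose proof (sin2_cos2 (Im z)) as Hsc. unfold Rsqr in *.
  transitivity (exp (Re z) * exp (Re z) * (sin (Im z) * sin (Im z) + cos (Im z) * cos (Im z)));
    [ring|rewrite Hsc; ring].
Qed.

Lemma derivable_bound f x l : derivable_pt_lim f x l ->
  forall eps, 0 < eps -> exists d, 0 < d /\ forall h, Rabs h < d ->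
    Rabs (f (x + h) - f x - l * h) <= eps * Rabs h.
Proof.
  intros H eps He; destruct (H eps He) as [d Hd]; exists d; split; [apply cond_pos|].
  intros h Hh. destruct (Req_dec h 0) as [->|Hn].
  - rewrite Rplus_0_r. replace (f x - f x - l * 0) with 0 by ring.
    rewrite Rabs_R0; lra.
  - specialize (Hd h Hn Hh).
    replace (f (x + h) - f x - l * h) with (((f (x + h) - f x) / h - l) * h)
      by (field; exact Hn).
    rewrite Rabs_mult. apply Rmult_le_compat_r; [apply Rabs_pos|lra].
Qed.

Lemma cderiv_cexp_0 : cderiv cexp (RtoC 0) (RtoC 1).
Proof.
  apply cderiv_of_bound; intros eps He.
  set (e := Rmin (eps / 9) 1).
  assert (He0 : 0 < e) by (apply Rmin_glb_lt; lra).
  assert (He1 : e <= 1) by apply Rmin_r.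
  assert (He2 : e <= eps / 9) by apply Rmin_l.
  destruct (derivable_bound exp 0 1 derivable_pt_lim_exp_0 e He0) as [d1 [Hd1 Hexp]].
  pose proof (derivable_pt_lim_sin 0) as Ds. rewrite cos_0 in Ds.
  destruct (derivable_bound sin 0 1 Ds e He0) as [d2 [Hd2 Hsin]].
  pose proof (derivable_pt_lim_cos 0) as Dc. rewrite sin_0 in Dc.
  destruct (derivable_bound cos 0 (- 0) Dc e He0) as [d3 [Hd3 Hcos]].
  exists (Rmin (Rmin d1 d2) (Rmin d3 e)); split.
  { repeat apply Rmin_glb_lt; lra. }
  intros [x t] Hy.
  replace ((x, t) - RtoC 0)%C with ((x, t) : C) in *
    by (apply injective_projections; simpl; ring).
  pose proof (re_le_Cmod (x, t)) as Hx. pose proof (im_le_Cmod (x, t)) as Ht.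
  simpl in Hx, Ht.
  apply Rmin_Rgt in Hy; destruct Hy as [Hy1 Hy2].
  apply Rmin_Rgt in Hy1; apply Rmin_Rgt in Hy2.
  specialize (Hexp x ltac:(lra)); specialize (Hsin t ltac:(lra));
  specialize (Hcos t ltac:(lra)).
  rewrite Rplus_0_l in *. rewrite exp_0 in Hexp. rewrite sin_0 in Hsin.
  rewrite cos_0 in Hcos.
  replace (cos t - 1 - - 0 * t) with (cos t - 1) in Hcos by ring.
  replace (sin t - 0 - 1 * t) with (sin t - t) in Hsin by ring.
  rewrite Rmult_1_l in Hexp.
  pose proof (Rabs_pos x). pose proof (Rabs_pos t).
  assert (Hex1 : Rabs (exp x - 1) <= 2 * Rabs x).
  { replace (exp x - 1) with ((exp x - 1 - x) + x) by ring.
    eapply Rle_trans; [apply Rabs_triang|]. nra. }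
  assert (Hex3 : Rabs (exp x) <= 3).
  { replace (exp x) with (1 + (exp x - 1)) by ring.
    eapply Rle_trans; [apply Rabs_triang|]. rewrite Rabs_R1. lra. }
  eapply Rle_trans; [apply Cmod_le_abs|].
  assert (Hre : Re (cexp (x, t) - cexp (RtoC 0) - RtoC 1 * (x, t))%C
    = exp x * (cos t - 1) + (exp x - 1 - x)).
  { unfold cexp, Re, Im; simpl; rewrite exp_0, cos_0; ring. }
  assert (Him : Im (cexp (x, t) - cexp (RtoC 0) - RtoC 1 * (x, t))%C
    = exp x * (sin t - t) + (exp x - 1) * t).
  { unfold cexp, Re, Im; simpl; rewrite exp_0, sin_0; ring. }
  rewrite Hre, Him.
  assert (Rabs (exp x * (cos t - 1) + (exp x - 1 - x)) <= 3 * (e * Rabs t) + e * Rabs x).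
  { eapply Rle_trans; [apply Rabs_triang|]. apply Rplus_le_compat; [|exact Hexp].
    rewrite Rabs_mult. apply Rmult_le_compat; trivial; apply Rabs_pos. }
  assert (Rabs (exp x * (sin t - t) + (exp x - 1) * t)
          <= 3 * (e * Rabs t) + (2 * e) * Rabs t).
  { eapply Rle_trans; [apply Rabs_triang|]. rewrite !Rabs_mult.
    apply Rplus_le_compat; apply Rmult_le_compat; trivial; try apply Rabs_pos; try lra. }
  nra.
Qed.

Lemma cderiv_cexp z : cderiv cexp z (cexp z).
Proof.
  apply cderiv_ext with (fun y => cexp z * cexp (y - z))%C.
  { apply near_all; intros y. rewrite <- cexp_add. f_equal; ring. }
  assert (H : cderiv (fun y => cexp z * cexp (y - z))%C z
    (RtoC 0 * cexp (z - z) + cexp z * (RtoC 1 * RtoC 1))%C).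
  { apply (cderiv_mult (fun _ => cexp z) (fun y => cexp (y - z))%C); [apply cderiv_const|].
    apply (cderiv_comp (fun y => y - z)%C cexp).
    - replace (RtoC 1) with (RtoC 1 + RtoC 0)%C by ring.
      apply cderiv_plus; [apply cderiv_id|apply (cderiv_const (- z)%C)].
    - replace (z - z)%C with (RtoC 0) by ring. apply cderiv_cexp_0. }
  replace (RtoC 0 * cexp (z - z) + cexp z * (RtoC 1 * RtoC 1))%C with (cexp z) in H
    by ring.
  exact H.
Qed.

(** * Goursat's theorem for rectangles *)

Lemma ccont_continuous_horizontal E s c :
  ccont E (s, c) ->
  continuous (fun x => Re (E (x, c))) s /\ continuous (fun x => Im (E (x, c))) s.
Proof.
  intros HE; split; apply continuity_pt_filterlim; intros eps He;
  destruct (HE eps He) as [d [Hd H]]; exists d; (split; [exact Hd|]);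
  intros x [_ Hx]; simpl in *; unfold R_dist in *.
  all: assert (Hm : Cmod ((x, c) - (s, c)) < d) by
   (replace ((x, c) - (s, c))%C with (RtoC (x - s))
      by (apply injective_projections; simpl; ring); rewrite Cmod_R; exact Hx).
  all: specialize (H _ Hm); eapply Rle_lt_trans; [|exact H].
  - exact (re_le_Cmod (E (x, c) - E (s, c))%C).
  - exact (im_le_Cmod (E (x, c) - E (s, c))%C).
Qed.

Lemma ccont_continuous_vertical E s c :
  ccont E (s, c) ->
  continuous (fun x => Re (E (s, x))) c /\ continuous (fun x => Im (E (s, x))) c.
Proof.
  intros HE; split; apply continuity_pt_filterlim; intros eps He;
  destruct (HE eps He) as [d [Hd H]]; exists d; (split; [exact Hd|]);
  intros x [_ Hx]; simpl in *; unfold R_dist in *.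
  all: assert (Hm : Cmod ((s, x) - (s, c)) < d) by
   (replace ((s, x) - (s, c))%C with (Ci * RtoC (x - c))%C
      by (apply injective_projections; simpl; ring);
    rewrite Cmod_mult, Cmod_Ci, Cmod_R, Rmult_1_l; exact Hx).
  all: specialize (H _ Hm); eapply Rle_lt_trans; [|exact H].
  - exact (re_le_Cmod (E (s, x) - E (s, c))%C).
  - exact (im_le_Cmod (E (s, x) - E (s, c))%C).
Qed.

Definition cont_box (E : C -> C) a b c d := forall z, in_box a b c d z -> ccont E z.

(** This is the real part of the integral of [E] along the boundary of the
    rectangle. *)
Definition rect_int (E : C -> C) (a b c d : R) : R :=
  RInt (fun s => Re (E (s, c)) - Re (E (s, d))) a b
  - RInt (fun t => Im (E (b, t)) - Im (E (a, t))) c d.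

Lemma ex_RInt_horizontal E a b c d x y u v :
  cont_box E a b c d -> a <= x <= y -> y <= b -> c <= u <= d -> c <= v <= d ->
  ex_RInt (fun s => Re (E (s, u)) - Re (E (s, v))) x y.
Proof.
  intros H ? ? ? ?. apply (@ex_RInt_continuous R_CompleteNormedModule).
  rewrite Rmin_left, Rmax_right by lra. intros s Hs.
  apply (continuous_minus (V := R_NormedModule));
    apply ccont_continuous_horizontal; apply H; split; simpl; lra.
Qed.

Lemma ex_RInt_vertical E a b c d x y u v :
  cont_box E a b c d -> c <= x <= y -> y <= d -> a <= u <= b -> a <= v <= b ->
  ex_RInt (fun t => Im (E (u, t)) - Im (E (v, t))) x y.
Proof.
  intros H ? ? ? ?. apply (@ex_RInt_continuous R_CompleteNormedModule).
  rewrite Rmin_left, Rmax_right by lra. intros s Hs.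
  apply (continuous_minus (V := R_NormedModule));
    apply ccont_continuous_vertical; apply H; split; simpl; lra.
Qed.

Lemma RInt_sum_ext (f g h : R -> R) a b :
  ex_RInt g a b -> ex_RInt h a b -> (forall x, f x = g x + h x) ->
  RInt f a b = RInt g a b + RInt h a b.
Proof.
  intros Hg Hh He. rewrite (RInt_ext f (fun x => plus (g x) (h x))).
  - apply (@RInt_plus R_CompleteNormedModule); assumption.
  - intros; apply He.
Qed.

Lemma rect_int_split E a b c d m n :
  cont_box E a b c d -> a <= m <= b -> c <= n <= d ->
  rect_int E a b c d = rect_int E a m c n + rect_int E m b c n
    + rect_int E a m n d + rect_int E m b n d.
Proof.
  intros H Hm Hn. unfold rect_int.
  assert (Eh : forall x y, a <= x <= y -> y <= b ->
    RInt (fun s => Re (E (s, c)) - Re (E (s, d))) x y =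
    RInt (fun s => Re (E (s, c)) - Re (E (s, n))) x y +
    RInt (fun s => Re (E (s, n)) - Re (E (s, d))) x y).
  { intros x y Hx Hy. apply RInt_sum_ext; try (eapply ex_RInt_horizontal; eauto; lra).
    intros; ring. }
  assert (Ev : forall x y, c <= x <= y -> y <= d ->
    RInt (fun t => Im (E (b, t)) - Im (E (a, t))) x y =
    RInt (fun t => Im (E (m, t)) - Im (E (a, t))) x y +
    RInt (fun t => Im (E (b, t)) - Im (E (m, t))) x y).
  { intros x y Hx Hy. apply RInt_sum_ext; try (eapply ex_RInt_vertical; eauto; lra).
    intros; ring. }
  rewrite <- (RInt_Chasles (fun s => Re (E (s, c)) - Re (E (s, d))) a m b)
    by (eapply ex_RInt_horizontal; eauto; lra).
  rewrite <- (RInt_Chasles (fun t => Im (E (b, t)) - Im (E (a, t))) c n d)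
    by (eapply ex_RInt_vertical; eauto; lra).
  unfold plus; simpl.
  rewrite (Eh a m), (Eh m b), (Ev c n), (Ev n d) by lra. ring.
Qed.

Lemma RInt_near_const f a b m e :
  a <= b -> ex_RInt f a b -> (forall x, a < x < b -> Rabs (f x - m) <= e) ->
  Rabs (RInt f a b - m * (b - a)) <= e * (b - a).
Proof.
  intros Hab Hf He.
  assert (H1 : RInt f a b <= RInt (fun _ => m + e) a b).
  { apply RInt_le; trivial; [apply ex_RInt_const|].
    intros x Hx; specialize (He x Hx); apply Rabs_le_between in He; lra. }
  assert (H2 : RInt (fun _ => m - e) a b <= RInt f a b).
  { apply RInt_le; trivial; [apply ex_RInt_const|].
    intros x Hx; specialize (He x Hx); apply Rabs_le_between in He; lra. }
  rewrite RInt_const in H1, H2. unfold scal in H1, H2; simpl in H1, H2.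
  unfold mult in H1, H2; simpl in H1, H2.
  apply Rabs_le_between. lra.
Qed.

Lemma Cmod_in_box a b c d z w :
  in_box a b c d z -> in_box a b c d w -> Cmod (w - z)%C <= (b - a) + (d - c).
Proof.
  intros [H1 H2] [H3 H4]. eapply Rle_trans; [apply Cmod_le_abs|].
  replace (Re (w - z)) with (Re w - Re z) by reflexivity.
  replace (Im (w - z)) with (Im w - Im z) by reflexivity.
  apply Rplus_le_compat; apply Rabs_le_between; lra.
Qed.

(** Boundary integrals of affine functions vanish, so only the error of the
    affine approximation contributes: it is at most [e] times the diameter,
    integrated over a path of comparable length. *)
Lemma rect_int_small E a b c d z l e :
  a <= b -> c <= d -> in_box a b c d z -> cont_box E a b c d ->
  (forall w, in_box a b c d w ->
     Cmod (E w - E z - l * (w - z))%C <= e * Cmod (w - z)%C) -> 0 <= e ->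
  Rabs (rect_int E a b c d) <= 2 * e * ((b - a) + (d - c)) ^ 2.
Proof.
  intros Hab Hcd Hz Hcont Hl He.
  set (L := (b - a) + (d - c)).
  assert (Hb : forall w, in_box a b c d w ->
    Cmod (E w - E z - l * (w - z))%C <= e * L).
  { intros w Hw; eapply Rle_trans; [now apply Hl|].
    apply Rmult_le_compat_l; [exact He|]. now apply Cmod_in_box. }
  assert (H1 : Rabs (RInt (fun s => Re (E (s, c)) - Re (E (s, d))) a b
    - (Im l * (d - c)) * (b - a)) <= 2 * (e * L) * (b - a)).
  { apply RInt_near_const; [lra|eapply ex_RInt_horizontal; eauto; lra|].
    intros s Hs.
    pose proof (Hb (s, c) ltac:(split; simpl; lra)) as B1.
    pose proof (Hb (s, d) ltac:(split; simpl; lra)) as B2.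
    replace (Re (E (s, c)) - Re (E (s, d)) - Im l * (d - c))
      with (Re (E (s, c) - E z - l * ((s, c) - z))%C
            - Re (E (s, d) - E z - l * ((s, d) - z))%C) by (unfold Re, Im; simpl; ring).
    pose proof (re_le_Cmod (E (s, c) - E z - l * ((s, c) - z))%C) as R1.
    pose proof (re_le_Cmod (E (s, d) - E z - l * ((s, d) - z))%C) as R2.
    eapply Rle_trans; [apply Rabs_triang|]. rewrite Rabs_Ropp. lra. }
  assert (H2 : Rabs (RInt (fun t => Im (E (b, t)) - Im (E (a, t))) c d
    - (Im l * (b - a)) * (d - c)) <= 2 * (e * L) * (d - c)).
  { apply RInt_near_const; [lra|eapply ex_RInt_vertical; eauto; lra|].
    intros s Hs.
    pose proof (Hb (b, s) ltac:(split; simpl; lra)) as B1.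
    pose proof (Hb (a, s) ltac:(split; simpl; lra)) as B2.
    replace (Im (E (b, s)) - Im (E (a, s)) - Im l * (b - a))
      with (Im (E (b, s) - E z - l * ((b, s) - z))%C
            - Im (E (a, s) - E z - l * ((a, s) - z))%C) by (unfold Re, Im; simpl; ring).
    pose proof (im_le_Cmod (E (b, s) - E z - l * ((b, s) - z))%C) as R1.
    pose proof (im_le_Cmod (E (a, s) - E z - l * ((a, s) - z))%C) as R2.
    eapply Rle_trans; [apply Rabs_triang|]. rewrite Rabs_Ropp. lra. }
  unfold rect_int. apply Rabs_le_between in H1. apply Rabs_le_between in H2.
  apply Rabs_le_between. unfold L in *. nra.
Qed.

(** Under quadrisection the integral is additive and the squared perimeter is
    divided by four, so the local bound e L^2 of [rect_int_small] propagates to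
    the whole rectangle, for every e. *)
Lemma goursat E a b c d :
  a <= b -> c <= d -> (forall z, in_box a b c d z -> cdiff E z) ->
  rect_int E a b c d = 0.
Proof.
  intros Hab Hcd HE.
  assert (Hc : forall a' b' c' d', a <= a' -> b' <= b -> c <= c' -> d' <= d ->
    cont_box E a' b' c' d').
  { intros a' b' c' d' ? ? ? ? z [? ?]. apply cdiff_cont, HE; split; lra. }
  set (L := (b - a) + (d - c)).
  assert (Hall : forall e, 0 < e -> Rabs (rect_int E a b c d) <= e * L ^ 2).
  { intros e He.
    refine (box_induction (fun a' b' c' d' => a <= a' -> b' <= b -> c <= c' -> d' <= d ->
      Rabs (rect_int E a' b' c' d') <= e * ((b' - a') + (d' - c')) ^ 2)
      _ a b c d Hab Hcd _ _ _ _ _); try lra.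
    - intros a' b' c' d' Ha Hc' P1 P2 P3 P4 ? ? ? ?.
      rewrite (rect_int_split E a' b' c' d' ((a' + b') / 2) ((c' + d') / 2));
        [|now apply Hc|lra|lra].
      specialize (P1 ltac:(lra) ltac:(lra) ltac:(lra) ltac:(lra)).
      specialize (P2 ltac:(lra) ltac:(lra) ltac:(lra) ltac:(lra)).
      specialize (P3 ltac:(lra) ltac:(lra) ltac:(lra) ltac:(lra)).
      specialize (P4 ltac:(lra) ltac:(lra) ltac:(lra) ltac:(lra)).
      replace (b' - (a' + b') / 2) with ((b' - a') / 2) in * by lra.
      replace ((a' + b') / 2 - a') with ((b' - a') / 2) in * by lra.
      replace (d' - (c' + d') / 2) with ((d' - c') / 2) in * by lra.
      replace ((c' + d') / 2 - c') with ((d' - c') / 2) in * by lra.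
      replace (e * ((b' - a') / 2 + (d' - c') / 2) ^ 2)
        with (e * (b' - a' + (d' - c')) ^ 2 / 4) in * by field.
      eapply Rle_trans; [apply Rabs_triang|].
      eapply Rle_trans; [apply Rplus_le_compat_r, Rabs_triang|].
      eapply Rle_trans; [apply Rplus_le_compat_r, Rplus_le_compat_r, Rabs_triang|].
      lra.
    - intros z Hz. destruct (HE z Hz) as [l Hl].
      destruct (cderiv_bound _ _ _ Hl (e / 2) ltac:(lra)) as [dl [Hdl Hb]].
      exists (dl / 2); split; [lra|].
      intros a' b' c' d' Hz' Ha Hb' Hc' Hd' Hs1 Hs2 _ _ _ _.
      replace e with (2 * (e / 2)) by lra.
      destruct Hz' as [? ?].
      apply rect_int_small with z l; try lra; [split; lra|now apply Hc|].
      intros w Hw. apply Hb.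
      eapply Rle_lt_trans; [apply Cmod_in_box with (1 := conj H H0) (2 := Hw)|lra]. }
  apply NNPP; intros Hn. apply Rabs_pos_lt in Hn.
  assert (HL : 0 <= L ^ 2) by apply pow2_ge_0.
  set (J := Rabs (rect_int E a b c d)) in *. set (Q := L ^ 2) in *.
  clearbody J Q.
  assert (Hq : J / (2 * (Q + 1)) * Q < J).
  { apply Rmult_lt_reg_r with (2 * (Q + 1)); [lra|].
    replace (J / (2 * (Q + 1)) * Q * (2 * (Q + 1))) with (J * Q) by (field; lra).
    nra. }
  assert (H : 0 < J / (2 * (Q + 1))) by (apply Rdiv_lt_0_compat; lra).
  specialize (Hall _ H). lra.
Qed.

(** * The mean value property *)

(** The circle of radius [exp s], so that circles become vertical segments in
    the plane of the logarithm. *)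
Definition circle_point (z0 : C) (s t : R) : C := (z0 + cexp (s, t))%C.

Lemma Cmod_circle_point z0 s t : Cmod (circle_point z0 s t - z0)%C = exp s.
Proof.
  unfold circle_point. replace (z0 + cexp (s, t) - z0)%C with (cexp (s, t)) by ring.
  apply Cmod_cexp.
Qed.

Lemma circle_point_neq z0 s t : circle_point z0 s t <> z0.
Proof.
  intros E. pose proof (Cmod_circle_point z0 s t) as H. rewrite E in H.
  replace (z0 - z0)%C with (RtoC 0) in H by ring. rewrite Cmod_0 in H.
  pose proof (exp_pos s); lra.
Qed.

Lemma cdiff_circle_point f z0 s t :
  cdiff f (circle_point z0 s t) -> cdiff (fun w => f (z0 + cexp w)%C) (s, t).
Proof.
  intros H. apply (cdiff_comp (fun w => z0 + cexp w)%C f); [|exact H].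
  apply cdiff_plus; [apply cdiff_const|eexists; apply cderiv_cexp].
Qed.

(** In the variables (s, t) the function is periodic of period 2 pi in t, so in
    Goursat's theorem the horizontal sides cancel and the mean over the circle of
    radius [exp s] does not depend on s; it tends to the value at the centre as s
    tends to minus infinity. The centre corresponds to no point of the rectangles,
    which is why continuity there is enough. *)
Lemma mean_value f z0 S :
  ccont f z0 -> (forall z, z <> z0 -> Cmod (z - z0)%C < exp S -> cdiff f z) ->
  forall s, s < S ->
  RInt (fun t => Re (f (circle_point z0 s t))) 0 (2 * PI) = 2 * PI * Re (f z0).
Proof.
  intros Hc Hd.
  (* The factor i makes the vertical sides of [rect_int E] carry Re f. *)
  set (E := fun w => (Ci * f (z0 + cexp w))%C).
  pose proof PI_RGT_0 as Hpi.
  assert (HE : forall s t, s < S -> cdiff E (s, t)).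
  { intros s t Hs. apply cdiff_mult; [apply cdiff_const|]. apply cdiff_circle_point, Hd.
    - apply circle_point_neq.
    - rewrite Cmod_circle_point. now apply exp_increasing. }
  assert (Hint : forall s, s < S -> ex_RInt (fun t => Re (f (circle_point z0 s t))) 0 (2 * PI)).
  { intros s Hs. apply (@ex_RInt_continuous R_CompleteNormedModule). intros t _.
    apply (ccont_continuous_vertical (fun w => f (z0 + cexp w)%C)).
    apply cdiff_cont, cdiff_circle_point, Hd; [apply circle_point_neq|].
    rewrite Cmod_circle_point. now apply exp_increasing. }
  assert (Heq : forall a b, a <= b -> b < S ->
    RInt (fun t => Re (f (circle_point z0 a t))) 0 (2 * PI)
    = RInt (fun t => Re (f (circle_point z0 b t))) 0 (2 * PI)).
  { intros a b Hab Hb.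
    assert (G : rect_int E a b 0 (2 * PI) = 0).
    { apply goursat; try lra. intros [x y] [Hx _]; simpl in Hx; apply HE; lra. }
    unfold rect_int in G.
    rewrite (RInt_ext _ (fun _ => 0)) in G.
    2:{ intros x _. unfold E, cexp; simpl. rewrite cos_2PI, sin_2PI, cos_0, sin_0. ring. }
    rewrite RInt_const in G. unfold scal in G; simpl in G; unfold mult in G; simpl in G.
    rewrite (RInt_ext _ (fun t => minus (Re (f (circle_point z0 b t))) (Re (f (circle_point z0 a t)))))
      in G.
    2:{ intros t _. unfold E, circle_point, minus, plus, opp; simpl. unfold Re. ring. }
    rewrite (@RInt_minus R_CompleteNormedModule) in G by (apply Hint; lra).
    unfold minus, plus, opp in G; simpl in G. lra. }
  intros s Hs.
  apply cond_eq; intros eps Heps.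
  destruct (Hc (eps / (4 * PI)) ltac:(apply Rdiv_lt_0_compat; lra)) as [d [Hd0 Hb]].
  set (a := Rmin s (ln (d / 2))).
  assert (Ha : a <= s) by apply Rmin_l.
  assert (Had : exp a < d).
  { apply Rle_lt_trans with (d / 2); [|lra].
    rewrite <- (exp_ln (d / 2)) by lra.
    assert (a <= ln (d / 2)) as [Hlt| ->] by apply Rmin_r; [|lra].
    left; now apply exp_increasing. }
  rewrite <- (Heq a s) by lra.
  pose proof (RInt_near_const (fun t => Re (f (circle_point z0 a t))) 0 (2 * PI) (Re (f z0))
    (eps / (4 * PI)) ltac:(lra) (Hint a ltac:(lra))) as Hn.
  rewrite Rminus_0_r in Hn.
  replace (eps / (4 * PI) * (2 * PI)) with (eps / 2) in Hn by (field; lra).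
  rewrite (Rmult_comm (2 * PI)). eapply Rle_lt_trans; [apply Hn|lra].
  intros t _.
  pose proof (Hb (circle_point z0 a t)) as Hbt. rewrite Cmod_circle_point in Hbt.
  left; eapply Rle_lt_trans; [|exact (Hbt Had)].
  exact (re_le_Cmod (f (circle_point z0 a t) - f z0)%C).
Qed.

(** Allowing an exceptional point [z0] where only continuity is known is what
    lets the maximum principle apply to quotients such as f(z)/z. *)
Lemma no_strict_local_max_Re k z0 :
  ccont k z0 ->
  near z0 (fun z => z <> z0 -> cdiff k z /\ Re (k z) < Re (k z0)) -> False.
Proof.
  intros Hc [d [Hd Hn]]. pose proof PI_RGT_0 as Hpi.
  assert (HS : exp (ln d) = d) by now apply exp_ln.
  pose proof (mean_value k z0 (ln d) Hc) as Hm.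
  rewrite HS in Hm. specialize (Hm (fun z H1 H2 => proj1 (Hn z H2 H1))).
  specialize (Hm (ln d - 1) ltac:(lra)).
  assert (Hlt : exp (ln d - 1) < d).
  { rewrite <- HS at 2. apply exp_increasing; lra. }
  assert (Hp : forall t, cdiff k (circle_point z0 (ln d - 1) t) /\
     Re (k (circle_point z0 (ln d - 1) t)) < Re (k z0)).
  { intros t; apply Hn; [rewrite Cmod_circle_point; exact Hlt|apply circle_point_neq]. }
  assert (H : RInt (fun t => Re (k (circle_point z0 (ln d - 1) t))) 0 (2 * PI)
    < RInt (fun _ => Re (k z0)) 0 (2 * PI)).
  { apply RInt_lt; [lra|intros; apply continuous_const| |intros; apply Hp].
    intros t _. apply (ccont_continuous_vertical (fun w => k (z0 + cexp w)%C)).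
    apply cdiff_cont, cdiff_circle_point, Hp. }
  rewrite RInt_const, Hm in H. unfold scal in H; simpl in H; unfold mult in H; simpl in H.
  lra.
Qed.

(** * The maximum principle *)

Definition cclosed (K : C -> Prop) := forall z, ~ K z -> near z (fun y => ~ K y).
Definition cbounded (K : C -> Prop) := exists M, forall z, K z -> Cmod z <= M.

Lemma Cmod_small_box a b c d z w e :
  in_box a b c d z -> in_box a b c d w -> b - a < e / 2 -> d - c < e / 2 ->
  Cmod (w - z)%C < e.
Proof.
  intros Hz Hw H1 H2. eapply Rle_lt_trans; [apply Cmod_in_box with (1 := Hz) (2 := Hw)|].
  lra.
Qed.

(** If no point were a maximum, each point would have a neighbourhood on which
    [Psi] stays below one of its values on [K], and [box_induction] would give a
    single value of [Psi] exceeding all of its values on [K]. *)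
Lemma attains_max (K : C -> Prop) (Psi : C -> R) :
  cclosed K -> cbounded K -> (exists z, K z) ->
  (forall z, K z -> forall eps, 0 < eps -> near z (fun y => Psi y < Psi z + eps)) ->
  exists z, K z /\ forall y, K y -> Psi y <= Psi z.
Proof.
  intros Hcl [M HM] [z0 Hz0] Husc. apply NNPP; intros Hno.
  assert (Hup : forall z, K z -> exists y, K y /\ Psi z < Psi y).
  { intros z Hz; apply NNPP; intros H; apply Hno; exists z; split; [exact Hz|].
    intros y Hy; apply Rnot_lt_le; intros Hlt; apply H; now exists y. }
  pose proof (HM _ Hz0) as HM0. pose proof (Cmod_ge_0 z0).
  assert (HB : exists y, K y /\ forall z, K z -> in_box (-M) M (-M) M z -> Psi z < Psi y).
  { apply (box_induction (fun a b c d =>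
      exists y, K y /\ forall z, K z -> in_box a b c d z -> Psi z < Psi y)); try lra.
    - intros a b c d _ _ [y1 [K1 H1]] [y2 [K2 H2]] [y3 [K3 H3]] [y4 [K4 H4]].
      assert (Hmax : exists y, K y /\ Psi y1 <= Psi y /\ Psi y2 <= Psi y /\
        Psi y3 <= Psi y /\ Psi y4 <= Psi y).
      { destruct (Rle_dec (Psi y1) (Psi y2)), (Rle_dec (Psi y3) (Psi y4)).
        - destruct (Rle_dec (Psi y2) (Psi y4)); [exists y4|exists y2]; repeat split; trivial; lra.
        - destruct (Rle_dec (Psi y2) (Psi y3)); [exists y3|exists y2]; repeat split; trivial; lra.
        - destruct (Rle_dec (Psi y1) (Psi y4)); [exists y4|exists y1]; repeat split; trivial; lra.
        - destruct (Rle_dec (Psi y1) (Psi y3)); [exists y3|exists y1]; repeat split; trivial; lra. }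
      destruct Hmax as [y [Ky [L1 [L2 [L3 L4]]]]]. exists y; split; [exact Ky|].
      intros z Kz [Hr Hi].
      destruct (Rle_dec (Re z) ((a + b) / 2)), (Rle_dec (Im z) ((c + d) / 2)).
      + eapply Rlt_le_trans; [apply H1|]; trivial; split; lra.
      + eapply Rlt_le_trans; [apply H3|]; trivial; split; lra.
      + eapply Rlt_le_trans; [apply H2|]; trivial; split; lra.
      + eapply Rlt_le_trans; [apply H4|]; trivial; split; lra.
    - intros z _. destruct (classic (K z)) as [Kz|Kz].
      + destruct (Hup z Kz) as [y [Ky Hy]].
        destruct (Husc z Kz (Psi y - Psi z) ltac:(lra)) as [e [He Hn]].
        exists (e / 2); split; [lra|]. intros a b c d Hb _ _ _ _ W1 W2.
        exists y; split; [exact Ky|]. intros w _ Hw.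
        specialize (Hn w (Cmod_small_box _ _ _ _ _ _ _ Hb Hw W1 W2)). lra.
      + destruct (Hcl z Kz) as [e [He Hn]].
        exists (e / 2); split; [lra|]. intros a b c d Hb _ _ _ _ W1 W2.
        exists z0; split; [exact Hz0|]. intros w Kw Hw.
        elim (Hn w (Cmod_small_box _ _ _ _ _ _ _ Hb Hw W1 W2) Kw). }
  destruct HB as [y [Ky HB]].
  apply (Rlt_irrefl (Psi y)), HB; [exact Ky|].
  specialize (HM y Ky).
  pose proof (re_le_Cmod y) as R1. pose proof (im_le_Cmod y) as R2.
  split; apply Rabs_le_between; lra.
Qed.

Lemma Cmod2_minus x y : Cmod (x - y)%C ^ 2 = Cmod x ^ 2 + Cmod y ^ 2 - 2 * Re (Cconj y * x)%C.
Proof. rewrite !Cmod2_alt. destruct x, y; unfold Re, Im; simpl. ring. Qed.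

Lemma near_Cmod_lt f g z :
  ccont f z -> ccont g z -> Cmod (f z) < Cmod (g z) ->
  near z (fun y => Cmod (f y) < Cmod (g y)).
Proof.
  intros Hf Hg Hlt. set (e := (Cmod (g z) - Cmod (f z)) / 2).
  assert (He : 0 < e) by (unfold e; lra).
  eapply near_imp; [|exact (near_and _ _ _ (Hf e He) (Hg e He))].
  intros y [H1 H2]; simpl in *.
  pose proof (Cmod_tri_le (f y) (f z)). pose proof (Cmod_tri_le (g z) (g y)).
  rewrite Cmod_sub_sym in H2. unfold e in *. lra.
Qed.

Lemma Cmod_usc f z : ccont f z ->
  forall eps, 0 < eps -> near z (fun y => Cmod (f y) ^ 2 < Cmod (f z) ^ 2 + eps).
Proof.
  intros Hf eps He. pose proof (Cmod_ge_0 (f z)) as P.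
  assert (Hc : near z (fun y => Cmod (f y * f y)%C < Cmod (RtoC (Cmod (f z) ^ 2 + eps)))).
  { apply (near_Cmod_lt (fun y => f y * f y)%C (fun _ => RtoC (Cmod (f z) ^ 2 + eps))).
    - now apply ccont_mult.
    - apply ccont_const.
    - rewrite Cmod_R, Rabs_pos_eq, Cmod_mult by nra. nra. }
  eapply near_imp; [|exact Hc]. intros y; simpl.
  rewrite Cmod_R, Rabs_pos_eq, Cmod_mult by nra. nra.
Qed.

(** Maximise |Q|^2 + eps |z|^2 rather than |Q|: an interior maximum [z] of it
    would be a strict local maximum of the real part of
    conj(Q z) Q + eps conj(z) id, because |u|^2 >= 2 Re(conj v u) - |v|^2 with
    defect |u - v|^2. So the maximum lies where |Q| <= M, and eps tends to 0. *)
Lemma max_principle K Q M :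
  cclosed K -> cbounded K -> 0 <= M -> (forall z, K z -> ccont Q z) ->
  (forall z, K z -> Cmod (Q z) <= M \/ near z (fun y => K y /\ (y <> z -> cdiff Q y))) ->
  forall z, K z -> Cmod (Q z) <= M.
Proof.
  intros Hcl Hbd HM Hc Hin w Kw.
  apply Rnot_lt_le; intros Hlt.
  destruct Hbd as [B HB].
  set (eps := (Cmod (Q w) ^ 2 - M ^ 2) / (B ^ 2 + 1)).
  assert (HB1 : 0 < B ^ 2 + 1) by (pose proof (pow2_ge_0 B); lra).
  assert (He : 0 < eps) by (apply Rdiv_lt_0_compat; nra).
  assert (HeB : eps * (B ^ 2 + 1) = Cmod (Q w) ^ 2 - M ^ 2).
  { unfold eps. generalize dependent (B ^ 2 + 1). intros; field; lra. }
  destruct (attains_max K (fun z => Cmod (Q z) ^ 2 + eps * Cmod z ^ 2)) as [z [Kz Hz]].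
  - exact Hcl.
  - now exists B.
  - now exists w.
  - intros z Kz e He'.
    assert (He2 : 0 < e / (2 * eps)) by (apply Rdiv_lt_0_compat; lra).
    eapply near_imp; [|exact (near_and _ _ _ (Cmod_usc Q z (Hc z Kz) (e / 2) ltac:(lra))
      (Cmod_usc _ z (ccont_id z) _ He2))].
    intros y [H1 H2]; simpl in H1, H2 |- *.
    apply Rmult_lt_compat_l with (r := eps) in H2; [|exact He].
    rewrite Rmult_plus_distr_l in H2.
    replace (eps * (e / (2 * eps))) with (e / 2) in H2 by (field; lra). lra.
  - destruct (Hin z Kz) as [Hb|Hi].
    + specialize (Hz w Kw). specialize (HB z Kz).
      pose proof (Cmod_ge_0 z). pose proof (Cmod_ge_0 (Q z)).
      assert (Cmod z ^ 2 <= B ^ 2) by (apply pow_incr; lra).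
      assert (Cmod (Q z) ^ 2 <= M ^ 2) by (apply pow_incr; lra).
      pose proof (pow2_ge_0 (Cmod w)). nra.
    + apply (no_strict_local_max_Re
        (fun y => Cconj (Q z) * Q y + RtoC eps * (Cconj z * y))%C z).
      * apply ccont_plus; repeat apply ccont_mult; try apply ccont_const;
          [now apply Hc|apply ccont_id].
      * eapply near_imp; [|exact Hi]. intros y [Ky Hy] Hne. split.
        -- apply cdiff_plus; repeat apply cdiff_mult; try apply cdiff_const;
             [now apply Hy|apply cdiff_id].
        -- specialize (Hz y Ky).
           assert (Hre : forall u v : C, Re (u + RtoC eps * v)%C = Re u + eps * Re v).
           { intros [u1 u2] [v1 v2]; unfold Re; simpl; ring. }
           rewrite !Hre.
           pose proof (Cmod2_minus (Q y) (Q z)) as E1.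
           pose proof (Cmod2_minus y z) as E2.
           assert (E3 : forall x, Re (Cconj x * x)%C = Cmod x ^ 2).
           { intros [x1 x2]; rewrite Cmod2_alt; unfold Re, Im; simpl; ring. }
           rewrite !E3.
           pose proof (pow2_ge_0 (Cmod (Q y - Q z))).
           assert (Hp : 0 < Cmod (y - z) ^ 2).
           { apply pow_lt, Cmod_gt_0. intros E; apply Hne.
             replace y with ((y - z) + z)%C by ring. rewrite E; ring. }
           assert (0 < eps * Cmod (y - z) ^ 2) by now apply Rmult_lt_0_compat.
           nra.
Qed.

Lemma near_neq z a : z <> a -> near z (fun y => y <> a).
Proof.
  intros H. eapply near_imp; [|apply (Cneq0_near (fun y => y - a)%C z)].
  - intros y Hy E; apply Hy; rewrite E; ring.
  - apply ccont_minus; [apply ccont_id|apply ccont_const].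
  - intros E; apply H. replace z with ((z - a) + a)%C by ring. rewrite E; ring.
Qed.

(** The common form of the Schwarz lemma and of its version for inverse
    functions: the maximum principle for N/D, continuously extended at the common
    zero [a]. *)
Lemma quotient_bound K N D a n l M :
  cclosed K -> cbounded K -> 0 <= M ->
  (forall z, K z -> cdiff N z /\ cdiff D z) ->
  cderiv N a n -> cderiv D a l -> N a = RtoC 0 -> D a = RtoC 0 -> l <> RtoC 0 ->
  (forall z, K z -> z <> a -> D z <> RtoC 0) ->
  (forall z, K z -> (z <> a /\ Cmod (N z) <= M * Cmod (D z)) \/ near z K) ->
  forall z, K z -> Cmod (N z) <= M * Cmod (D z).
Proof.
  intros Hcl Hbd HM Hd [qN [CN [En HN]]] [qD [CD [El HD]]] N0 D0 Hl HD0 Hbdry z Kz.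
  set (Q := fun y => if Ceq_dec y a then (qN a / qD a)%C else (N y / D y)%C).
  assert (HQ : forall y, y <> a -> Q y = (N y / D y)%C).
  { intros y Hy; unfold Q; destruct (Ceq_dec y a); [contradiction|reflexivity]. }
  assert (HQd : forall y, K y -> y <> a -> cdiff Q y).
  { intros y Ky Hy. apply cdiff_ext with (fun x => N x / D x)%C.
    - eapply near_imp; [|exact (near_neq _ _ Hy)]. intros x Hx; symmetry; now apply HQ.
    - apply cdiff_div; [apply Hd|apply Hd|apply HD0]; assumption. }
  assert (HQa : ccont Q a).
  { assert (HqD : qD a <> RtoC 0) by congruence.
    apply ccont_ext with (fun x => qN x * / qD x)%C.
    - eapply near_imp; [|exact (near_and _ _ _ (near_and _ _ _ HN HD) (Cneq0_near _ _ CD HqD))].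
      intros x [[H1 H2] H3]; simpl in *. unfold Q.
      destruct (Ceq_dec x a) as [->|Hx]; [reflexivity|].
      rewrite N0 in H1; rewrite D0 in H2.
      replace (N x) with (qN x * (x - a))%C by (rewrite <- H1; ring).
      replace (D x) with (qD x * (x - a))%C by (rewrite <- H2; ring).
      field. split; [|exact H3]. intros E; apply Hx.
      replace x with ((x - a) + a)%C by ring. rewrite E; ring.
    - apply ccont_mult; [exact CN|]. apply ccont_comp; [exact CD|now apply ccont_inv]. }
  destruct (Ceq_dec z a) as [->|Hza].
  { rewrite N0, D0, Cmod_0; lra. }
  assert (HQM : Cmod (Q z) <= M).
  { apply (max_principle K); trivial.
    - intros y Ky. destruct (Ceq_dec y a) as [->|Hy]; [exact HQa|].
      now apply cdiff_cont, HQd.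
    - intros y Ky. destruct (Hbdry y Ky) as [[Hy Hb]|Hi].
      + left. rewrite HQ by exact Hy. pose proof (HD0 y Ky Hy) as Hne.
        rewrite Cmod_div by exact Hne. apply Cmod_gt_0 in Hne.
        apply Rmult_le_reg_r with (Cmod (D y)); [exact Hne|].
        unfold Rdiv; rewrite Rmult_assoc, Rinv_l by lra. lra.
      + right. destruct (Ceq_dec y a) as [->|Hy].
        * eapply near_imp; [|exact Hi]. intros x Kx; split; [exact Kx|]. now apply HQd.
        * eapply near_imp; [|exact (near_and _ _ _ Hi (near_neq _ _ Hy))].
          intros x [Kx Hx]; split; [exact Kx|]. intros _; now apply HQd. }
  rewrite HQ in HQM by exact Hza. pose proof (HD0 z Kz Hza) as Hne.
  rewrite Cmod_div in HQM by exact Hne. apply Cmod_gt_0 in Hne.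
  apply Rmult_le_compat_r with (r := Cmod (D z)) in HQM; [|lra].
  unfold Rdiv in HQM; rewrite Rmult_assoc, Rinv_l in HQM by lra. lra.
Qed.

(** * The Schwarz-Pick lemma for maps into a half-plane *)

Definition moebius (a z : C) : C := ((z - a) / (1 - Cconj a * z))%C.

Lemma moebius_den_neq a z : Cmod a < 1 -> Cmod z < 1 -> (1 - Cconj a * z)%C <> RtoC 0.
Proof.
  intros Ha Hz E. pose proof (Cmod_tri_le (RtoC 1) (Cconj a * z)%C) as H.
  rewrite E, Cmod_0, Cmod_1, Cmod_mult, Cmod_conj in H.
  pose proof (Cmod_ge_0 a). pose proof (Cmod_ge_0 z). nra.
Qed.

(** The identity behind the invariance of the pseudo-hyperbolic distance. *)
Lemma moebius_den_identity a z : Cmod (1 - Cconj a * z)%C ^ 2 - Cmod (z - a)%C ^ 2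
  = (1 - Cmod a ^ 2) * (1 - Cmod z ^ 2).
Proof. rewrite !Cmod2_alt. destruct a, z; unfold Re, Im; simpl; ring. Qed.

Lemma pow2_le_inv x y : 0 <= y -> x ^ 2 <= y ^ 2 -> x <= y.
Proof. intros Hy H. apply Rnot_lt_le; intros Hlt. nra. Qed.

Lemma moebius_num_le_den a z : Cmod a < 1 -> Cmod z < 1 -> Cmod (z - a)%C <= Cmod (1 - Cconj a * z)%C.
Proof.
  intros Ha Hz. apply pow2_le_inv; [apply Cmod_ge_0|].
  pose proof (moebius_den_identity a z). pose proof (Cmod_ge_0 a). pose proof (Cmod_ge_0 z).
  assert (0 <= (1 - Cmod a ^ 2) * (1 - Cmod z ^ 2)) by (apply Rmult_le_pos; nra). lra.
Qed.

Lemma moebius_le_1 a z : Cmod a < 1 -> Cmod z < 1 -> Cmod (moebius a z) <= 1.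
Proof.
  intros Ha Hz. pose proof (moebius_den_neq a z Ha Hz) as Hn. unfold moebius.
  rewrite Cmod_div by exact Hn. apply Cmod_gt_0 in Hn.
  apply Rmult_le_reg_r with (Cmod (1 - Cconj a * z)); [exact Hn|].
  unfold Rdiv; rewrite Rmult_assoc, Rinv_l by lra.
  pose proof (moebius_num_le_den a z Ha Hz). lra.
Qed.

(** On the circle of radius [r] the pseudo-hyperbolic distance to [a] is least at
    the point on the ray through [a]; this least value tends to 1 as [r] tends
    to 1. *)
Lemma moebius_lower_bound a z r : Cmod a < r -> r < 1 -> Cmod z = r ->
  (r - Cmod a) * Cmod (1 - Cconj a * z)%C <= (1 - r * Cmod a) * Cmod (z - a)%C.
Proof.
  intros Ha Hr Hz. pose proof (Cmod_ge_0 a) as Pa.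
  apply pow2_le_inv.
  { apply Rmult_le_pos; [nra|apply Cmod_ge_0]. }
  rewrite !Rpow_mult_distr.
  pose proof (moebius_den_identity a z) as E1. rewrite Hz in E1.
  pose proof (Cmod2_minus z a) as E2. rewrite Hz in E2.
  pose proof (re_le_Cmod (Cconj a * z)%C) as Hx.
  rewrite Cmod_mult, Cmod_conj, Hz in Hx. apply Rabs_le_between in Hx.
  set (x := Re (Cconj a * z)%C) in *. set (al := Cmod a) in *.
  set (u := Cmod (1 - Cconj a * z)%C ^ 2) in *. set (v := Cmod (z - a)%C ^ 2) in *.
  clearbody x al u v.
  assert (Hu : u = v + (1 - al ^ 2) * (1 - r ^ 2)) by lra. subst u. subst v.
  assert (0 <= (al * r - x) * ((1 - al ^ 2) * (1 - r ^ 2))).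
  { apply Rmult_le_pos; [lra|apply Rmult_le_pos; nra]. }
  nra.
Qed.

Lemma cderiv_moebius a : Cmod a < 1 -> exists l, cderiv (moebius a) a l /\ l <> RtoC 0.
Proof.
  intros Ha. pose proof (moebius_den_neq a a Ha Ha) as Hn.
  exists ((RtoC 1 + RtoC 0) * / (1 - Cconj a * a) + (a - a) *
    (- / ((1 - Cconj a * a) * (1 - Cconj a * a)) *
     (RtoC 0 + (RtoC 0 * (Cconj a * a) + RtoC (-1) * (RtoC 0 * a + Cconj a * RtoC 1)))))%C.
  split.
  - unfold moebius, Cdiv. apply (cderiv_mult (fun z => z - a)%C (fun z => / (1 - Cconj a * z))%C).
    + apply (cderiv_plus (fun z => z) (fun _ => - a)%C);
        [apply cderiv_id|apply cderiv_const].
    + apply (cderiv_comp (fun z => 1 - Cconj a * z)%C Cinv); [|now apply cderiv_inv].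
      apply (cderiv_plus (fun _ => RtoC 1) (fun z => - (Cconj a * z))%C);
        [apply cderiv_const|].
      apply cderiv_ext with (fun z => RtoC (-1) * (Cconj a * z))%C.
      { apply near_all; intros; apply injective_projections; simpl; ring. }
      apply (cderiv_mult (fun _ => RtoC (-1)) (fun z => Cconj a * z)%C);
        [apply cderiv_const|].
      apply (cderiv_mult (fun _ => Cconj a) (fun z => z));
        [apply cderiv_const|apply cderiv_id].
  - replace (a - a)%C with (RtoC 0) by ring. rewrite Cmult_0_l, !Cplus_0_r, Cmult_1_l.
    intros E. apply (C1_nz). rewrite <- (Cinv_r _ Hn), E. ring.
Qed.

Lemma cdiff_moebius a z : Cmod a < 1 -> Cmod z < 1 -> cdiff (moebius a) z.
Proof.
  intros Ha Hz. apply cdiff_div.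
  - apply cdiff_minus; [apply cdiff_id|apply cdiff_const].
  - apply cdiff_minus; [apply cdiff_const|apply cdiff_mult; [apply cdiff_const|apply cdiff_id]].
  - now apply moebius_den_neq.
Qed.

(** The analogue of [moebius_den_identity] in the right half-plane. *)
Lemma halfplane_identity w b : Cmod (w + Cconj b)%C ^ 2 - Cmod (w - b)%C ^ 2 = 4 * Re w * Re b.
Proof. rewrite !Cmod2_alt. destruct w, b; unfold Re, Im; simpl; ring. Qed.

Lemma halfplane_le w b : 0 <= Re w -> 0 <= Re b ->
  Cmod (w - b)%C <= Cmod (w + Cconj b)%C.
Proof.
  intros Hw Hb. apply pow2_le_inv; [apply Cmod_ge_0|].
  pose proof (halfplane_identity w b). nra.
Qed.

Lemma cclosed_disc a r : cclosed (fun z => Cmod (z - a)%C <= r).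
Proof.
  intros z Hz. apply Rnot_le_lt in Hz. exists (Cmod (z - a) - r); split; [lra|].
  intros y Hy H. pose proof (Cmod_tri z y a). rewrite Cmod_sub_sym in Hy. lra.
Qed.

Lemma near_disc a r z : Cmod (z - a)%C < r -> near z (fun y => Cmod (y - a)%C < r).
Proof.
  intros Hz. exists (r - Cmod (z - a)); split; [lra|].
  intros y Hy. pose proof (Cmod_tri y z a). lra.
Qed.

Lemma cbounded_disc a r : cbounded (fun z => Cmod (z - a)%C <= r).
Proof. exists (Cmod a + r); intros z Hz. pose proof (Cmod_tri_le z a). lra. Qed.

(** Used to let the radius of the disc tend to 1 in estimates that depend
    affinely on it. *)
Lemma affine_left_limit_nonpos A B r0 :
  r0 < 1 -> (forall r, r0 < r < 1 -> A + B * r <= 0) -> A + B <= 0.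
Proof.
  intros Hr H. apply Rnot_lt_le; intros Hlt.
  set (e := Rmin ((1 - r0) / 2) ((A + B) / (2 * (Rabs B + 1)))).
  pose proof (Rabs_pos B) as PB.
  assert (He : 0 < e).
  { apply Rmin_glb_lt; [lra|apply Rdiv_lt_0_compat; lra]. }
  assert (He1 : e <= (1 - r0) / 2) by apply Rmin_l.
  assert (He2 : e * (2 * (Rabs B + 1)) <= A + B).
  { replace (A + B) with ((A + B) / (2 * (Rabs B + 1)) * (2 * (Rabs B + 1)))
      by (field; lra).
    apply Rmult_le_compat_r; [lra|apply Rmin_r]. }
  specialize (H (1 - e) ltac:(lra)). pose proof (Rle_abs B). nra.
Qed.

Lemma Csub_0_r z : (z - RtoC 0)%C = z.
Proof. ring. Qed.

(** Pseudo-hyperbolic distances decrease. With N the pseudo-hyperbolic quotient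
    in the half-plane, |N| <= 1 on the circle of radius [r] while |moebius a| is
    nearly 1 there, so [quotient_bound] applies. *)
Lemma schwarz_pick_strict g a z :
  (forall y, Cmod y < 1 -> cdiff g y /\ 0 < Re (g y)) -> Cmod a < 1 -> Cmod z < 1 ->
  Cmod (g z - g a)%C * Cmod (1 - Cconj a * z)%C
  <= Cmod (z - a)%C * Cmod (g z + Cconj (g a))%C.
Proof.
  intros Hg Ha Hz.
  assert (Hden : forall y, Cmod y < 1 -> (g y + Cconj (g a))%C <> RtoC 0).
  { intros y Hy E. assert (Re (g y + Cconj (g a))%C = 0) by (rewrite E; reflexivity).
    destruct (Hg y Hy) as [_ P1]. destruct (Hg a Ha) as [_ P2].
    change (Re (g y) + Re (g a) = 0) in H. lra. }
  set (N := fun y => ((g y - g a) / (g y + Cconj (g a)))%C).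
  assert (HNd : forall y, Cmod y < 1 -> cdiff N y).
  { intros y Hy. apply cdiff_div; [| |now apply Hden].
    - apply cdiff_minus; [now apply Hg|apply cdiff_const].
    - apply cdiff_plus; [now apply Hg|apply cdiff_const]. }
  assert (HN1 : forall y, Cmod y < 1 -> Cmod (N y) <= 1).
  { intros y Hy. unfold N. pose proof (Hden y Hy) as Hn.
    rewrite Cmod_div by exact Hn. apply Cmod_gt_0 in Hn.
    apply Rmult_le_reg_r with (1 := Hn). unfold Rdiv; rewrite Rmult_assoc, Rinv_l by lra.
    pose proof (halfplane_le (g y) (g a)). destruct (Hg y Hy). destruct (Hg a Ha). lra. }
  assert (HNz : Cmod (N z) <= Cmod (moebius a z)).
  { pose proof (Cmod_ge_0 a) as Pa.
    enough (H : - (Cmod (N z) * Cmod a + Cmod (moebius a z))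
              + (Cmod (N z) + Cmod (moebius a z) * Cmod a) * 1 <= 0) by nra.
    rewrite Rmult_1_r.
    apply affine_left_limit_nonpos with (Rmax (Cmod a) (Cmod z)).
    { now apply Rmax_lub_lt. }
    intros r [Hr1 Hr].
    assert (Har : Cmod a < r) by (eapply Rle_lt_trans; [apply Rmax_l|exact Hr1]).
    assert (Hzr : Cmod z < r) by (eapply Rle_lt_trans; [apply Rmax_r|exact Hr1]).
    set (M := (1 - r * Cmod a) / (r - Cmod a)).
    assert (HM0 : 0 <= M).
    { apply Rlt_le, Rdiv_lt_0_compat; [nra|lra]. }
    destruct (HNd a Ha) as [n Hn]. destruct (cderiv_moebius a Ha) as [l [Hl Hl0]].
    assert (HB : Cmod (N z) <= M * Cmod (moebius a z)).
    { refine (quotient_bound (fun y => Cmod (y - RtoC 0)%C <= r) N (moebius a) a n l M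
        (cclosed_disc _ _) (cbounded_disc _ _) HM0 _ Hn Hl _ _ Hl0 _ _ z _).
      - intros y Hy. rewrite Csub_0_r in Hy.
        split; [apply HNd|apply cdiff_moebius]; lra.
      - unfold N. replace (g a - g a)%C with (RtoC 0) by ring. unfold Cdiv; ring.
      - unfold moebius. replace (a - a)%C with (RtoC 0) by ring. unfold Cdiv; ring.
      - intros y Hy Hne. rewrite Csub_0_r in Hy.
        pose proof (moebius_den_neq a y Ha ltac:(lra)) as Hq.
        intros E. apply Hne. unfold moebius in E.
        replace y with ((y - a) / (1 - Cconj a * y) * (1 - Cconj a * y) + a)%C
          by (field; exact Hq). rewrite E; ring.
      - intros y Hy. rewrite Csub_0_r in Hy.
        destruct Hy as [Hy|Hy].
        + right. eapply near_imp; [|apply (near_disc (RtoC 0) r y)].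
          * intros x Hx; simpl in *; lra.
          * now rewrite Csub_0_r.
        + left; split; [intros ->; lra|].
          pose proof (moebius_lower_bound a y r Har Hr Hy) as Hlow.
          pose proof (moebius_den_neq a y Ha ltac:(lra)) as Hq.
          eapply Rle_trans; [apply HN1; lra|].
          unfold moebius. rewrite Cmod_div by exact Hq. apply Cmod_gt_0 in Hq.
          apply Rmult_le_reg_r with ((r - Cmod a) * Cmod (1 - Cconj a * y)).
          { apply Rmult_lt_0_compat; lra. }
          unfold M.
          replace ((1 - r * Cmod a) / (r - Cmod a) *
            (Cmod (y - a) / Cmod (1 - Cconj a * y)) *
            ((r - Cmod a) * Cmod (1 - Cconj a * y)))
            with ((1 - r * Cmod a) * Cmod (y - a)) by (field; lra).
          lra.
      - rewrite Csub_0_r. lra. }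
    apply Rmult_le_compat_r with (r := r - Cmod a) in HB; [|lra].
    replace (M * Cmod (moebius a z) * (r - Cmod a)) with ((1 - r * Cmod a) * Cmod (moebius a z))
      in HB by (unfold M; field; lra).
    lra. }
  unfold N, moebius in HNz.
  pose proof (Hden z Hz) as D1. pose proof (moebius_den_neq a z Ha Hz) as D2.
  rewrite !Cmod_div in HNz by assumption. apply Cmod_gt_0 in D1, D2.
  apply Rmult_le_compat_r with
    (r := Cmod (g z + Cconj (g a)) * Cmod (1 - Cconj a * z)) in HNz;
    [|apply Rmult_le_pos; lra].
  match type of HNz with ?A <= ?B =>
    replace A with (Cmod (g z - g a) * Cmod (1 - Cconj a * z)) in HNz by (field; lra);
    replace B with (Cmod (z - a) * Cmod (g z + Cconj (g a))) in HNz by (field; lra)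
  end. exact HNz.
Qed.

(** Written without quotients, so that it survives the passage to the limit from
    g + eta, which has positive real part, to g. *)
Lemma schwarz_pick g a z :
  (forall y, Cmod y < 1 -> cdiff g y /\ 0 <= Re (g y)) -> Cmod a < 1 -> Cmod z < 1 ->
  Cmod (g z - g a)%C * Cmod (1 - Cconj a * z)%C
  <= Cmod (z - a)%C * Cmod (g z + Cconj (g a))%C.
Proof.
  intros Hg Ha Hz. apply le_epsilon; intros eps He.
  set (eta := eps / (2 * (Cmod (z - a)%C + 1))).
  pose proof (Cmod_ge_0 (z - a)%C) as Pz.
  assert (Heta : 0 < eta) by (apply Rdiv_lt_0_compat; lra).
  pose proof (schwarz_pick_strict (fun y => g y + RtoC eta)%C a z) as H.
  simpl in H.
  replace (g z + RtoC eta - (g a + RtoC eta))%C with (g z - g a)%C in H by ring.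
  eapply Rle_trans; [apply H; trivial|].
  - intros y Hy; destruct (Hg y Hy) as [H1 H2]; split.
    + apply cdiff_plus; [exact H1|apply cdiff_const].
    + change (0 < Re (g y) + eta). lra.
  - replace (g z + RtoC eta + Cconj (g a + RtoC eta))%C
      with ((g z + Cconj (g a)) + RtoC (2 * eta))%C
      by (apply injective_projections; simpl; ring).
    pose proof (Cmod_triangle (g z + Cconj (g a))%C (RtoC (2 * eta))) as Ht.
    rewrite Cmod_R, Rabs_pos_eq in Ht by lra.
    apply Rmult_le_compat_l with (r := Cmod (z - a)%C) in Ht; [|exact Pz].
    assert (Cmod (z - a)%C * (2 * eta) <= eps).
    { replace eps with ((Cmod (z - a)%C + 1) * (2 * eta)) by (unfold eta; field; lra).
      apply Rmult_le_compat_r; lra. }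
    lra.
Qed.

(** A map into the half-plane changes by at most a multiple of its real part
    between points at pseudo-hyperbolic distance [th] from each other. *)
Lemma harnack g a z th :
  (forall y, Cmod y < 1 -> cdiff g y /\ 0 <= Re (g y)) -> Cmod a < 1 -> Cmod z < 1 ->
  Cmod (z - a)%C <= th * Cmod (1 - Cconj a * z)%C ->
  (1 - th) * Cmod (g z - g a)%C <= 2 * th * Re (g a).
Proof.
  intros Hg Ha Hz Hth.
  pose proof (schwarz_pick g a z Hg Ha Hz) as H.
  pose proof (moebius_den_neq a z Ha Hz) as Hn. apply Cmod_gt_0 in Hn.
  pose proof (Cmod_ge_0 (z - a)%C).
  assert (Hth0 : 0 <= th) by (apply Rnot_lt_le; intro; nra).
  assert (H1 : Cmod (g z - g a)%C <= th * Cmod (g z + Cconj (g a))%C).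
  { apply Rmult_le_reg_r with (1 := Hn). eapply Rle_trans; [exact H|].
    apply Rmult_le_compat_r with (r := Cmod (g z + Cconj (g a))%C) in Hth;
      [|apply Cmod_ge_0]. lra. }
  assert (H2 : Cmod (g z + Cconj (g a))%C <= Cmod (g z - g a)%C + 2 * Re (g a)).
  { replace (g z + Cconj (g a))%C with ((g z - g a) + RtoC (2 * Re (g a)))%C.
    - eapply Rle_trans; [apply Cmod_triangle|]. rewrite Cmod_R, Rabs_pos_eq; [lra|].
      destruct (Hg a Ha); lra.
    - destruct (g a), (g z); unfold Re; apply injective_projections; simpl; ring. }
  apply Rmult_le_compat_l with (r := th) in H2; [|exact Hth0]. lra.
Qed.

(** * Inverses of univalent functions *)

Lemma cclosed_circle a r : cclosed (fun z => Cmod (z - a)%C = r).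
Proof.
  intros z Hz. destruct (Rle_dec (Cmod (z - a)) r) as [H|H].
  - eapply near_imp; [|apply (near_disc a r z); lra]. intros y Hy; simpl in *; lra.
  - eapply near_imp; [|apply (cclosed_disc a r z H)]. intros y Hy; simpl in *; lra.
Qed.

Lemma Csub_neq0 x y : x <> y -> (x - y)%C <> RtoC 0.
Proof. intros H E; apply H. replace x with ((x - y) + y)%C by ring. rewrite E; ring. Qed.

(** If [w] close to [h a] were omitted, 1/(h - w) would be larger at the centre
    than on the circle. *)
Lemma open_mapping h a r :
  0 < r -> (forall z, Cmod (z - a)%C <= r -> cdiff h z) ->
  (forall z, Cmod (z - a)%C = r -> h z <> h a) ->
  exists d, 0 < d /\ forall w, Cmod (w - h a)%C < d ->
    exists z, Cmod (z - a)%C <= r /\ h z = w.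
Proof.
  intros Hr Hd Hne.
  destruct (attains_max (fun z => Cmod (z - a)%C = r) (fun z => - Cmod (h z - h a)%C))
    as [z0 [Hz0 Hmin]].
  - apply cclosed_circle.
  - destruct (cbounded_disc a r) as [M HM]; exists M; intros z Hz; apply HM; lra.
  - exists (a + RtoC r)%C. replace (a + RtoC r - a)%C with (RtoC r) by ring.
    rewrite Cmod_R, Rabs_pos_eq; lra.
  - intros z Hz eps He.
    eapply near_imp; [|apply (cdiff_cont _ _ (Hd z ltac:(lra))); exact He].
    intros y Hy; simpl in *. pose proof (Cmod_tri (h z) (h y) (h a)).
    rewrite Cmod_sub_sym in Hy. lra.
  - set (m := Cmod (h z0 - h a)%C) in *.
    assert (Hm : 0 < m) by (apply Cmod_gt_0, Csub_neq0, Hne, Hz0).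
    exists (m / 2); split; [lra|]. intros w Hw.
    apply NNPP; intros Hno.
    assert (Hn0 : forall z, Cmod (z - a)%C <= r -> (h z - w)%C <> RtoC 0).
    { intros z Hz E. apply Hno; exists z; split; [exact Hz|].
      replace (h z) with ((h z - w) + w)%C by ring. rewrite E; ring. }
    assert (Hdd : forall z, Cmod (z - a)%C <= r -> cdiff (fun y => / (h y - w))%C z).
    { intros z Hz. apply cdiff_inv; [|now apply Hn0].
      apply cdiff_minus; [now apply Hd|apply cdiff_const]. }
    assert (Haa : Cmod (a - a)%C = 0)
      by (replace (a - a)%C with (RtoC 0) by ring; apply Cmod_0).
    assert (Hmax : Cmod (/ (h a - w))%C <= / (m / 2)).
    { apply (max_principle (fun z => Cmod (z - a)%C <= r) (fun z => / (h z - w))%C).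
      - apply cclosed_disc.
      - apply cbounded_disc.
      - left; apply Rinv_0_lt_compat; lra.
      - intros z Hz; now apply cdiff_cont, Hdd.
      - intros z [Hz|Hz].
        + right. eapply near_imp; [|exact (near_disc _ _ _ Hz)].
          intros y Hy; simpl in *. split; [lra|intros _; apply Hdd; lra].
        + left. rewrite Cmod_inv by (apply Hn0; lra).
          apply Rinv_le_contravar; [lra|].
          specialize (Hmin z Hz). pose proof (Cmod_tri (h z) w (h a)). lra.
      - lra. }
    pose proof (Hn0 a ltac:(lra)) as Ha. rewrite Cmod_inv in Hmax by exact Ha.
    apply Cmod_gt_0 in Ha. rewrite Cmod_sub_sym in Hw.
    assert (/ (m / 2) < / Cmod (h a - w)).
    { apply Rinv_lt_contravar; [|exact Hw]. apply Rmult_lt_0_compat; lra. }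
    lra.
Qed.

(** Integration along the segment, done on real and imaginary parts. *)
Lemma cderiv_zero_const h a b :
  (forall t, 0 <= t <= 1 -> cderiv h (a + RtoC t * (b - a))%C (RtoC 0)) -> h a = h b.
Proof.
  intros Hd.
  set (p := fun t => (a + RtoC t * (b - a))%C).
  assert (Hb : forall t, 0 <= t <= 1 -> forall eps, 0 < eps -> exists d : posreal,
    forall x, x <> 0 -> Rabs x < d ->
      Cmod (h (p (t + x)%R) - h (p t))%C / Rabs x < eps).
  { intros t Ht eps He. pose proof (Cmod_ge_0 (b - a)%C) as Pb.
    destruct (cderiv_bound _ _ _ (Hd t Ht) (eps / (2 * (Cmod (b - a)%C + 1)))
      ltac:(apply Rdiv_lt_0_compat; lra)) as [d [Hd0 Hn]].
    assert (Hdp : 0 < d / (Cmod (b - a)%C + 1)) by (apply Rdiv_lt_0_compat; lra).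
    exists (mkposreal _ Hdp). intros x Hx Hxd; simpl in Hxd.
    assert (Hpx : (p (t + x)%R - p t)%C = (RtoC x * (b - a))%C).
    { unfold p. rewrite RtoC_plus. ring. }
    assert (Hpm : Cmod (p (t + x)%R - p t)%C = Rabs x * Cmod (b - a)%C).
    { rewrite Hpx, Cmod_mult, Cmod_R; reflexivity. }
    pose proof (Rabs_pos_lt x Hx) as Px.
    apply Rmult_lt_compat_r with (r := Cmod (b - a)%C + 1) in Hxd; [|lra].
    unfold Rdiv in Hxd at 1; rewrite Rmult_assoc, Rinv_l in Hxd by lra.
    specialize (Hn (p (t + x)%R)). fold (p t) in Hn. rewrite Hpm in Hn.
    specialize (Hn ltac:(nra)).
    replace (h (p (t + x)%R) - h (p t) - RtoC 0 * (p (t + x)%R - p t))%C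
      with (h (p (t + x)%R) - h (p t))%C in Hn by ring.
    apply Rmult_lt_reg_r with (Rabs x); [exact Px|].
    unfold Rdiv at 1; rewrite Rmult_assoc, Rinv_l by lra. rewrite Rmult_1_r.
    eapply Rle_lt_trans; [exact Hn|].
    apply Rle_lt_trans with (eps / (2 * (Cmod (b - a)%C + 1)) * ((Cmod (b - a)%C + 1) * Rabs x)).
    - apply Rmult_le_compat_l; [apply Rlt_le, Rdiv_lt_0_compat; lra|nra].
    - replace (eps / (2 * (Cmod (b - a)%C + 1)) * ((Cmod (b - a)%C + 1) * Rabs x))
        with (eps / 2 * Rabs x) by (field; lra). nra. }
  assert (Hp0 : p 0 = a) by (unfold p; ring).
  assert (Hp1 : p 1 = b) by (unfold p; ring).
  rewrite <- Hp0, <- Hp1.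
  apply injective_projections.
  - apply (eq_is_derive (V := R_NormedModule) (fun t => fst (h (p t))) 0 1); [|lra].
    intros t Ht. apply is_derive_Reals. intros eps He.
    destruct (Hb t Ht eps He) as [d Hdd]; exists d; intros x Hx Hxd.
    eapply Rle_lt_trans; [|exact (Hdd x Hx Hxd)].
    unfold zero; simpl. rewrite Rminus_0_r. unfold Rdiv. rewrite Rabs_mult, Rabs_inv.
    apply Rmult_le_compat_r; [left; apply Rinv_0_lt_compat, Rabs_pos_lt, Hx|].
    exact (re_le_Cmod (h (p (t + x)%R) - h (p t))%C).
  - apply (eq_is_derive (V := R_NormedModule) (fun t => snd (h (p t))) 0 1); [|lra].
    intros t Ht. apply is_derive_Reals. intros eps He.
    destruct (Hb t Ht eps He) as [d Hdd]; exists d; intros x Hx Hxd.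
    eapply Rle_lt_trans; [|exact (Hdd x Hx Hxd)].
    unfold zero; simpl. rewrite Rminus_0_r. unfold Rdiv. rewrite Rabs_mult, Rabs_inv.
    apply Rmult_le_compat_r; [left; apply Rinv_0_lt_compat, Rabs_pos_lt, Hx|].
    exact (im_le_Cmod (h (p (t + x)%R) - h (p t))%C).
Qed.

Lemma univalent_cdiff h : univalent h -> forall z, Cmod z < 1 -> cdiff h z.
Proof. intros [H _] z Hz. now apply ex_derive_cdiff, H. Qed.

Lemma near_in_disc z : Cmod z < 1 -> near z (fun y => Cmod y < 1).
Proof.
  intros Hz. eapply near_imp; [|apply (near_disc (RtoC 0) 1 z)].
  - intros y Hy; cbv beta in Hy. now rewrite Csub_0_r in Hy.
  - now rewrite Csub_0_r.
Qed.

(** The inverse of [h] is continuous by [open_mapping], so the preimage of a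
    compact disc is compact; [box_induction] in the image plane makes this
    explicit. *)
Lemma preimage_in_smaller_disc h a rho rho' :
  univalent h -> 0 < rho' < rho ->
  (forall w, Cmod (w - h a)%C < rho -> disc_image h w) ->
  exists R, R < 1 /\ forall z, Cmod z < 1 -> Cmod (h z - h a)%C <= rho' -> Cmod z <= R.
Proof.
  intros Hu Hrho Him. pose proof (univalent_cdiff h Hu) as Hd. destruct Hu as [_ Hinj].
  set (x0 := Re (h a)). set (y0 := Im (h a)).
  assert (HB : exists R, R < 1 /\ forall z, Cmod z < 1 -> Cmod (h z - h a)%C <= rho' ->
    in_box (x0 - rho') (x0 + rho') (y0 - rho') (y0 + rho') (h z) -> Cmod z <= R).
  { apply (box_induction (fun x1 x2 y1 y2 => exists R, R < 1 /\ forall z, Cmod z < 1 ->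
      Cmod (h z - h a)%C <= rho' -> in_box x1 x2 y1 y2 (h z) -> Cmod z <= R)); try lra.
    - intros x1 x2 y1 y2 _ _ [R1 [L1 H1]] [R2 [L2 H2]] [R3 [L3 H3]] [R4 [L4 H4]].
      exists (Rmax (Rmax R1 R2) (Rmax R3 R4)); split.
      { repeat apply Rmax_lub_lt; assumption. }
      pose proof (Rmax_l R1 R2). pose proof (Rmax_r R1 R2).
      pose proof (Rmax_l R3 R4). pose proof (Rmax_r R3 R4).
      pose proof (Rmax_l (Rmax R1 R2) (Rmax R3 R4)).
      pose proof (Rmax_r (Rmax R1 R2) (Rmax R3 R4)).
      intros z Hz Hh [Hr Hi]. specialize (H1 z Hz Hh). specialize (H2 z Hz Hh).
      specialize (H3 z Hz Hh). specialize (H4 z Hz Hh).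
      destruct (Rle_dec (Re (h z)) ((x1 + x2) / 2)), (Rle_dec (Im (h z)) ((y1 + y2) / 2)).
      + apply Rle_trans with R1; [|lra]. apply H1; split; lra.
      + apply Rle_trans with R3; [|lra]. apply H3; split; lra.
      + apply Rle_trans with R2; [|lra]. apply H2; split; lra.
      + apply Rle_trans with R4; [|lra]. apply H4; split; lra.
    - intros w0 _. destruct (Rlt_dec (Cmod (w0 - h a)%C) rho) as [Hw|Hw].
      + destruct (Him w0 Hw) as [z0 [Hz0 E0]]. unfold unit_disc in Hz0.
        set (r := (1 - Cmod z0) / 2).
        assert (Hr : 0 < r) by (unfold r; lra).
        assert (Hin : forall z, Cmod (z - z0)%C <= r -> Cmod z < 1 /\ Cmod z <= Cmod z0 + r).
        { intros z Hz. pose proof (Cmod_tri_le z z0). unfold r in *. lra. }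
        destruct (open_mapping h z0 r Hr) as [dl [Hdl Hopen]].
        { intros z Hz; apply Hd, Hin, Hz. }
        { intros z Hz E. assert (Hz1 : Cmod (z - z0)%C <= r) by lra.
          apply Hinj in E; [|apply Hin, Hz1|exact Hz0]. subst z.
          replace (z0 - z0)%C with (RtoC 0) in Hz by ring. rewrite Cmod_0 in Hz. lra. }
        exists (dl / 2); split; [lra|]. intros x1 x2 y1 y2 Hb _ _ _ _ W1 W2.
        exists (Cmod z0 + r); split; [unfold r; lra|].
        intros z Hz _ Hbz.
        pose proof (Cmod_small_box _ _ _ _ _ _ _ Hb Hbz W1 W2) as Hc.
        rewrite <- E0 in Hc. destruct (Hopen _ Hc) as [z1 [Hz1 E1]].
        apply Hinj in E1; [|apply Hin, Hz1|exact Hz]. subst z1. apply Hin, Hz1.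
      + exists ((rho - rho') / 2); split; [lra|]. intros x1 x2 y1 y2 Hb _ _ _ _ W1 W2.
        exists 0; split; [lra|]. intros z Hz Hh Hbz. exfalso.
        pose proof (Cmod_small_box _ _ _ _ _ _ _ Hb Hbz W1 W2) as Hc.
        pose proof (Cmod_tri w0 (h z) (h a)). rewrite Cmod_sub_sym in Hc. lra. }
  destruct HB as [R [HR HB]]. exists R; split; [exact HR|].
  intros z Hz Hh. apply HB; trivial.
  pose proof (re_le_Cmod (h z - h a)%C) as R1. pose proof (im_le_Cmod (h z - h a)%C) as R2.
  replace (Re (h z - h a)%C) with (Re (h z) - x0) in R1 by reflexivity.
  replace (Im (h z - h a)%C) with (Im (h z) - y0) in R2 by reflexivity.
  apply Rabs_le_between in R1. apply Rabs_le_between in R2. split; lra.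
Qed.

(** The Schwarz lemma for the inverse of [h] at [h a], read in the disc: on the
    compact preimage of the disc of radius [rho'] the quotient moebius a / (h - h a)
    is at most 1/rho' on the boundary. The assumption on [l] makes the quotient
    continuous at [a]. *)
Lemma inverse_contraction_regular h a l rho :
  univalent h -> Cmod a < 1 -> cderiv h a l -> l <> RtoC 0 ->
  (forall w, Cmod (w - h a)%C < rho -> disc_image h w) ->
  forall z, Cmod z < 1 -> rho * Cmod (moebius a z) <= Cmod (h z - h a)%C.
Proof.
  intros Hu Ha Hl Hl0 Him z Hz.
  pose proof (univalent_cdiff h Hu) as Hd.
  pose proof (Cmod_ge_0 (h z - h a)%C) as Ph.
  pose proof (moebius_le_1 a z Ha Hz) as Hm1. pose proof (Cmod_ge_0 (moebius a z)) as Pm.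
  destruct (Rle_dec rho 0) as [Hrho|Hrho]; [nra|].
  enough (HE : forall rho', 0 < rho' < rho -> rho' * Cmod (moebius a z) <= Cmod (h z - h a)%C).
  { apply Rnot_lt_le; intros Hlt.
    assert (Pm' : 0 < Cmod (moebius a z)) by nra.
    specialize (HE ((Cmod (h z - h a)%C / Cmod (moebius a z) + rho) / 2)).
    assert (Hq : Cmod (h z - h a)%C / Cmod (moebius a z) < rho).
    { apply Rmult_lt_reg_r with (1 := Pm'). unfold Rdiv; rewrite Rmult_assoc, Rinv_l; lra. }
    assert (Hq0 : 0 <= Cmod (h z - h a)%C / Cmod (moebius a z)).
    { apply Rmult_le_pos; [exact Ph|left; now apply Rinv_0_lt_compat]. }
    specialize (HE ltac:(lra)).
    replace ((Cmod (h z - h a)%C / Cmod (moebius a z) + rho) / 2 * Cmod (moebius a z))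
      with ((Cmod (h z - h a)%C + rho * Cmod (moebius a z)) / 2) in HE by (field; lra).
    lra. }
  intros rho' Hrho'.
  destruct (Rle_dec (Cmod (h z - h a)%C) rho') as [Hz'|Hz']; [|nra].
  destruct (preimage_in_smaller_disc h a rho rho' Hu Hrho' Him) as [R [HR HK]].
  destruct (cderiv_moebius a Ha) as [n [Hn _]].
  assert (Hcont : forall y, Cmod y < 1 -> ccont (fun x => h x - h a)%C y).
  { intros y Hy. apply ccont_minus; [now apply cdiff_cont, Hd|apply ccont_const]. }
  assert (Hlm : cderiv (fun y => h y - h a)%C a (l + RtoC 0)%C).
  { apply (cderiv_plus h (fun _ => - h a)%C); [exact Hl|apply cderiv_const]. }
  assert (HB : Cmod (moebius a z) <= / rho' * Cmod (h z - h a)%C).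
  { apply (quotient_bound (fun y => Cmod y < 1 /\ Cmod (h y - h a)%C <= rho')
      (moebius a) (fun y => h y - h a)%C a n (l + RtoC 0)%C).
    - intros y Hy. destruct (Rlt_dec (Cmod y) 1) as [H1|H1].
      + assert (H2 : rho' < Cmod (h y - h a)%C) by (apply Rnot_le_lt; tauto).
        eapply near_imp; [|apply (near_Cmod_lt (fun _ => RtoC rho') (fun x => h x - h a)%C y)].
        * intros x Hx [_ H3]; simpl in Hx. rewrite Cmod_R, Rabs_pos_eq in Hx; lra.
        * apply ccont_const.
        * now apply Hcont.
        * rewrite Cmod_R, Rabs_pos_eq; lra.
      + eapply near_imp; [|apply (cclosed_disc (RtoC 0) R y)].
        * intros x Hx [H2 H3]; cbv beta in Hx. rewrite Csub_0_r in Hx. now apply Hx, HK.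
        * rewrite Csub_0_r. lra.
    - exists 1; intros y [Hy _]; lra.
    - left; apply Rinv_0_lt_compat; lra.
    - intros y [Hy _]; split; [now apply cdiff_moebius|].
      apply cdiff_minus; [now apply Hd|apply cdiff_const].
    - exact Hn.
    - exact Hlm.
    - unfold moebius. replace (a - a)%C with (RtoC 0) by ring. unfold Cdiv; ring.
    - ring.
    - rewrite Cplus_0_r. exact Hl0.
    - intros y [Hy _] Hne. apply Csub_neq0. intros E; apply Hne.
      now apply Hu.
    - intros y [Hy [Hh|Hh]].
      + right. eapply near_imp; [|exact (near_and _ _ _ (near_in_disc y Hy)
          (near_Cmod_lt (fun x => h x - h a)%C (fun _ => RtoC rho') y (Hcont y Hy)
            (ccont_const _ _) ltac:(cbv beta; rewrite Cmod_R, Rabs_pos_eq; lra)))].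
        intros x [H1 H2]; simpl in H2. rewrite Cmod_R, Rabs_pos_eq in H2; lra.
      + left. split.
        * intros ->. replace (h a - h a)%C with (RtoC 0) in Hh by ring.
          rewrite Cmod_0 in Hh; lra.
        * rewrite Hh, Rinv_l by lra. now apply moebius_le_1.
    - split; assumption. }
  apply Rmult_le_compat_l with (r := rho') in HB; [|lra].
  rewrite <- Rmult_assoc, Rinv_r in HB by lra. lra.
Qed.

Lemma ccont_conj z : ccont Cconj z.
Proof.
  intros eps He; exists eps; split; [exact He|]. intros y Hy.
  now rewrite <- Cminus_conj, Cmod_conj.
Qed.

(** If the derivative vanished on a disc, [h] would be constant there. *)
Lemma regular_points_dense h a e :
  univalent h -> Cmod a < 1 -> 0 < e ->
  exists b l, Cmod b < 1 /\ Cmod (b - a)%C < e /\ cderiv h b l /\ l <> RtoC 0.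
Proof.
  intros Hu Ha He. pose proof (univalent_cdiff h Hu) as Hd.
  apply NNPP; intros Hno.
  destruct (near_in_disc a Ha) as [d [Hd0 Hin]].
  set (s := Rmin d e / 2).
  assert (Hm : 0 < Rmin d e) by now apply Rmin_glb_lt.
  assert (Hs1 : s < d) by (pose proof (Rmin_l d e); unfold s; lra).
  assert (Hs2 : s < e) by (pose proof (Rmin_r d e); unfold s; lra).
  assert (Hs : 0 < s) by (unfold s; lra).
  assert (Hab : (a + RtoC s - a)%C = RtoC s) by ring.
  assert (Hz : h a = h (a + RtoC s)%C).
  { apply cderiv_zero_const. intros t Ht. rewrite Hab.
    set (y := (a + RtoC t * RtoC s)%C).
    assert (Hy : Cmod (y - a)%C <= s).
    { unfold y. replace (a + RtoC t * RtoC s - a)%C with (RtoC t * RtoC s)%C by ring.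
      rewrite Cmod_mult, !Cmod_R, !Rabs_pos_eq; nra. }
    assert (Hy1 : Cmod y < 1) by (apply Hin; lra).
    destruct (Hd y Hy1) as [l Hl]. destruct (Ceq_dec l (RtoC 0)) as [->|Hl0]; [exact Hl|].
    exfalso; apply Hno; exists y, l; repeat split; trivial; lra. }
  apply Hu in Hz.
  - assert (E : RtoC s = RtoC 0) by (rewrite <- Hab, <- Hz; ring).
    apply RtoC_inj in E; lra.
  - exact Ha.
  - apply Hin. rewrite Hab, Cmod_R, Rabs_pos_eq; lra.
Qed.

(** Both sides depend continuously on [a], so it is enough to treat the dense set
    of points where the derivative does not vanish. *)
Lemma inverse_contraction h a rho :
  univalent h -> Cmod a < 1 ->
  (forall w, Cmod (w - h a)%C < rho -> disc_image h w) ->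
  forall z, Cmod z < 1 ->
  rho * Cmod (z - a)%C <= Cmod (h z - h a)%C * Cmod (1 - Cconj a * z)%C.
Proof.
  intros Hu Ha Him z Hz. pose proof (univalent_cdiff h Hu) as Hd.
  apply Rnot_lt_le; intros Hlt.
  pose proof (Cmod_ge_0 (z - a)%C) as Pz.
  set (A := Cmod (h z - h a)%C * Cmod (1 - Cconj a * z)%C) in *.
  assert (PA : 0 <= A) by (apply Rmult_le_pos; apply Cmod_ge_0).
  assert (Pz' : 0 < Cmod (z - a)%C) by (destruct Pz as [|E]; [assumption|rewrite <- E in Hlt; lra]).
  assert (Hq : A / Cmod (z - a)%C < rho).
  { apply Rmult_lt_reg_r with (1 := Pz'). unfold Rdiv; rewrite Rmult_assoc, Rinv_l; lra. }
  assert (Hq0 : 0 <= A / Cmod (z - a)%C).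
  { apply Rmult_le_pos; [exact PA|left; now apply Rinv_0_lt_compat]. }
  set (rho' := (A / Cmod (z - a)%C + rho) / 2).
  assert (Hr1 : 0 < rho' < rho) by (unfold rho'; lra).
  assert (Hr2 : A < rho' * Cmod (z - a)%C).
  { unfold rho'.
    replace ((A / Cmod (z - a)%C + rho) / 2 * Cmod (z - a)%C)
      with ((A + rho * Cmod (z - a)%C) / 2) by (field; lra). lra. }
  assert (Hnear : near a (fun b =>
    Cmod ((h z - h b) * (1 - Cconj b * z))%C < Cmod (RtoC rho' * (z - b))%C)).
  { apply (near_Cmod_lt (fun b => (h z - h b) * (1 - Cconj b * z))%C
      (fun b => RtoC rho' * (z - b))%C).
    - apply ccont_mult; apply ccont_minus; try apply ccont_const.
      + now apply cdiff_cont, Hd.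
      + apply ccont_mult; [apply ccont_conj|apply ccont_const].
    - apply ccont_mult; [apply ccont_const|].
      apply ccont_minus; [apply ccont_const|apply ccont_id].
    - rewrite !Cmod_mult, Cmod_R, Rabs_pos_eq by lra. exact Hr2. }
  destruct (near_and _ _ _ Hnear (cdiff_cont _ _ (Hd a Ha) (rho - rho') ltac:(lra)))
    as [e [He Hn]].
  destruct (regular_points_dense h a e Hu Ha He) as [b [l [Hb [Hba [Hl Hl0]]]]].
  destruct (Hn b Hba) as [H1 H2].
  rewrite !Cmod_mult, Cmod_R, Rabs_pos_eq in H1 by lra.
  assert (H3 : rho' * Cmod (moebius b z) <= Cmod (h z - h b)%C).
  { apply (inverse_contraction_regular h b l); trivial.
    intros w Hw. apply Him. pose proof (Cmod_tri w (h b) (h a)). lra. }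
  unfold moebius in H3. pose proof (moebius_den_neq b z Hb Hz) as Hn0.
  rewrite Cmod_div in H3 by exact Hn0. apply Cmod_gt_0 in Hn0.
  apply Rmult_le_compat_r with (r := Cmod (1 - Cconj b * z)%C) in H3; [|lra].
  replace (rho' * (Cmod (z - b)%C / Cmod (1 - Cconj b * z)%C) * Cmod (1 - Cconj b * z)%C)
    with (rho' * Cmod (z - b)%C) in H3 by (field; lra).
  lra.
Qed.

(** Liouville: [inverse_contraction] with arbitrarily large [rho] would make two
    distinct points coincide. *)
Lemma univalent_image_not_plane h : univalent h -> exists q, ~ disc_image h q.
Proof.
  intros Hu. apply NNPP; intros Hno.
  assert (Hall : forall w, disc_image h w) by (intros w; apply NNPP; intros H; apply Hno; now exists w).
  assert (H0 : Cmod (RtoC 0) < 1) by (rewrite Cmod_0; lra).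
  assert (H1 : Cmod (RtoC (1/2)) < 1) by (rewrite Cmod_R, Rabs_pos_eq; lra).
  set (A := Cmod (h (RtoC (1/2)) - h (RtoC 0))%C).
  pose proof (Cmod_ge_0 (h (RtoC (1/2)) - h (RtoC 0))%C) as PA. fold A in PA.
  pose proof (inverse_contraction h (RtoC 0) (2 * A + 1) Hu H0 (fun w _ => Hall w) _ H1) as H.
  fold A in H.
  replace (RtoC (1/2) - RtoC 0)%C with (RtoC (1/2)) in H by ring.
  replace (1 - Cconj (RtoC 0) * RtoC (1/2))%C with (RtoC 1) in H
    by (apply injective_projections; simpl; ring).
  rewrite !Cmod_R, !Rabs_pos_eq in H by lra. lra.
Qed.

(** * The Cayley transform *)

Definition cayley (tau z : C) : C := ((tau + z) / (tau - z))%C.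

Lemma cayley_den_neq tau z : Cmod tau = 1 -> Cmod z < 1 -> (tau - z)%C <> RtoC 0.
Proof. intros Ht Hz. apply Csub_neq0. intros ->; lra. Qed.

Lemma Cmult_conj_unit tau : Cmod tau = 1 -> (tau * Cconj tau)%C = RtoC 1.
Proof. intros H. rewrite <- Cmod2_conj, H. f_equal; ring. Qed.

(** The real part of the Cayley transform is the Poisson kernel at [tau]. *)
Lemma Re_cayley tau z : Cmod tau = 1 -> Cmod z < 1 ->
  Re (cayley tau z) * Cmod (tau - z)%C ^ 2 = 1 - Cmod z ^ 2.
Proof.
  intros Ht Hz. pose proof (cayley_den_neq tau z Ht Hz) as Hn.
  set (P := cayley tau z).
  assert (HP : (P * (tau - z))%C = (tau + z)%C) by (unfold P, cayley; field; exact Hn).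
  assert (H : (RtoC (Cmod (tau - z)%C ^ 2) * P)%C = ((tau + z) * Cconj (tau - z))%C).
  { rewrite Cmod2_conj, <- HP. ring. }
  apply (f_equal Re) in H.
  assert (E1 : Re (RtoC (Cmod (tau - z)%C ^ 2) * P)%C = Cmod (tau - z)%C ^ 2 * Re P).
  { destruct P; unfold Re; simpl; ring. }
  rewrite E1 in H. rewrite Rmult_comm, H.
  pose proof (Cmod2_alt tau) as H1. rewrite Ht in H1. rewrite Cmod2_alt.
  destruct tau as [t1 t2], z as [z1 z2]; unfold Re, Im in *; simpl in *. lra.
Qed.

Lemma Re_cayley_pos tau z : Cmod tau = 1 -> Cmod z < 1 -> 0 < Re (cayley tau z).
Proof.
  intros Ht Hz. pose proof (Re_cayley tau z Ht Hz) as H.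
  pose proof (cayley_den_neq tau z Ht Hz) as Hn. apply Cmod_gt_0 in Hn.
  pose proof (Cmod_ge_0 z). assert (0 < 1 - Cmod z ^ 2) by nra.
  assert (0 < Cmod (tau - z)%C ^ 2) by now apply pow_lt.
  apply Rnot_le_lt; intros Hle. nra.
Qed.

Lemma cdiff_cayley tau z : Cmod tau = 1 -> Cmod z < 1 -> cdiff (cayley tau) z.
Proof.
  intros Ht Hz. apply cdiff_div; [| |now apply cayley_den_neq].
  - apply cdiff_plus; [apply cdiff_const|apply cdiff_id].
  - apply cdiff_minus; [apply cdiff_const|apply cdiff_id].
Qed.

(** The Cayley transform is an isometry for the pseudo-hyperbolic distances. *)
Lemma cayley_pseudo_distance tau a z : Cmod tau = 1 -> Cmod a < 1 -> Cmod z < 1 ->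
  Cmod (cayley tau z - cayley tau a)%C * Cmod (1 - Cconj a * z)%C
  = Cmod (z - a)%C * Cmod (cayley tau z + Cconj (cayley tau a))%C.
Proof.
  intros Ht Ha Hz.
  pose proof (cayley_den_neq tau z Ht Hz) as Dz. pose proof (cayley_den_neq tau a Ht Ha) as Da.
  assert (Da' : (Cconj tau - Cconj a)%C <> RtoC 0).
  { rewrite <- Cminus_conj. apply Cmod_gt_0. rewrite Cmod_conj. now apply Cmod_gt_0. }
  assert (Ec : Cconj (cayley tau a) = ((Cconj tau + Cconj a) / (Cconj tau - Cconj a))%C).
  { unfold cayley. rewrite Cdiv_conj by exact Da. now rewrite Cplus_conj, Cminus_conj. }
  assert (Hc : (tau * Cconj tau)%C = RtoC 1) by now apply Cmult_conj_unit.
  assert (E1 : (cayley tau z - cayley tau a)%C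
    = (RtoC 2 * tau * (z - a) / ((tau - z) * (tau - a)))%C).
  { unfold cayley; field; split; assumption. }
  assert (E2 : (cayley tau z + Cconj (cayley tau a))%C
    = (RtoC 2 * (1 - Cconj a * z) / ((tau - z) * (Cconj tau - Cconj a)))%C).
  { rewrite Ec, <- Hc; unfold cayley; field; split; assumption. }
  rewrite E1, E2, !Cmod_div, !Cmod_mult by (apply Cmult_neq_0; assumption).
  rewrite <- Cminus_conj, Cmod_conj, Ht.
  apply Cmod_gt_0 in Dz, Da. field. lra.
Qed.

(** * Functions omitting a half-line *)

Lemma square_root_on_slit_plane w : (forall s, 0 <= s -> w <> RtoC (- s)) ->
  exists r, 0 < Re r /\ (r * r)%C = w.
Proof.
  intros Hw. destruct w as [u v].
  pose proof (Cmod2_alt (u, v)) as H2. unfold Re, Im in H2; simpl fst in H2; simpl snd in H2.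
  set (m := Cmod (u, v)) in *.
  pose proof (re_le_Cmod (u, v)) as Hre. unfold Re in Hre; simpl fst in Hre. fold m in Hre.
  apply Rabs_le_between in Hre.
  assert (Hp : 0 < m + u).
  { destruct (Rle_lt_or_eq_dec 0 (m + u) ltac:(lra)) as [|E]; [assumption|exfalso].
    assert (Hv : v = 0) by nra.
    apply (Hw (- u)); [pose proof (Cmod_ge_0 (u, v)); fold m in H; lra|].
    apply injective_projections; simpl; lra. }
  (* A root r has |r|^2 = m and Re (r^2) = u, so (Re r)^2 = (m + u) / 2. *)
  set (x := sqrt ((m + u) / 2)).
  assert (Hx : 0 < x) by (apply sqrt_lt_R0; lra).
  assert (Hxx : x * x = (m + u) / 2) by (apply sqrt_sqrt; lra).
  exists (x, v / (2 * x)). split; [exact Hx|].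
  apply injective_projections; simpl.
  - replace (v / (2 * x) * (v / (2 * x))) with (v * v / (4 * (x * x))) by (field; lra).
    rewrite Hxx. replace (v * v) with ((m - u) * (m + u)) by (simpl in H2; lra).
    field. lra.
  - field. lra.
Qed.

(** (s y - s z)(s y + s z) = f y - f z, and the second factor is bounded below
    since both square roots lie in the right half-plane. *)
Lemma cdiff_square_root f s z :
  near z (fun y => 0 < Re (s y) /\ (s y * s y)%C = f y) -> cdiff f z -> cdiff s z.
Proof.
  intros Hs Hf. pose proof (near_self _ _ Hs) as [Hz0 Hz].
  pose proof (cdiff_cont _ _ Hf) as Cf.
  assert (Hsum : forall y, 0 < Re (s y) -> Re (s z) <= Cmod (s y + s z)%C).
  { intros y Hy. pose proof (re_le_Cmod (s y + s z)%C) as H.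
    change (Re (s y + s z)%C) with (Re (s y) + Re (s z)) in H.
    rewrite Rabs_pos_eq in H by lra. lra. }
  assert (Cs : ccont s z).
  { intros eps He.
    eapply near_imp; [|exact (near_and _ _ _ Hs (Cf (eps * Re (s z)) ltac:(nra)))].
    intros y [[H1 H2] H3]; cbv beta in *.
    rewrite <- H2, <- Hz in H3.
    replace (s y * s y - s z * s z)%C with ((s y - s z) * (s y + s z))%C in H3 by ring.
    rewrite Cmod_mult in H3. specialize (Hsum y H1).
    pose proof (Cmod_ge_0 (s y - s z)%C).
    apply Rmult_lt_reg_r with (1 := Hz0). nra. }
  destruct Hf as [l [q [Cq [_ Hq]]]].
  exists (q z / (s z + s z))%C, (fun y => q y / (s y + s z))%C.
  assert (Hne : forall y, 0 < Re (s y) -> (s y + s z)%C <> RtoC 0).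
  { intros y Hy. apply Cmod_gt_0. specialize (Hsum y Hy). lra. }
  repeat split.
  - apply ccont_mult; [exact Cq|].
    apply (ccont_comp (fun y => s y + s z)%C Cinv).
    + apply ccont_plus; [exact Cs|apply ccont_const].
    + now apply ccont_inv, Hne.
  - eapply near_imp; [|exact (near_and _ _ _ Hs Hq)].
    intros y [[H1 H2] H3]; cbv beta in *.
    rewrite <- H2, <- Hz in H3. pose proof (Hne y H1) as Hn.
    replace (q y / (s y + s z) * (y - z))%C with ((q y * (y - z)) / (s y + s z))%C
      by (field; exact Hn).
    rewrite <- H3. field. exact Hn.
Qed.

(** Multiplication by -i turns the omitted half-line into the negative real axis,
    so -i (h - q) has a holomorphic square root s with positive real part. Apply
    [schwarz_pick] to s and multiply by |s z + s a|. The estimate plays the role of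
    Koebe's distortion theorem. *)
Lemma slit_distortion h q a z :
  (forall y, Cmod y < 1 -> cdiff h y) ->
  (forall y s, Cmod y < 1 -> 0 <= s -> h y <> (q - Ci * RtoC s)%C) ->
  Cmod a < 1 -> Cmod z < 1 ->
  Cmod (h z - h a)%C * Cmod (1 - Cconj a * z)%C
  <= 2 * (Cmod (h z - q)%C + Cmod (h a - q)%C) * Cmod (z - a)%C.
Proof.
  intros Hd Hom Ha Hz.
  set (v := fun y => (- Ci * (h y - q))%C).
  assert (HCi : (Ci * Ci)%C = RtoC (-1)) by (apply injective_projections; simpl; ring).
  assert (Hex : forall y, exists s, Cmod y < 1 -> 0 < Re s /\ (s * s)%C = v y).
  { intros y. destruct (Rlt_dec (Cmod y) 1) as [Hy|Hy]; [|exists (RtoC 0); tauto].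
    destruct (square_root_on_slit_plane (v y)) as [s Hs]; [|exists s; tauto].
    intros s Hs E. apply (Hom y s Hy Hs).
    replace (h y) with (q + Ci * v y)%C.
    - rewrite E, RtoC_opp. ring.
    - unfold v. replace (q + Ci * (- Ci * (h y - q)))%C
        with (q - (Ci * Ci) * (h y - q))%C by ring.
      rewrite HCi. apply injective_projections; simpl; ring. }
  apply choice in Hex. destruct Hex as [s Hs].
  assert (Hsd : forall y, Cmod y < 1 -> cdiff s y /\ 0 <= Re (s y)).
  { intros y Hy. split; [|left; now apply Hs].
    apply (cdiff_square_root v).
    - eapply near_imp; [|exact (near_in_disc y Hy)]. intros x Hx; now apply Hs.
    - apply cdiff_mult; [apply cdiff_const|].
      apply cdiff_minus; [now apply Hd|apply cdiff_const]. }
  pose proof (schwarz_pick s a z Hsd Ha Hz) as H.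
  assert (Hv : forall y, Cmod y < 1 -> Cmod (s y) * Cmod (s y) = Cmod (h y - q)%C).
  { intros y Hy. rewrite <- Cmod_mult, (proj2 (Hs y Hy)). unfold v.
    rewrite Cmod_mult, Cmod_opp, Cmod_Ci. ring. }
  assert (Hdiff : Cmod (h z - h a)%C = Cmod (s z - s a)%C * Cmod (s z + s a)%C).
  { rewrite <- Cmod_mult.
    replace ((s z - s a) * (s z + s a))%C with (s z * s z - s a * s a)%C by ring.
    rewrite (proj2 (Hs z Hz)), (proj2 (Hs a Ha)). unfold v.
    replace (- Ci * (h z - q) - - Ci * (h a - q))%C with (- Ci * (h z - h a))%C by ring.
    rewrite Cmod_mult, Cmod_opp, Cmod_Ci. ring. }
  rewrite Hdiff, <- (Hv z Hz), <- (Hv a Ha).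
  pose proof (Cmod_ge_0 (s z)) as P1. pose proof (Cmod_ge_0 (s a)) as P2.
  pose proof (Cmod_ge_0 (s z + s a)%C) as P3.
  pose proof (Cmod_ge_0 (z - a)%C) as P4.
  pose proof (Cmod_triangle (s z) (s a)) as T1.
  pose proof (Cmod_triangle (s z) (Cconj (s a))) as T2. rewrite Cmod_conj in T2.
  pose proof (Cmod_ge_0 (s z + Cconj (s a))%C) as P5.
  apply Rle_trans with (Cmod (z - a)%C * Cmod (s z + Cconj (s a))%C * Cmod (s z + s a)%C).
  { apply Rmult_le_compat_r with (r := Cmod (s z + s a)%C) in H; [|exact P3]. lra. }
  assert (HS : Cmod (s z + Cconj (s a))%C * Cmod (s z + s a)%C
    <= (Cmod (s z) + Cmod (s a)) * (Cmod (s z) + Cmod (s a)))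
    by (apply Rmult_le_compat; assumption).
  assert (HS2 : (Cmod (s z) + Cmod (s a)) * (Cmod (s z) + Cmod (s a))
    <= 2 * (Cmod (s z) * Cmod (s z) + Cmod (s a) * Cmod (s a))).
  { pose proof (pow2_ge_0 (Cmod (s z) - Cmod (s a))). lra. }
  rewrite Rmult_assoc, Rmult_comm. apply Rmult_le_compat_r; [exact P4|]. lra.
Qed.

(** * Julia's lemma for a semigroup *)

Lemma ccont_sequence (x : nat -> C) (l : C) f :
  ccont f l -> (forall eps, 0 < eps -> exists N, forall n, (N <= n)%nat -> Cmod (x n - l)%C < eps) ->
  forall eps, 0 < eps -> exists N, forall n, (N <= n)%nat -> Cmod (f (x n) - f l)%C < eps.
Proof.
  intros Hf Hx eps He. destruct (Hf eps He) as [d [Hd Hn]].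
  destruct (Hx d Hd) as [N HN]. exists N; intros n Hn'. apply Hn, HN, Hn'.
Qed.

(** This selects the times at which the orbit does not move away from the
    boundary. *)
Lemma positive_null_sequence_descends (u : nat -> R) :
  (forall n, 0 < u n) -> (forall eps, 0 < eps -> exists n, forall m, (n <= m)%nat -> u m < eps) ->
  forall N, exists n, (N <= n)%nat /\ u (S n) <= u n.
Proof.
  intros Hp H0 N. apply NNPP; intros Hno.
  assert (Hi : forall k, u N <= u (N + k)%nat).
  { induction k as [|k IH]; [rewrite Nat.add_0_r; lra|].
    rewrite Nat.add_succ_r. apply Rnot_lt_le; intros Hlt.
    apply Hno; exists (N + k)%nat; split; [lia|lra]. }
  destruct (H0 (u N) (Hp N)) as [n Hn].
  specialize (Hn (N + n)%nat ltac:(lia)). specialize (Hi n). lra.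
Qed.

Lemma orbit_tends_to_dw phi tau z : denjoy_wolff_point phi tau -> Cmod z < 1 ->
  forall eps, 0 < eps -> exists T, forall t, T < t -> Cmod (phi t z - tau)%C < eps.
Proof.
  intros [_ H] Hz eps He.
  assert (HP : locally tau (fun y => Cmod (y - tau)%C < eps)).
  { apply locally_C. exists (mkposreal eps He). intros y Hy. exact Hy. }
  destruct (H z Hz _ HP) as [T HT]. exists T; exact HT.
Qed.

(** Compare [z] with the points x_n of the orbit of 0 at the times n s, by
    [schwarz_pick] for the map phi_s, which sends x_n to x_(n+1). Both tend to the
    boundary point tau; in the limit the inequality becomes the assertion,
    provided u_(n+1) <= u_n, where u_n = Re (1 / P(x_n)) measures how close x_n
    is to the boundary. Since u_n > 0 tends to 0, this holds for infinitely
    many n. *)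
Lemma Re_cayley_nondecreasing phi tau s z :
  holomorphic_semigroup phi -> denjoy_wolff_point phi tau -> Cmod tau = 1 ->
  0 <= s -> Cmod z < 1 -> Re (cayley tau z) <= Re (cayley tau (phi s z)).
Proof.
  intros Hphi Hdw Ht Hs0 Hz.
  destruct Hs0 as [Hs| <-]; [|rewrite (hs_zero _ Hphi); [lra|exact Hz]].
  assert (Hself : forall t y, 0 <= t -> Cmod y < 1 -> Cmod (phi t y) < 1)
    by exact (hs_self_map _ Hphi).
  assert (H0 : Cmod (RtoC 0) < 1) by (rewrite Cmod_0; lra).
  set (x := fun n : nat => phi (INR n * s) (RtoC 0)).
  assert (Hns : forall n, 0 <= INR n * s) by (intros n; apply Rmult_le_pos; [apply pos_INR|lra]).
  assert (Hx : forall n, Cmod (x n) < 1) by (intros n; now apply Hself).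
  assert (HxS : forall n, x (S n) = phi s (x n)).
  { intros n. unfold x. rewrite S_INR.
    replace ((INR n + 1) * s) with (s + INR n * s) by ring.
    apply (hs_add _ Hphi); trivial; lra. }
  assert (Hlim : forall eps, 0 < eps -> exists N, forall n, (N <= n)%nat -> Cmod (x n - tau)%C < eps).
  { intros eps He. destruct (orbit_tends_to_dw _ _ _ Hdw H0 eps He) as [T HT].
    destruct (INR_unbounded (T / s)) as [N HN]. exists N; intros n Hn.
    apply HT. apply le_INR in Hn.
    apply Rmult_lt_reg_r with (/ s); [now apply Rinv_0_lt_compat|].
    rewrite Rmult_assoc, Rinv_r, Rmult_1_r by lra. unfold Rdiv in HN. lra. }
  
  (* The reciprocal of the Cayley transform, which is continuous at [tau]. *)
  set (r := fun y => ((tau - y) / (tau + y))%C).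
  assert (Hden : forall y, Cmod y < 1 -> (tau + y)%C <> RtoC 0).
  { intros y Hy. pose proof (cayley_den_neq tau (- y)%C Ht) as H. rewrite Cmod_opp in H.
    specialize (H Hy). replace (tau - - y)%C with (tau + y)%C in H by ring. exact H. }
  assert (Hrc : forall y, Cmod y < 1 -> (r y * cayley tau y)%C = RtoC 1).
  { intros y Hy. unfold r, cayley. field. split; [now apply cayley_den_neq|now apply Hden]. }
  assert (Hrt : r tau = RtoC 0).
  { unfold r. replace (tau - tau)%C with (RtoC 0) by ring. unfold Cdiv; ring. }
  assert (Htau2 : (tau + tau)%C <> RtoC 0).
  { apply Cmod_gt_0. replace (tau + tau)%C with (RtoC 2 * tau)%C
      by (apply injective_projections; simpl; ring).
    rewrite Cmod_mult, Cmod_R, Rabs_pos_eq, Ht; lra. }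
  assert (Crt : ccont r tau).
  { apply cdiff_cont, cdiff_div; trivial.
    - apply cdiff_minus; [apply cdiff_const|apply cdiff_id].
    - apply cdiff_plus; [apply cdiff_const|apply cdiff_id]. }
  set (g := fun y => cayley tau (phi s y)).
  assert (Hg : forall y, Cmod y < 1 -> cdiff g y /\ 0 <= Re (g y)).
  { intros y Hy. split.
    - apply (cdiff_comp (phi s) (cayley tau)).
      + apply ex_derive_cdiff. apply (hs_holomorphic _ Hphi); [lra|exact Hy].
      + apply cdiff_cayley; [exact Ht|]. apply Hself; [lra|exact Hy].
    - left; apply Re_cayley_pos; [exact Ht|]. apply Hself; [lra|exact Hy]. }
  set (u := fun n => Re (r (x n))).
  assert (Hur : forall n, u n * Cmod (cayley tau (x n)) ^ 2 = Re (cayley tau (x n))).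
  { intros n. unfold u. pose proof (Hrc (x n) (Hx n)) as E.
    set (p := cayley tau (x n)) in *. set (rr := r (x n)) in *.
    assert (E2 : (rr * RtoC (Cmod p ^ 2))%C = Cconj p).
    { rewrite Cmod2_conj. replace (rr * (p * Cconj p))%C with ((rr * p) * Cconj p)%C by ring.
      rewrite E; ring. }
    apply (f_equal Re) in E2. rewrite re_conj in E2. rewrite <- E2.
    destruct rr; unfold Re; simpl; ring. }
  assert (Hpos : forall n, 0 < Re (cayley tau (x n))) by (intros n; now apply Re_cayley_pos).
  assert (Hpm : forall n, 0 < Cmod (cayley tau (x n))).
  { intros n. pose proof (re_le_Cmod (cayley tau (x n))) as H. specialize (Hpos n).
    rewrite Rabs_pos_eq in H; lra. }
  assert (Hup : forall n, 0 < u n).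
  { intros n. specialize (Hur n). specialize (Hpos n). specialize (Hpm n).
    assert (0 < Cmod (cayley tau (x n)) ^ 2) by now apply pow_lt.
    apply Rnot_le_lt; intros Hle. nra. }
  assert (Hu0 : forall eps, 0 < eps -> exists n, forall m, (n <= m)%nat -> u m < eps).
  { intros eps He. destruct (ccont_sequence x tau r Crt Hlim eps He) as [N HN].
    exists N; intros n Hn. specialize (HN n Hn). rewrite Hrt in HN.
    rewrite Csub_0_r in HN. pose proof (re_le_Cmod (r (x n))) as H.
    unfold u. pose proof (Rle_abs (Re (r (x n)))). lra. }
  set (P := cayley tau z). set (Gz := g z).
  assert (HPp : 0 < Re P) by now apply Re_cayley_pos.
  assert (HGp : 0 <= Re Gz) by now apply Hg.
  (* Schwarz-Pick at [x n], in the form 1 - |.|^2, divided by the squared moduli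
     of the Cayley transforms of [x n] and [x (S n)]. *)
  assert (Hkey : forall n,
    Re P * u n * Cmod (Cconj (r (x (S n))) * Gz + 1)%C ^ 2
    <= Re Gz * u (S n) * Cmod (Cconj (r (x n)) * P + 1)%C ^ 2).
  { intros n.
    pose proof (schwarz_pick g (x n) z Hg (Hx n) Hz) as HSP.
    pose proof (cayley_pseudo_distance tau (x n) z Ht (Hx n) Hz) as HC.
    change (g (x n)) with (cayley tau (phi s (x n))) in HSP. rewrite <- HxS in HSP.
    fold P in HC. fold Gz in HSP.
    set (p := cayley tau (x n)) in *. set (p' := cayley tau (x (S n))) in *.
    pose proof (moebius_den_neq (x n) z (Hx n) Hz) as Hn. apply Cmod_gt_0 in Hn.
    set (D := Cmod (1 - Cconj (x n) * z)%C) in *. set (E := Cmod (z - x n)%C) in *.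
    assert (Hcross : Cmod (Gz - p')%C * Cmod (P + Cconj p)%C
      <= Cmod (P - p)%C * Cmod (Gz + Cconj p')%C).
    { apply Rmult_le_reg_r with (1 := Hn).
      apply Rmult_le_compat_r with (r := Cmod (P + Cconj p)%C) in HSP; [|apply Cmod_ge_0].
      replace (Cmod (P - p)%C * Cmod (Gz + Cconj p')%C * D)
        with (Cmod (P - p)%C * D * Cmod (Gz + Cconj p')%C) by ring.
      rewrite HC. lra. }
    assert (Hsq : (Cmod (Gz - p')%C * Cmod (P + Cconj p)%C) ^ 2
      <= (Cmod (P - p)%C * Cmod (Gz + Cconj p')%C) ^ 2).
    { apply pow_incr; split; [apply Rmult_le_pos; apply Cmod_ge_0|exact Hcross]. }
    rewrite !Rpow_mult_distr in Hsq.
    pose proof (halfplane_identity Gz p') as I1. pose proof (halfplane_identity P p) as I2.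
    assert (Hmain : Re P * Re p * Cmod (Gz + Cconj p')%C ^ 2
      <= Re Gz * Re p' * Cmod (P + Cconj p)%C ^ 2).
    { set (A := Cmod (Gz + Cconj p')%C ^ 2) in *. set (B := Cmod (P + Cconj p)%C ^ 2) in *.
      replace (Cmod (Gz - p')%C ^ 2) with (A - 4 * Re Gz * Re p') in Hsq by lra.
      replace (Cmod (P - p)%C ^ 2) with (B - 4 * Re P * Re p) in Hsq by lra. nra. }
    assert (F : forall (m : nat) w, Cmod (w + Cconj (cayley tau (x m)))%C ^ 2
      = Cmod (cayley tau (x m)) ^ 2 * Cmod (Cconj (r (x m)) * w + 1)%C ^ 2).
    { intros m w. rewrite <- Rpow_mult_distr. f_equal.
      rewrite <- (Cmod_conj (cayley tau (x m))), <- Cmod_mult. f_equal.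
      replace (Cconj (cayley tau (x m)) * (Cconj (r (x m)) * w + 1))%C
        with (Cconj (cayley tau (x m)) + w * (Cconj (r (x m)) * Cconj (cayley tau (x m))))%C by ring.
      rewrite <- Cmult_conj, Hrc by apply Hx.
      apply injective_projections; simpl; ring. }
    unfold p, p' in Hmain. rewrite !F in Hmain.
    rewrite <- (Hur n), <- (Hur (S n)) in Hmain.
    apply Rmult_le_reg_r with (Cmod (cayley tau (x n)) ^ 2 * Cmod (cayley tau (x (S n))) ^ 2).
    { apply Rmult_lt_0_compat; apply pow_lt; apply Hpm. }
    match type of Hmain with ?A <= ?B => eapply Rle_trans; [|eapply Rle_trans; [exact Hmain|]] end;
      right; ring. }
  apply Rnot_lt_le; intros Hlt. fold (g z) in Hlt. fold Gz P in Hlt.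
  set (dl := (Re P - Re Gz) / (4 * (Re P + 1))).
  assert (Hlim1 : forall w eps, 0 < eps -> exists N, forall n, (N <= n)%nat ->
    Rabs (Cmod (Cconj (r (x n)) * w + 1)%C ^ 2 - 1) < eps).
  { intros w eps He.
    set (F := fun y => ((Cconj (r y) * w + 1) * (Cconj (r y) * w + 1))%C).
    assert (CF : ccont F tau).
    { assert (ccont (fun y => Cconj (r y) * w + 1)%C tau).
      { apply ccont_plus; [|apply ccont_const]. apply ccont_mult; [|apply ccont_const].
        apply ccont_comp; [exact Crt|apply ccont_conj]. }
      now apply ccont_mult. }
    destruct (ccont_sequence x tau F CF Hlim eps He) as [N HN].
    exists N; intros n Hn. eapply Rle_lt_trans; [|exact (HN n Hn)].
    replace (F tau) with (RtoC 1).
    2:{ unfold F. rewrite Hrt. apply injective_projections; simpl; ring. }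
    unfold F. set (y := (Cconj (r (x n)) * w + 1)%C).
    replace (Cmod y ^ 2) with (Cmod (y * y)%C) by (rewrite Cmod_mult; ring).
    pose proof (Cmod_tri_le (y * y)%C (RtoC 1)) as T1.
    pose proof (Cmod_tri_le (RtoC 1) (y * y)%C) as T2. rewrite Cmod_sub_sym in T2.
    rewrite Cmod_1 in T1, T2. apply Rabs_le_between. lra. }
  assert (Hdl : 0 < dl) by (apply Rdiv_lt_0_compat; lra).
  assert (Hdl2 : dl * (4 * (Re P + 1)) = Re P - Re Gz) by (unfold dl; field; lra).
  destruct (Hlim1 Gz dl Hdl) as [N1 H1]. destruct (Hlim1 P dl Hdl) as [N2 H2].
  destruct (positive_null_sequence_descends u Hup Hu0 (N1 + N2)) as [n [Hn Hdesc]].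
  specialize (H1 (S n) ltac:(lia)). specialize (H2 n ltac:(lia)). specialize (Hkey n).
  apply Rabs_lt_between in H1. apply Rabs_lt_between in H2.
  set (A := Cmod (Cconj (r (x (S n))) * Gz + 1)%C ^ 2) in *.
  set (B := Cmod (Cconj (r (x n)) * P + 1)%C ^ 2) in *.
  assert (HB : 0 <= B) by (apply pow2_ge_0).
  pose proof (Hup n).
  assert (S1 : Re Gz * u (S n) * B <= Re Gz * u n * B).
  { apply Rmult_le_compat_r; [exact HB|]. now apply Rmult_le_compat_l. }
  assert (S2 : u n * (Re P * A - Re Gz * B) <= 0) by lra.
  assert (S3 : 0 < Re P * A - Re Gz * B).
  { assert (Re P * (1 - dl) < Re P * A) by (apply Rmult_lt_compat_l; lra).
    assert (Re Gz * B <= Re Gz * (1 + dl)) by (apply Rmult_le_compat_l; lra).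
    assert (Re Gz * dl <= Re P * dl) by (apply Rmult_le_compat_r; lra). lra. }
  assert (0 < u n * (Re P * A - Re Gz * B)) by now apply Rmult_lt_0_compat.
  lra.
Qed.

(** * Increments along an orbit *)

(** The slack 1/2 in c (1 + k) = 1/2 absorbs the position of [w0] relative to the
    apex of the sector once t is large. *)
Lemma sector_contains_large_discs Omega :
  contains_vertical_sector Omega ->
  exists c, 0 < c <= 1 /\ forall w0, exists T, 0 < T /\ forall t, T <= t ->
    forall w, Cmod (w - (w0 + Ci * RtoC t))%C < c * t -> Omega w.
Proof.
  intros [p [k [Hk HS]]].
  exists (/ (2 * (1 + k))). split.
  { split; [apply Rinv_0_lt_compat; lra|].
    rewrite <- Rinv_1. apply Rinv_le_contravar; lra. }
  intros w0.
  set (B := Rabs (Im (w0 - p)%C) + k * Rabs (Re (w0 - p)%C)).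
  assert (HB : 0 <= B).
  { apply Rplus_le_le_0_compat; [apply Rabs_pos|].
    apply Rmult_le_pos; [lra|apply Rabs_pos]. }
  exists (2 * B + 1); split; [lra|]. intros t Ht w Hw.
  apply HS. unfold vertical_sector.
  set (e := (w - (w0 + Ci * RtoC t))%C) in *.
  assert (HR : Re (w - p)%C = Re (w0 - p)%C + Re e).
  { unfold e, Re; simpl; ring. }
  assert (HI : Im (w - p)%C = Im (w0 - p)%C + t + Im e).
  { unfold e, Im; simpl; ring. }
  rewrite HR, HI.
  pose proof (re_le_Cmod e) as R1. pose proof (im_le_Cmod e) as R2.
  pose proof (Rabs_triang (Re (w0 - p)%C) (Re e)) as T1.
  pose proof (Rabs_maj2 (Im (w0 - p)%C)) as T2. pose proof (Rabs_maj2 (Im e)) as T3.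
  assert (Hc : (1 + k) * (/ (2 * (1 + k)) * t) = t / 2) by (field; lra).
  assert ((1 + k) * Cmod e < t / 2).
  { rewrite <- Hc. apply Rmult_lt_compat_l; lra. }
  apply Rmult_le_compat_l with (r := k) in T1; [|lra].
  apply Rmult_le_compat_l with (r := k) in R1; [|lra].
  unfold B in Ht. lra.
Qed.

(** The three hypotheses after monotonicity are: Harnack for P, Harnack for the
    increments of P, and the lower bound for increments coming from the omitted
    half-line. The step c t / 2 keeps consecutive points at pseudo-hyperbolic
    distance at most 1/2, where Harnack reads |g_(j+1) - g_j| <= 2 Re g_j, so
    that Re g_j <= 3^j Re g_0. At time t + N a the same step has
    pseudo-hyperbolic length at most [th], of order 1/N, and N is chosen so large that
    40 th |g_0| <= (lam / 2) |g_0|. *)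
Lemma increment_direction (P : R -> C) (T c : R) :
  0 < T -> 0 < c <= 1 ->
  (forall s t, 0 <= s <= t -> Re (P s) <= Re (P t)) ->
  (forall s t th, T <= t <= s -> s - t <= th * (c * t) ->
     (1 - th) * Cmod (P s - P t)%C <= 2 * th * Re (P t)) ->
  (forall a s t th, 0 <= a -> T <= t <= s -> s - t <= th * (c * t) ->
     (1 - th) * Cmod ((P (s + a)%R - P s) - (P (t + a)%R - P t))%C
     <= 2 * th * Re (P (t + a)%R - P t)%C) ->
  (forall a t, T <= t -> 0 <= a <= t ->
     a * Re (P t) <= 10 * t * Cmod (P (t + a)%R - P t)%C) ->
  exists K, 0 < K /\ forall t, T <= t ->
    Cmod (P (t + c / 2 * t)%R - P t)%C <= K * (Re (P (t + c / 2 * t)%R) - Re (P t)).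
Proof.
  intros HT Hc Hmono Hfar Hhar Hlow.
  set (lam := c / 2).
  assert (Hlam : 0 < lam <= 1 / 2) by (unfold lam; lra).
  (* With th = 1 / (2 (1 + lam N)) this gives 40 th <= lam / 2. *)
  destruct (INR_unbounded (40 / (lam * lam))) as [N HN].
  assert (HN' : 40 < INR N * (lam * lam)).
  { apply Rmult_lt_reg_r with (/ (lam * lam)); [apply Rinv_0_lt_compat; nra|].
    rewrite Rmult_assoc, Rinv_r, Rmult_1_r by nra. unfold Rdiv in HN. lra. }
  exists (6 * 3 ^ N).
  assert (H3 : 0 < 3 ^ N) by (apply pow_lt; lra).
  split; [lra|]. intros t Ht.
  set (a := lam * t). assert (Ha : 0 < a) by (unfold a; nra).
  set (tj := fun j : nat => t + INR j * a).
  set (g := fun j => (P (tj j + a)%R - P (tj j))%C).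
  assert (Htj : forall j, t <= tj j).
  { intros j; unfold tj. pose proof (pos_INR j). nra. }
  assert (HtS : forall j, tj (S j) = tj j + a).
  { intros j; unfold tj; rewrite S_INR; ring. }
  assert (Ht0 : tj 0%nat = t) by (unfold tj; simpl; ring).
  assert (Hre : forall j, Re (g j) = Re (P (tj j + a)%R) - Re (P (tj j))).
  { intros j; reflexivity. }
  assert (Hstep : forall j, Cmod (g (S j) - g j)%C <= 2 * Re (g j)).
  { intros j. specialize (Htj j).
    assert (Hs : tj j + a - tj j <= 1 / 2 * (c * tj j)) by (unfold a, lam; nra).
    pose proof (Hhar a (tj j + a) (tj j) (1 / 2) ltac:(lra) ltac:(lra) Hs) as H.
    change (P (tj j + a)%R - P (tj j))%C with (g j) in H.
    rewrite <- HtS in H. change (P (tj (S j) + a)%R - P (tj (S j)))%C with (g (S j)) in H.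
    lra. }
  set (R0 := Re (g 0%nat)).
  assert (HR0 : 0 <= R0).
  { unfold R0. rewrite Hre, Ht0. pose proof (Hmono t (t + a) ltac:(lra)). lra. }
  assert (Hind : forall j, Re (g j) <= 3 ^ j * R0 /\
    Cmod (g j - g 0%nat)%C <= (3 ^ j - 1) * R0 /\
    Re (P (tj j)) - Re (P t) <= (3 ^ j - 1) * R0).
  { induction j as [|j [I1 [I2 I3]]].
    - rewrite Ht0. replace (g 0%nat - g 0%nat)%C with (RtoC 0) by ring.
      rewrite Cmod_0. change (3 ^ 0) with 1. unfold R0. repeat split; lra.
    - specialize (Hstep j). change (3 ^ S j) with (3 * 3 ^ j).
      pose proof (re_le_Cmod (g (S j) - g j)%C) as Hr.
      change (Re (g (S j) - g j)%C) with (Re (g (S j)) - Re (g j)) in Hr.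
      pose proof (Rle_abs (Re (g (S j)) - Re (g j))).
      pose proof (Cmod_tri (g (S j)) (g j) (g 0%nat)).
      specialize (Hre j). rewrite HtS.
      assert (1 <= 3 ^ j) by (apply pow_R1_Rle; lra).
      assert (0 <= (3 ^ j - 1) * R0) by (apply Rmult_le_pos; lra).
      repeat split; lra. }
  destruct (Hind N) as [_ [I2 I3]].
  pose proof (Hlow a t Ht) as HL. specialize (HL ltac:(unfold a; nra)).
  assert (HL' : lam * Re (P t) <= 10 * Cmod (g 0%nat)).
  { unfold g. rewrite Ht0. unfold a in HL at 1.
    apply Rmult_le_reg_r with t; [lra|]. lra. }
  set (th := / (2 * (1 + lam * INR N))).
  assert (HlN : 0 <= lam * INR N) by (apply Rmult_le_pos; [lra|apply pos_INR]).
  assert (Hth : 0 < th <= 1 / 2).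
  { unfold th; split; [apply Rinv_0_lt_compat; lra|].
    replace (1 / 2) with (/ 2) by lra. apply Rinv_le_contravar; lra. }
  pose proof (Hfar (tj N + a) (tj N) th) as HF.
  specialize (Htj N). specialize (HF ltac:(lra)).
  assert (Hs : tj N + a - tj N <= th * (c * tj N)).
  { right. unfold th, tj, a.
    replace c with (2 * lam) by (unfold lam; lra). field. lra. }
  specialize (HF Hs). change (P (tj N + a)%R - P (tj N))%C with (g N) in HF.
  assert (Hsmall : 4 * th * 10 <= lam / 2).
  { apply Rmult_le_reg_r with (2 * (1 + lam * INR N)); [lra|].
    replace (4 * th * 10 * (2 * (1 + lam * INR N))) with 40 by (unfold th; field; lra).
    nra. }
  pose proof (Cmod_ge_0 (g N)) as Pg. pose proof (Cmod_ge_0 (g 0%nat)) as Pg0.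
  assert (HgN : Cmod (g N) <= 4 * th * Re (P (tj N))) by nra.
  assert (HgN2 : Cmod (g N) <= 4 * th * Re (P t) + 2 * ((3 ^ N - 1) * R0)).
  { assert (0 <= (3 ^ N - 1) * R0).
    { apply Rmult_le_pos; [|lra]. assert (1 <= 3 ^ N) by (apply pow_R1_Rle; lra). lra. }
    assert (4 * th * (Re (P (tj N)) - Re (P t)) <= 4 * th * ((3 ^ N - 1) * R0))
      by (apply Rmult_le_compat_l; lra).
    assert (4 * th * ((3 ^ N - 1) * R0) <= 2 * ((3 ^ N - 1) * R0))
      by (apply Rmult_le_compat_r; lra).
    lra. }
  assert (HXM : 4 * th * Re (P t) <= Cmod (g 0%nat) / 2).
  { apply Rmult_le_reg_l with lam; [lra|].
    replace (lam * (4 * th * Re (P t))) with (4 * th * (lam * Re (P t))) by ring.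
    apply Rle_trans with (4 * th * (10 * Cmod (g 0%nat))).
    - apply Rmult_le_compat_l; lra.
    - replace (4 * th * (10 * Cmod (g 0%nat))) with (4 * th * 10 * Cmod (g 0%nat)) by ring.
      apply Rle_trans with (lam / 2 * Cmod (g 0%nat)); [|lra].
      now apply Rmult_le_compat_r. }
  pose proof (Cmod_tri_le (g 0%nat) (g N)) as Ht1. rewrite Cmod_sub_sym in Ht1.
  (* |g_0| <= |g_N| + |g_0 - g_N|, and half of |g_0| is absorbed by [HXM]. *)
  assert (Hfin : Cmod (g 0%nat) <= 6 * 3 ^ N * R0) by lra.
  unfold R0 in Hfin. rewrite Hre in Hfin. unfold g in Hfin. rewrite Ht0 in Hfin.
  exact Hfin.
Qed.

(** Divide t by 1 + lam until it falls into the fundamental interval from T to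
    T (1 + lam). *)
Lemma geometric_telescoping (P : R -> C) (T lam K B : R) :
  0 < T -> 0 < lam -> 0 <= K -> 0 <= B -> (forall t, T <= t -> 0 <= Re (P t)) ->
  (forall t, T <= t <= T * (1 + lam) -> Cmod (P t) <= B) ->
  (forall t, T <= t ->
    Cmod (P (t + lam * t)%R - P t)%C <= K * (Re (P (t + lam * t)%R) - Re (P t))) ->
  forall t, T <= t -> Cmod (P t) <= B + K * Re (P t).
Proof.
  intros HT Hlam HK HB Hpos Hbase Hinc.
  assert (Hn : forall n t, T <= t <= T * (1 + lam) ^ n -> Cmod (P t) <= B + K * Re (P t)).
  { induction n as [|n IH]; intros t Ht;
    (assert (0 <= K * Re (P t)) by (apply Rmult_le_pos; [lra|apply Hpos; lra]));
    (destruct (Rle_dec t (T * (1 + lam))) as [Hle|Hle];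
     [pose proof (Hbase t ltac:(lra)); lra|]).
    - simpl in Ht. nra.
    - set (t' := t / (1 + lam)).
      assert (Et : t = t' + lam * t') by (unfold t'; field; lra).
      assert (Ht' : T <= t').
      { apply Rmult_le_reg_r with (1 + lam); lra. }
      assert (Ht2 : t' <= T * (1 + lam) ^ n).
      { apply Rmult_le_reg_r with (1 + lam); [lra|]. simpl in Ht. lra. }
      specialize (IH t' ltac:(lra)). specialize (Hinc t' Ht'). rewrite <- Et in Hinc.
      pose proof (Cmod_tri_le (P t) (P t')). lra. }
  intros t Ht. destruct (Pow_x_infinity (1 + lam)) with (b := t / T) as [n Hn'].
  { rewrite Rabs_pos_eq; lra. }
  apply (Hn n). split; [exact Ht|]. specialize (Hn' n (le_n n)).
  rewrite Rabs_pos_eq in Hn' by (apply pow_le; lra).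
  apply Rge_le in Hn'. apply Rmult_le_compat_l with (r := T) in Hn'; [|lra].
  replace (T * (t / T)) with t in Hn' by (field; lra). exact Hn'.
Qed.

(** * Arguments and cluster sets *)

Lemma Arg_atan V : 0 < Re V -> Arg V = atan (Im V / Re V).
Proof.
  intros HV. pose proof (re_le_Cmod V) as Hm. rewrite Rabs_pos_eq in Hm by lra.
  pose proof (Cmod2_alt V) as H2.
  set (r := Im V / Re V).
  assert (Hr : 0 < 1 + r²) by (pose proof (Rle_0_sqr r); lra).
  assert (Hcos : Re V / Cmod V = cos (atan r)).
  { rewrite cos_atan.
    assert (E : Cmod V = Re V * sqrt (1 + r²)).
    { apply Rsqr_inj; [apply Cmod_ge_0|apply Rmult_le_pos; [lra|apply sqrt_pos]|].
      rewrite Rsqr_mult, Rsqr_sqrt by lra.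
      rewrite Rsqr_pow2, H2. unfold r, Rsqr. field. lra. }
    rewrite E. pose proof (sqrt_lt_R0 _ Hr). field. lra. }
  pose proof (atan_bound r) as Hb.
  unfold Arg. rewrite Hcos.
  destruct (Rle_dec 0 (Im V)) as [Hi|Hi].
  - apply acos_cos. split; [|lra].
    assert (H0 : 0 <= r) by (apply Rmult_le_pos; [exact Hi|left; now apply Rinv_0_lt_compat]).
    rewrite <- atan_0. destruct H0 as [H0|<-]; [left; now apply atan_increasing|lra].
  - rewrite <- cos_neg, acos_cos; [ring|]. split; [|lra].
    assert (H0 : r < 0).
    { unfold r. apply Rmult_lt_reg_r with (1 := HV). unfold Rdiv.
      rewrite Rmult_assoc, Rinv_l by lra. lra. }
    apply atan_increasing in H0. rewrite atan_0 in H0. lra.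
Qed.

(** 1 - conj(tau) z = 2 / (P + 1) for the Cayley transform P of z. *)
Lemma Arg_cayley tau z : Cmod tau = 1 -> Cmod z < 1 ->
  Arg (1 - Cconj tau * z)%C = - atan (Im (cayley tau z) / (Re (cayley tau z) + 1)).
Proof.
  intros Ht Hz. pose proof (cayley_den_neq tau z Ht Hz) as Hn.
  pose proof (Re_cayley_pos tau z Ht Hz) as HX.
  set (V := (1 - Cconj tau * z)%C). set (P := cayley tau z) in *.
  assert (E : (V * (P + 1))%C = RtoC 2).
  { assert (HVt : (V * tau)%C = (tau - z)%C).
    { unfold V. replace ((1 - Cconj tau * z) * tau)%C with (tau - (tau * Cconj tau) * z)%C
        by ring. rewrite Cmult_conj_unit by exact Ht. ring. }
    replace (V * (P + 1))%C with (RtoC 2 * (V * tau) / (tau - z))%C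
      by (unfold P, cayley; field; exact Hn).
    rewrite HVt. field. exact Hn. }
  assert (HV : 0 < Re V).
  { pose proof (re_le_Cmod (Cconj tau * z)%C) as Hr.
    rewrite Cmod_mult, Cmod_conj, Ht in Hr. pose proof (Rle_abs (Re (Cconj tau * z)%C)).
    unfold V. change (0 < 1 - Re (Cconj tau * z)%C). lra. }
  rewrite Arg_atan by exact HV. rewrite <- atan_opp. f_equal.
  apply (f_equal Im) in E.
  assert (EI : Re V * Im P + Im V * (Re P + 1) = 0).
  { rewrite <- (eq_refl : Im (RtoC 2) = 0), <- E. unfold Re, Im; simpl; ring. }
  apply Rmult_eq_reg_r with (Re V * (Re P + 1)); [|apply Rmult_integral_contrapositive; lra].
  field_simplify; lra.
Qed.

Lemma atan_lipschitz x y : Rabs (atan x - atan y) <= Rabs (x - y).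
Proof.
  assert (H : forall a b, a < b -> 0 <= atan b - atan a <= b - a).
  { intros a b Hab.
    destruct (MVT_cor2 atan (fun x => / (1 + x ^ 2)) a b Hab) as [c [Hc _]].
    - intros c _. apply derivable_pt_lim_atan.
    - rewrite Hc. pose proof (pow2_ge_0 c).
      assert (0 < / (1 + c ^ 2)) by (apply Rinv_0_lt_compat; lra).
      assert (/ (1 + c ^ 2) <= 1) by (rewrite <- Rinv_1; apply Rinv_le_contravar; lra).
      split; nra. }
  destruct (Rtotal_order x y) as [Hl|[->|Hl]].
  - pose proof (H x y Hl). rewrite !Rabs_left1 by lra. lra.
  - rewrite !Rminus_diag, Rabs_R0; lra.
  - pose proof (H y x Hl). rewrite !Rabs_pos_eq by lra. lra.
Qed.

(** The bounds [a] and [b] are the lower and upper limits of [f]; intermediate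
    values are taken at arbitrarily late times by continuity. *)
Lemma cluster_set_interval f m T0 :
  continuity f -> (forall t, T0 <= t -> Rabs (f t) <= m) ->
  exists a b, - m <= a /\ a <= b /\ b <= m /\
    forall theta, cluster_point_at_infinity f theta <-> a <= theta <= b.
Proof.
  intros Hf Hm.
  assert (Hmm : 0 <= m) by (eapply Rle_trans; [apply Rabs_pos|apply (Hm T0); lra]).
  assert (Hsup : forall g, (forall t, T0 <= t -> Rabs (g t) <= m) ->
    exists b, - m <= b <= m /\
     (forall eps, 0 < eps -> forall T, exists t, T <= t /\ b - eps < g t) /\
     (forall eps, 0 < eps -> exists T, forall t, T <= t -> g t < b + eps)).
  { intros g Hg.
    destruct (completeness (fun x => forall T, exists t, T <= t /\ x <= g t)) as [b [Hub Hlub]].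
    - exists m. intros x Hx. destruct (Hx T0) as [t [Ht Hxt]]. specialize (Hg t Ht).
      apply Rabs_le_between in Hg. lra.
    - exists (- m). intros T. exists (Rmax T T0). split; [apply Rmax_l|].
      specialize (Hg (Rmax T T0) (Rmax_r _ _)). apply Rabs_le_between in Hg. lra.
    - exists b. repeat split.
      + apply Hub. intros T. exists (Rmax T T0). split; [apply Rmax_l|].
        specialize (Hg (Rmax T T0) (Rmax_r _ _)). apply Rabs_le_between in Hg. lra.
      + apply Hlub. intros x Hx. destruct (Hx T0) as [t [Ht Hxt]]. specialize (Hg t Ht).
        apply Rabs_le_between in Hg. lra.
      + intros eps He T. apply NNPP; intros Hno.
        assert (b <= b - eps); [|lra]. apply Hlub. intros x Hx. apply Rnot_lt_le; intros Hlt.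
        destruct (Hx T) as [t [Ht Hxt]]. apply Hno; exists t; split; [exact Ht|lra].
      + intros eps He. apply NNPP; intros Hno.
        assert (b + eps <= b); [|lra]. apply Hub. intros T. apply NNPP; intros Hno2.
        apply Hno. exists T. intros t Ht. apply Rnot_le_lt; intros Hle.
        apply Hno2; exists t; split; assumption. }
  destruct (Hsup f Hm) as [b [Hb [Hb1 Hb2]]].
  destruct (Hsup (fun t => - f t)) as [a' [Ha [Ha1 Ha2]]].
  { intros t Ht. rewrite Rabs_Ropp. now apply Hm. }
  exists (- a'), b. split; [lra|]. split.
  { apply Rnot_lt_le; intros Hlt.
    destruct (Hb2 ((- a' - b) / 2) ltac:(lra)) as [T1 H1].
    destruct (Ha2 ((- a' - b) / 2) ltac:(lra)) as [T2 H2].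
    specialize (H1 (Rmax T1 T2) (Rmax_l _ _)). specialize (H2 (Rmax T1 T2) (Rmax_r _ _)). lra. }
  split; [lra|]. intros theta; split.
  - intros Hc. split; apply Rnot_lt_le; intros Hlt.
    + destruct (Ha2 ((- a' - theta) / 2) ltac:(lra)) as [T HT].
      assert (He : 0 < (- a' - theta) / 2) by lra.
      destruct (Hc (mkposreal _ He) T) as [t [Ht Hd]]; simpl in Hd.
      specialize (HT t Ht). apply Rabs_lt_between in Hd. lra.
    + destruct (Hb2 ((theta - b) / 2) ltac:(lra)) as [T HT].
      assert (He : 0 < (theta - b) / 2) by lra.
      destruct (Hc (mkposreal _ He) T) as [t [Ht Hd]]; simpl in Hd.
      specialize (HT t Ht). apply Rabs_lt_between in Hd. lra.
  - intros Hth eps T.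
    destruct (Hb1 eps (cond_pos eps) T) as [t1 [Ht1 H1]].
    destruct (Ha1 eps (cond_pos eps) T) as [t2 [Ht2 H2]].
    pose proof (cond_pos eps) as He.
    destruct (Rlt_dec (f t1) (theta + eps)) as [L1|L1].
    { exists t1; split; [exact Ht1|]. apply Rabs_lt_between; lra. }
    destruct (Rlt_dec (theta - eps) (f t2)) as [L2|L2].
    { exists t2; split; [exact Ht2|]. apply Rabs_lt_between; lra. }
    destruct (IVT_gen f t1 t2 theta Hf) as [t [Ht E]].
    { rewrite Rmin_right, Rmax_left; lra. }
    exists t; split.
    + eapply Rle_trans; [|apply Ht]. now apply Rmin_glb.
    + rewrite E, Rminus_diag, Rabs_R0. exact He.
Qed.

Lemma cluster_transfer f g theta :
  (forall eps, 0 < eps -> exists T, forall t, T <= t -> Rabs (f t - g t) < eps) ->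
  cluster_point_at_infinity f theta -> cluster_point_at_infinity g theta.
Proof.
  intros Hfg Hf eps T. pose proof (cond_pos eps) as He.
  destruct (Hfg (eps / 2) ltac:(lra)) as [T1 HT1].
  assert (He2 : 0 < eps / 2) by lra.
  destruct (Hf (mkposreal _ He2) (Rmax T T1)) as [t [Ht Hd]]; simpl in Hd.
  exists t; split; [eapply Rle_trans; [apply Rmax_l|exact Ht]|].
  specialize (HT1 t (Rle_trans _ _ _ (Rmax_r _ _) Ht)).
  apply Rabs_lt_between in HT1. apply Rabs_lt_between in Hd. apply Rabs_lt_between. lra.
Qed.

Lemma compact_singleton z : compact_set (fun y => y = z).
Proof.
  intros I U _ Hc. destruct (Hc z eq_refl) as [i Hi].
  exists (cons i nil). intros y ->. exists i; split; [now left|exact Hi].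
Qed.

(** * Orbits of the semigroup *)

Section Trajectories.

Variables (phi : R -> C -> C) (tau : C) (h : C -> C).
Hypotheses (Hphi : holomorphic_semigroup phi) (Hdw : denjoy_wolff_point phi tau)
  (Htau : Cmod tau = 1) (Hh : koenigs_function phi h)
  (Hsector : contains_vertical_sector (disc_image h)).

Let Hself : forall t y, 0 <= t -> Cmod y < 1 -> Cmod (phi t y) < 1 :=
  hs_self_map _ Hphi.

(** [inverse_contraction] on the discs of radius c t around the points
    h(phi_t(z)) = h(z) + i t. *)
Lemma trajectories_hyperbolically_close :
  exists c, 0 < c <= 1 /\ forall z, Cmod z < 1 -> exists T, 0 < T /\
    forall t y, T <= t -> Cmod y < 1 ->
    c * t * Cmod (y - phi t z)%C
    <= Cmod (h y - (h z + Ci * RtoC t))%C * Cmod (1 - Cconj (phi t z) * y)%C.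
Proof.
  destruct (sector_contains_large_discs _ Hsector) as [c [Hc HB]].
  exists c; split; [exact Hc|]. intros z Hz.
  destruct (HB (h z)) as [T [HT HB']]. exists T; split; [exact HT|].
  intros t y Ht Hy.
  rewrite <- (kf_conjugation _ _ Hh t z ltac:(lra) Hz).
  apply inverse_contraction; [apply (kf_univalent _ _ Hh)|apply Hself; [lra|exact Hz]| |exact Hy].
  intros w Hw. rewrite (kf_conjugation _ _ Hh t z ltac:(lra) Hz) in Hw.
  exact (HB' t Ht w Hw).
Qed.

(** The main estimate: the orbit ends up in an angular sector of the half-plane. *)
Lemma cayley_orbit_sectorial z : Cmod z < 1 ->
  exists K T, 0 < K /\ 0 < T /\ forall t, T <= t ->
    Cmod (cayley tau (phi t z)) <= K * Re (cayley tau (phi t z)).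
Proof.
  intros Hz.
  destruct trajectories_hyperbolically_close as [c [Hc HTr]].
  destruct (HTr z Hz) as [T1 [HT1 Hclose]].
  destruct (univalent_image_not_plane h (kf_univalent _ _ Hh)) as [q Hq].
  pose proof (univalent_cdiff h (kf_univalent _ _ Hh)) as Hd.
  assert (Homit : forall y s, Cmod y < 1 -> 0 <= s -> h y <> (q - Ci * RtoC s)%C).
  { intros y s Hy Hs E. apply Hq.
    replace q with (h y + Ci * RtoC s)%C by (rewrite E; ring).
    apply (kf_starlike _ _ Hh); [exact Hs|now exists y]. }
  set (x := fun t => phi t z). set (P := fun t => cayley tau (x t)).
  assert (Hx : forall t, 0 <= t -> Cmod (x t) < 1) by (intros; now apply Hself).
  assert (Hhx : forall t, 0 <= t -> h (x t) = (h z + Ci * RtoC t)%C).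
  { intros t Ht. now apply (kf_conjugation _ _ Hh). }
  assert (Hadd : forall a t, 0 <= a -> 0 <= t -> phi a (x t) = x (t + a)).
  { intros a t Ha Ht. unfold x. rewrite Rplus_comm. symmetry. now apply (hs_add _ Hphi). }
  assert (Hmono : forall s t, 0 <= s <= t -> Re (P s) <= Re (P t)).
  { intros s t Hst. unfold P. replace t with (s + (t - s)) by ring.
    rewrite <- Hadd by lra. apply Re_cayley_nondecreasing; trivial; [lra|apply Hx; lra]. }
  assert (Hpos : forall t, 0 <= t -> 0 < Re (P t)).
  { intros t Ht. apply Re_cayley_pos; [exact Htau|now apply Hx]. }
  (* Beyond T, the points h(z) + i t are at distance at most 2 t from q. *)
  set (T := Rmax T1 (Cmod (h z - q)%C)).
  assert (HTT1 : T1 <= T) by apply Rmax_l.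
  assert (HTq : Cmod (h z - q)%C <= T) by apply Rmax_r.
  assert (Hdist : forall s t th, T <= t <= s -> s - t <= th * (c * t) ->
    Cmod (x s - x t)%C <= th * Cmod (1 - Cconj (x t) * x s)%C).
  { intros s t th Hst Hth.
    pose proof (Hclose t (x s) ltac:(lra) (Hx s ltac:(lra))) as H.
    rewrite Hhx in H by lra.
    replace (h z + Ci * RtoC s - (h z + Ci * RtoC t))%C with (Ci * RtoC (s - t))%C in H
      by (rewrite RtoC_minus; ring).
    rewrite Cmod_mult, Cmod_Ci, Cmod_R, Rabs_pos_eq, Rmult_1_l in H by lra.
    apply Rmult_le_reg_l with (c * t); [apply Rmult_lt_0_compat; lra|].
    fold (x t) in H. eapply Rle_trans; [exact H|].
    replace (c * t * (th * Cmod (1 - Cconj (x t) * x s)%C))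
      with (th * (c * t) * Cmod (1 - Cconj (x t) * x s)%C) by ring.
    apply Rmult_le_compat_r; [apply Cmod_ge_0|exact Hth]. }
  assert (Hcayg : forall y, Cmod y < 1 -> cdiff (cayley tau) y /\ 0 <= Re (cayley tau y)).
  { intros y Hy; split; [now apply cdiff_cayley|left; now apply Re_cayley_pos]. }
  assert (Hfar : forall s t th, T <= t <= s -> s - t <= th * (c * t) ->
     (1 - th) * Cmod (P s - P t)%C <= 2 * th * Re (P t)).
  { intros s t th Hst Hth. apply (harnack (cayley tau)); trivial; try (apply Hx; lra).
    now apply Hdist. }
  assert (Hhar : forall a s t th, 0 <= a -> T <= t <= s -> s - t <= th * (c * t) ->
     (1 - th) * Cmod ((P (s + a)%R - P s) - (P (t + a)%R - P t))%C
     <= 2 * th * Re (P (t + a)%R - P t)%C).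
  { intros a s t th Ha Hst Hth. unfold P. rewrite <- !Hadd by lra.
    apply (harnack (fun y => cayley tau (phi a y) - cayley tau y)%C); try (apply Hx; lra);
      [|now apply Hdist].
    intros y Hy. split.
    - apply cdiff_minus; [|now apply cdiff_cayley].
      apply (cdiff_comp (phi a) (cayley tau)); [|apply cdiff_cayley; [exact Htau|now apply Hself]].
      apply ex_derive_cdiff, (hs_holomorphic _ Hphi); assumption.
    - change (0 <= Re (cayley tau (phi a y)) - Re (cayley tau y)).
      pose proof (Re_cayley_nondecreasing phi tau a y Hphi Hdw Htau Ha Hy). lra. }
  assert (Hlow : forall a t, T <= t -> 0 <= a <= t ->
     a * Re (P t) <= 10 * t * Cmod (P (t + a)%R - P t)%C).
  { intros a t Ht Ha.
    pose proof (Hx t ltac:(lra)) as X1. pose proof (Hx (t + a) ltac:(lra)) as X2.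
    pose proof (slit_distortion h q (x t) (x (t + a)) Hd Homit X1 X2) as HS.
    rewrite !Hhx in HS by lra.
    replace (h z + Ci * RtoC (t + a) - (h z + Ci * RtoC t))%C with (Ci * RtoC a)%C in HS
      by (rewrite RtoC_plus; ring).
    rewrite Cmod_mult, Cmod_Ci, Cmod_R, Rabs_pos_eq, Rmult_1_l in HS by lra.
    assert (Hq' : forall s, 0 <= s -> Cmod (h z + Ci * RtoC s - q)%C <= T + s).
    { intros s Hs. replace (h z + Ci * RtoC s - q)%C with ((h z - q) + Ci * RtoC s)%C by ring.
      eapply Rle_trans; [apply Cmod_triangle|].
      rewrite Cmod_mult, Cmod_Ci, Cmod_R, Rabs_pos_eq by lra. lra. }
    pose proof (Hq' t ltac:(lra)) as Q1. pose proof (Hq' (t + a) ltac:(lra)) as Q2.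
    pose proof (Cmod_ge_0 (x (t + a)%R - x t)%C) as Px.
    assert (HS2 : a * Cmod (1 - Cconj (x t) * x (t + a)%R)%C
      <= 10 * t * Cmod (x (t + a)%R - x t)%C).
    { eapply Rle_trans; [exact HS|]. apply Rmult_le_compat_r; [exact Px|]. lra. }
    pose proof (cayley_pseudo_distance tau (x t) (x (t + a)) Htau X1 X2) as HC.
    fold (P t) (P (t + a)) in HC.
    pose proof (moebius_den_neq (x t) (x (t + a)) X1 X2) as Hn. apply Cmod_gt_0 in Hn.
    set (D := Cmod (1 - Cconj (x t) * x (t + a)%R)%C) in *.
    assert (Hge : Re (P t) <= Cmod (P (t + a)%R + Cconj (P t))%C).
    { pose proof (re_le_Cmod (P (t + a)%R + Cconj (P t))%C) as H.
      change (Re (P (t + a)%R + Cconj (P t))%C) with (Re (P (t + a)) + Re (P t)) in H.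
      pose proof (Hpos t ltac:(lra)). pose proof (Hpos (t + a) ltac:(lra)).
      rewrite Rabs_pos_eq in H by lra. lra. }
    apply Rmult_le_reg_r with (1 := Hn).
    replace (10 * t * Cmod (P (t + a)%R - P t)%C * D)
      with (10 * t * (Cmod (P (t + a)%R - P t)%C * D)) by ring.
    rewrite HC.
    apply Rle_trans with (a * D * Cmod (P (t + a)%R + Cconj (P t))%C).
    - replace (a * Re (P t) * D) with (a * D * Re (P t)) by ring.
      apply Rmult_le_compat_l; [apply Rmult_le_pos; lra|exact Hge].
    - apply Rmult_le_compat_r with (r := Cmod (P (t + a)%R + Cconj (P t))%C) in HS2;
        [lra|apply Cmod_ge_0]. }
  assert (HT : 0 < T) by lra.
  destruct (increment_direction P T c HT Hc Hmono Hfar Hhar Hlow) as [K [HK Hinc]].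
  set (B := Cmod (P T) + 2 * Re (P T)).
  pose proof (Hpos T ltac:(lra)) as HPT. pose proof (Cmod_ge_0 (P T)) as HPT'.
  assert (Htel : forall t, T <= t -> Cmod (P t) <= B + K * Re (P t)).
  { apply geometric_telescoping with (c / 2); trivial; try lra; try (unfold B; lra).
    - intros t Ht. left; apply Hpos; lra.
    - intros t Ht. specialize (Hfar t T (1 / 2) ltac:(lra) ltac:(lra)).
      pose proof (Cmod_tri_le (P t) (P T)). unfold B. lra. }
  exists (B / Re (P T) + K), T. repeat split.
  - apply Rplus_le_lt_0_compat; [|exact HK].
    apply Rmult_le_pos; [unfold B; lra|left; now apply Rinv_0_lt_compat].
  - exact HT.
  - intros t Ht. change (cayley tau (phi t z)) with (P t). specialize (Htel t Ht). specialize (Hmono T t ltac:(lra)).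
    assert (B <= B / Re (P T) * Re (P t)).
    { replace B with (B / Re (P T) * Re (P T)) at 1 by (field; lra).
      apply Rmult_le_compat_l; [|exact Hmono].
      apply Rmult_le_pos; [unfold B; lra|left; now apply Rinv_0_lt_compat]. }
    lra.
Qed.

Lemma orbit_nontangential z : Cmod z < 1 ->
  converges_nontangentially (fun t => phi t z) tau.
Proof.
  intros Hz. split; [now apply Hdw|].
  destruct (cayley_orbit_sectorial z Hz) as [K [T [HK [HT Hsec]]]].
  destruct (orbit_tends_to_dw _ _ _ Hdw Hz 1 ltac:(lra)) as [T' HT'].
  (* |tau + x| >= 1 near tau, and 1 - |x|^2 <= 2 (1 - |x|); the extra 2 makes
     the inequality strict and the constant larger than 1. *)
  exists (2 * K + 2); split; [lra|].
  exists (Rmax T T'). intros t Ht.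
  assert (Ht1 : T < t) by (eapply Rle_lt_trans; [apply Rmax_l|exact Ht]).
  assert (Ht2 : T' < t) by (eapply Rle_lt_trans; [apply Rmax_r|exact Ht]).
  specialize (Hsec t ltac:(lra)). specialize (HT' t Ht2).
  assert (Hx : Cmod (phi t z) < 1) by (apply Hself; [lra|exact Hz]).
  set (x := phi t z) in *.
  pose proof (Re_cayley tau x Htau Hx) as HRe.
  pose proof (cayley_den_neq tau x Htau Hx) as Hn.
  assert (HC : Cmod (cayley tau x) * Cmod (tau - x)%C = Cmod (tau + x)%C).
  { rewrite <- Cmod_mult. f_equal. unfold cayley; field; exact Hn. }
  apply Cmod_gt_0 in Hn. rewrite Cmod_sub_sym in HT'.
  assert (Hplus : 1 <= Cmod (tau + x)%C).
  { pose proof (Cmod_triangle (tau + x)%C (tau - x)%C) as Htr.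
    replace (tau + x + (tau - x))%C with (RtoC 2 * tau)%C in Htr
      by (apply injective_projections; simpl; ring).
    rewrite Cmod_mult, Cmod_R, Rabs_pos_eq, Htau in Htr by lra. lra. }
  pose proof (Cmod_ge_0 x) as Px.
  set (d := Cmod (tau - x)%C) in *.
  assert (H1 : d <= K * (1 - Cmod x ^ 2)).
  { rewrite <- HRe. apply Rle_trans with (Cmod (cayley tau x) * d * d).
    - rewrite HC. nra.
    - replace (K * (Re (cayley tau x) * d ^ 2)) with (K * Re (cayley tau x) * d * d) by ring.
      apply Rmult_le_compat_r; [lra|]. apply Rmult_le_compat_r; lra. }
  assert (H2 : K * (1 - Cmod x ^ 2) <= K * (2 * (1 - Cmod x)))
    by (apply Rmult_le_compat_l; nra).
  lra.
Qed.

(** The points phi_t(z) and phi_t(z') have images at the fixed distance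
    |h(z) - h(z')|, so their pseudo-hyperbolic distance is O(1/t). *)
Lemma cayley_orbits_asymptotic z z' : Cmod z < 1 -> Cmod z' < 1 ->
  forall dl, 0 < dl -> exists T, forall t, T <= t ->
    Cmod (cayley tau (phi t z') - cayley tau (phi t z))%C <= dl * Re (cayley tau (phi t z)).
Proof.
  intros Hz Hz' dl Hdl.
  destruct trajectories_hyperbolically_close as [c [Hc HTr]].
  destruct (HTr z Hz) as [T [HT Hclose]].
  set (A := Cmod (h z' - h z)%C). pose proof (Cmod_ge_0 (h z' - h z)%C) as HA. fold A in HA.
  set (th := Rmin (1 / 2) (dl / 4)).
  assert (Hth : 0 < th) by (apply Rmin_glb_lt; lra).
  assert (Hth1 : th <= 1 / 2) by apply Rmin_l. assert (Hth2 : th <= dl / 4) by apply Rmin_r.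
  exists (Rmax T (A / (c * th))). intros t Ht.
  assert (Ht1 : T <= t) by (eapply Rle_trans; [apply Rmax_l|exact Ht]).
  assert (Ht2 : A <= th * (c * t)).
  { assert (H : A / (c * th) <= t) by (eapply Rle_trans; [apply Rmax_r|exact Ht]).
    apply Rmult_le_compat_l with (r := c * th) in H; [|apply Rmult_le_pos; lra].
    replace (c * th * (A / (c * th))) with A in H by (field; lra). lra. }
  assert (X1 : Cmod (phi t z) < 1) by (apply Hself; [lra|exact Hz]).
  assert (X2 : Cmod (phi t z') < 1) by (apply Hself; [lra|exact Hz']).
  pose proof (Hclose t (phi t z') Ht1 X2) as H.
  rewrite (kf_conjugation _ _ Hh t z' ltac:(lra) Hz') in H.
  replace (h z' + Ci * RtoC t - (h z + Ci * RtoC t))%C with (h z' - h z)%C in H by ring.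
  fold A in H.
  pose proof (harnack (cayley tau) (phi t z) (phi t z') th) as Hk.
  assert (HX : 0 < Re (cayley tau (phi t z))) by now apply Re_cayley_pos.
  pose proof (Cmod_ge_0 (cayley tau (phi t z') - cayley tau (phi t z))%C).
  assert (Hk' : (1 - th) * Cmod (cayley tau (phi t z') - cayley tau (phi t z))%C
    <= 2 * th * Re (cayley tau (phi t z))).
  { apply Hk; trivial.
    - intros y Hy; split; [now apply cdiff_cayley|left; now apply Re_cayley_pos].
    - apply Rmult_le_reg_l with (c * t); [apply Rmult_lt_0_compat; lra|].
      eapply Rle_trans; [exact H|].
      replace (c * t * (th * Cmod (1 - Cconj (phi t z) * phi t z')%C))
        with (th * (c * t) * Cmod (1 - Cconj (phi t z) * phi t z')%C) by ring.
      apply Rmult_le_compat_r; [apply Cmod_ge_0|exact Ht2]. }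
  nra.
Qed.

Lemma args_asymptotic z z' : Cmod z < 1 -> Cmod z' < 1 ->
  forall eps, 0 < eps -> exists T, forall t, T <= t ->
    Rabs (Arg (1 - Cconj tau * phi t z)%C - Arg (1 - Cconj tau * phi t z')%C) < eps.
Proof.
  intros Hz Hz' eps He.
  destruct (cayley_orbit_sectorial z Hz) as [K [T1 [HK [HT1 Hsec]]]].
  set (dl := Rmin (1 / 2) (eps / (4 * (1 + K)))).
  assert (Hdl : 0 < dl).
  { apply Rmin_glb_lt; [lra|apply Rdiv_lt_0_compat; lra]. }
  assert (Hdl1 : dl <= 1 / 2) by apply Rmin_l.
  assert (Hdl2 : dl * (4 * (1 + K)) <= eps).
  { replace eps with (eps / (4 * (1 + K)) * (4 * (1 + K))) by (field; lra).
    apply Rmult_le_compat_r; [lra|apply Rmin_r]. }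
  destruct (cayley_orbits_asymptotic z z' Hz Hz' dl Hdl) as [T2 HT2].
  exists (Rmax T1 T2). intros t Ht.
  assert (Ht1 : T1 <= t) by (eapply Rle_trans; [apply Rmax_l|exact Ht]).
  assert (Ht2 : T2 <= t) by (eapply Rle_trans; [apply Rmax_r|exact Ht]).
  specialize (Hsec t Ht1). specialize (HT2 t Ht2).
  assert (X1 : Cmod (phi t z) < 1) by (apply Hself; [lra|exact Hz]).
  assert (X2 : Cmod (phi t z') < 1) by (apply Hself; [lra|exact Hz']).
  rewrite !Arg_cayley by assumption.
  pose proof (Re_cayley_pos tau _ Htau X1) as P1. pose proof (Re_cayley_pos tau _ Htau X2) as P2.
  set (p := cayley tau (phi t z)) in *. set (p' := cayley tau (phi t z')) in *.
  pose proof (re_le_Cmod (p' - p)%C) as R1. pose proof (im_le_Cmod (p' - p)%C) as R2.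
  change (Re (p' - p)%C) with (Re p' - Re p) in R1.
  change (Im (p' - p)%C) with (Im p' - Im p) in R2.
  pose proof (im_le_Cmod p) as R3.
  replace (- atan (Im p / (Re p + 1)) - - atan (Im p' / (Re p' + 1)))
    with (atan (Im p' / (Re p' + 1)) - atan (Im p / (Re p + 1))) by ring.
  eapply Rle_lt_trans; [apply atan_lipschitz|].
  replace (Im p' / (Re p' + 1) - Im p / (Re p + 1))
    with (((Im p' - Im p) * (Re p + 1) - Im p * (Re p' - Re p)) / ((Re p + 1) * (Re p' + 1)))
    by (field; lra).
  unfold Rdiv. rewrite Rabs_mult, Rabs_inv.
  rewrite (Rabs_pos_eq ((Re p + 1) * (Re p' + 1))) by (apply Rmult_le_pos; lra).
  assert (HD : 0 < (Re p + 1) * (Re p' + 1)) by (apply Rmult_lt_0_compat; lra).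
  apply Rmult_lt_reg_r with (1 := HD). rewrite Rmult_assoc, Rinv_l, Rmult_1_r by lra.
  eapply Rle_lt_trans; [apply Rabs_triang|]. rewrite Rabs_Ropp, !Rabs_mult.
  rewrite (Rabs_pos_eq (Re p + 1)) by lra.
  assert (B1 : Rabs (Im p' - Im p) * (Re p + 1) <= dl * Re p * (Re p + 1))
    by (apply Rmult_le_compat_r; lra).
  assert (B2 : Rabs (Im p) * Rabs (Re p' - Re p) <= K * Re p * (dl * Re p))
    by (apply Rmult_le_compat; try apply Rabs_pos; lra).
  assert (Hhalf : Re p <= 2 * Re p').
  { apply Rabs_le_between in R1. nra. }
  assert (B3 : dl * Re p * (Re p + 1) + K * Re p * (dl * Re p)
     <= dl * (1 + K) * (Re p * (Re p + 1))).
  { assert (0 <= K * (dl * Re p)) by (apply Rmult_le_pos; [lra|apply Rmult_le_pos; lra]). lra. }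
  assert (B4 : Re p * (Re p + 1) <= 2 * ((Re p + 1) * (Re p' + 1))) by nra.
  assert (B5 : dl * (1 + K) * (Re p * (Re p + 1))
    <= dl * (1 + K) * (2 * ((Re p + 1) * (Re p' + 1)))).
  { apply Rmult_le_compat_l; [apply Rmult_le_pos; lra|exact B4]. }
  assert (B6 : dl * (4 * (1 + K)) * ((Re p + 1) * (Re p' + 1))
    <= eps * ((Re p + 1) * (Re p' + 1))) by (apply Rmult_le_compat_r; lra).
  assert (0 < eps * ((Re p + 1) * (Re p' + 1))) by now apply Rmult_lt_0_compat.
  lra.
Qed.

(** Time enters through its absolute value to have a function continuous on the
    whole line. *)
Lemma orbit_part_continuous (F : C -> R) z :
  (forall y y', Rabs (F y - F y') <= Cmod (y - y')%C) -> Cmod z < 1 ->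
  continuity (fun t => F (cayley tau (phi (Rabs t) z))).
Proof.
  intros HF Hz t eps He.
  assert (Hx : Cmod (phi (Rabs t) z) < 1) by (apply Hself; [apply Rabs_pos|exact Hz]).
  destruct (cdiff_cont _ _ (cdiff_cayley tau _ Htau Hx) eps He) as [d [Hd Hn]].
  destruct (hs_continuous _ Hphi (fun y => y = z) (compact_singleton z)
    (fun y Hy => eq_ind_r unit_disc Hz Hy) (Rabs t) (Rabs_pos t) (mkposreal d Hd)) as [dl Hdl].
  exists dl; split; [apply cond_pos|]. intros s [_ Hs]. simpl in *. unfold R_dist in *.
  eapply Rle_lt_trans; [apply HF|]. apply Hn.
  apply Hdl; [apply Rabs_pos| |reflexivity].
  eapply Rle_lt_trans; [apply Rabs_triang_inv2|exact Hs].
Qed.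

(** The bounds are those of the orbit of 0; [args_asymptotic] transfers them to
    every other orbit. *)
Lemma slope_is_interval :
  exists a b, - PI / 2 < a /\ a <= b /\ b < PI / 2 /\
    forall z, unit_disc z -> forall theta, slope phi tau z theta <-> a <= theta <= b.
Proof.
  assert (H0 : Cmod (RtoC 0) < 1) by (rewrite Cmod_0; lra).
  destruct (cayley_orbit_sectorial _ H0) as [K [T [HK [HT Hsec]]]].
  set (p := fun t => cayley tau (phi (Rabs t) (RtoC 0))).
  set (f := fun t => - atan (Im (p t) / (Re (p t) + 1))).
  assert (Hpp : forall t, 0 < Re (p t)).
  { intros t. apply Re_cayley_pos; [exact Htau|apply Hself; [apply Rabs_pos|exact H0]]. }
  assert (Hf : continuity f).
  { intros t. apply continuity_pt_opp.
    apply (continuity_pt_comp (fun t => Im (p t) / (Re (p t) + 1)) atan).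
    - apply (continuity_pt_div (fun t => Im (p t)) (fun t => Re (p t) + 1)).
      + apply (orbit_part_continuous Im); [|exact H0]. intros y y'.
        exact (im_le_Cmod (y - y')%C).
      + apply continuity_pt_plus; [|apply continuity_pt_const; now intros ? ?].
        apply (orbit_part_continuous Re); [|exact H0]. intros y y'.
        exact (re_le_Cmod (y - y')%C).
      + specialize (Hpp t). lra.
    - apply derivable_continuous_pt, derivable_pt_atan. }
  assert (HfArg : forall t, 0 <= t -> f t = Arg (1 - Cconj tau * phi t (RtoC 0))%C).
  { intros t Ht. unfold f, p. rewrite Rabs_pos_eq by exact Ht.
    symmetry; apply Arg_cayley; [exact Htau|now apply Hself]. }
  assert (Hb : forall t, T <= t -> Rabs (f t) <= atan K).
  { intros t Ht. specialize (Hsec t Ht). specialize (Hpp t).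
    unfold f. rewrite Rabs_Ropp. unfold p in *. rewrite (Rabs_pos_eq t) in * by lra.
    set (P := cayley tau (phi t (RtoC 0))) in *.
    pose proof (im_le_Cmod P) as Hi.
    assert (Hr : Rabs (Im P / (Re P + 1)) < K).
    { unfold Rdiv. rewrite Rabs_mult, Rabs_inv, (Rabs_pos_eq (Re P + 1)) by lra.
      apply Rmult_lt_reg_r with (Re P + 1); [lra|].
      rewrite Rmult_assoc, Rinv_l by lra. lra. }
    apply Rabs_lt_between in Hr. destruct Hr as [Hr1 Hr2].
    apply atan_increasing in Hr1, Hr2. rewrite atan_opp in Hr1.
    apply Rabs_le_between. lra. }
  destruct (cluster_set_interval f (atan K) T Hf Hb) as [a [b [Ha [Hab [Hb' Hcl]]]]].
  pose proof (atan_bound K) as HaK.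
  exists a, b. repeat split; try lra.
  all: assert (Hfz : forall eps, 0 < eps -> exists T', forall t, T' <= t ->
      Rabs (f t - Arg (1 - Cconj tau * phi t z)%C) < eps) by
    (intros eps He; destruct (args_asymptotic _ _ H0 H eps He) as [T' HT'];
     exists (Rmax T' 0); intros t Ht;
     rewrite HfArg by (eapply Rle_trans; [apply Rmax_r|exact Ht]);
     apply HT'; eapply Rle_trans; [apply Rmax_l|exact Ht]).
  1,2: apply Hcl; eapply cluster_transfer; [|eassumption];
    intros eps He; destruct (Hfz eps He) as [T' HT']; exists T'; intros t Ht;
    rewrite Rabs_minus_sym; now apply HT'.
  intros Hth. unfold slope. eapply cluster_transfer; [exact Hfz|]. apply Hcl; lra.
Qed.

End Trajectories.

Theorem corollary1p2 (phi : R -> C -> C) (tau : C) (h : C -> C)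
  (Hphi : parabolic_zero_hyperbolic_step phi)
  (Hdw : denjoy_wolff_point phi tau)
  (Htau : unit_circle tau)
  (Hh : koenigs_function phi h)
  (Hsector : contains_vertical_sector (disc_image h)) :
  (forall z, unit_disc z -> converges_nontangentially (fun t => phi t z) tau)
  /\
  (exists a b : R, - PI / 2 < a /\ a <= b /\ b < PI / 2 /\
    forall z, unit_disc z ->
    forall theta, slope phi tau z theta <-> a <= theta <= b).
Proof.
  destruct Hphi as [Hsg _]. split.
  - exact (orbit_nontangential phi tau h Hsg Hdw Htau Hh Hsector).
  - exact (slope_is_interval phi tau h Hsg Hdw Htau Hh Hsector).
Qed.
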